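(* Let $[X_{n,i}]_{n\ge1,i\in I}$ be a partially $\mathcal G$-c.i.d. array of real-valued, square-integrable random variables with directing random measures $(\alpha_i)_{i\in I}$. For $n\ge1$, $i\in I$ let $$S_{n,i}=\frac1{\sqrt n}\sum_{k=1}^n\big(X_{k,i}-\mathbb E[X_{k,i}\mid\mathcal G_{k-1}]\big),\qquad \mathbf S_n^I=(S_{n,i})_{i\in I}.$$ Then $(\mathbf S_n^I)_{n\ge1}$ converges stably with representing measure $\mathcal N(0,\Sigma)$, where $\Sigma$ is the random diagonal covariance given by $\Sigma(e_i,e_i)=\sigma^2_{\alpha_i}:=\int x^2\alpha_i(dx)-\big(\int x\,\alpha_i(dx)\big)^2$ and $\Sigma(e_i,e_j)=0$ for $i\ne j$.
   Context: All random elements live on $(\Omega,\mathcal F,\mathbb P)$; $I$ is finite or countable; here $\mathbb X=\mathbb R$. For a filtration $\mathcal G=(\mathcal G_n)_{n\ge0}$ and $j\in I$, $\mathcal G_n^j=\mathcal G_n\vee\sigma(X_{n+1,i}:i\ne j)$. The array (rows $\mathbf X_n^I=(X_{n,i})_{i\in I}$) is partially $\mathcal G$-c.i.d. if it is adapted to $\mathcal G$ and $\mathbb E[f(X_{n+1,j})\mid\mathcal G_n^j]=\mathbb E[f(X_{n+k,j})\mid\mathcal G_n^j]$ a.s. for all $j\in I$, $k\ge1$, $n\ge0$ and bounded measurable $f$; then $\mathbb P[X_{n+1,i}\in\cdot\mid\mathcal G_n]$ converges weakly a.s. to a random probability measure $\alpha_i$ (directing random measure of column $i$). $(e_i)_{i\in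 I}$ is the canonical basis of $\mathbb R^I$ ($\mathbb R^I$ with the product topology). For a (random) symmetric positive semidefinite form $\Sigma$ on $\mathbb R^I$, $\mathcal N(0,\Sigma)$ is the centered Gaussian measure on $\mathbb R^I$ whose finite-dimensional marginal on $\mathbb R^J$ ($J$ finite) is centered Gaussian with covariance matrix $(\Sigma(e_i,e_j))_{i,j\in J}$. A sequence $(Z_n)$ of random elements of a Polish space converges stably with representing random measure $\beta(\cdot;\omega)$ if for every $A\in\mathcal F$ and every bounded continuous $g$, $\mathbb E[\mathbf 1_A g(Z_n)]\to\int_A\int g\,d\beta(\cdot;\omega)\,\mathbb P(d\omega)$. *)

(* Defs.v *)
From HB Require Import structures.
From mathcomp Require Import all_boot all_order all_algebra.
From mathcomp Require Import all_classical all_reals all_analysis.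
From mathcomp Require Import measurable_realfun normal_distribution.
Import Order.TTheory GRing.Theory Num.Theory.
Import numFieldNormedType.Exports.

Set Implicit Arguments.
Unset Strict Implicit.
Unset Printing Implicit Defensive.

Local Open Scope classical_set_scope.
Local Open Scope ring_scope.

Section Defs.
Context {R : realType} {d : measure_display} {T : measurableType d}.

Definition sub_sigma (G : set (set T)) :=
  sigma_algebra setT G /\ G `<=` measurable.

Definition filtration (G : nat -> set (set T)) :=
  (forall n, sub_sigma (G n)) /\ (forall n, G n `<=` G n.+1).

Definition G_measurable (G : set (set T)) (Y : T -> R) :=
  forall B : set R, measurable B -> G (Y @^-1` B).

Definition is_cond_exp (P : probability T R) (G : set (set T)) (X Y : T -> R) :=
  [/\ G_measurable G Y, P.-integrable setT (EFin \o Y) &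
      forall A, G A -> (\int[P]_(w in A) (Y w)%:E = \int[P]_(w in A) (X w)%:E)%E].

(** E[X | G]: a (chosen) version of the conditional expectation
    (the constant 0 function if no version exists). *)
Definition cond_exp (P : probability T R) (G : set (set T)) (X : T -> R) : T -> R :=
  xget (fun _ => 0) [set Y | is_cond_exp P G X Y].

Context {I : countType}.

Definition Gnj (G : nat -> set (set T)) (X : nat -> I -> T -> R) (n : nat) (j : I)
  : set (set T) :=
  <<s G n `|` [set A | exists i B, [/\ i != j, measurable (B : set R) &
                                       A = X n.+1 i @^-1` B]] >>.

(** The array (rows X_n = (X_{n,i})_{i in I}, n >= 1; X 0 is unused)
    is partially G-c.i.d. *)
Definition partially_cid (P : probability T R) (G : nat -> set (set T))
    (X : nat -> I -> T -> R) :=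
  [/\ filtration G,
      (forall n i, (1 <= n)%N -> G_measurable (G n) (X n i)) &
      forall (j : I) (n k : nat) (f : R -> R), (1 <= k)%N ->
        measurable_fun setT f -> (exists M : R, forall x, `|f x| <= M) ->
        {ae P, forall w, cond_exp P (Gnj G X n j) (f \o X n.+1 j) w =
                         cond_exp P (Gnj G X n j) (f \o X (n + k)%N j) w}].

Definition weak_conv (mu : nat -> probability R R) (nu : probability R R) :=
  forall f : R -> R, continuous f -> (exists M : R, forall x, `|f x| <= M) ->
    (fun n => (\int[mu n]_x (f x)%:E)%E) @ \oo --> (\int[nu]_x (f x)%:E)%E.

Definition reg_cond_distr (P : probability T R) (G : set (set T)) (Y : T -> R)
    (K : T -> probability R R) :=
  forall B : set R, measurable B ->
    is_cond_exp P G (\1_(Y @^-1` B)) (fun w => fine (K w B)).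

Definition random_prob {d' : measure_display} {U : measurableType d'}
    (mu : T -> probability U R) :=
  forall B : set U, measurable B -> measurable_fun [set: T] ((mu ^~ B) : T -> \bar R).

Definition directing (P : probability T R) (G : nat -> set (set T))
    (X : nat -> I -> T -> R) (alpha : I -> T -> probability R R) :=
  forall i, random_prob (alpha i) /\ exists K : nat -> T -> probability R R,
    (forall n, reg_cond_distr P (G n) (X n.+1 i) (K n)) /\
    {ae P, forall w, weak_conv (fun n => K n w) (alpha i w)}.

End Defs.

Definition variance_of {R : realType} (mu : probability R R) : R :=
  fine (\int[mu]_x (x ^+ 2)%:E)%E - (fine (\int[mu]_x x%:E)%E) ^+ 2.

Definition gauss1 {R : realType} (m v : R) : set R -> \bar R :=
  if v == 0 then @dirac _ R m R else normal_prob m (Num.sqrt v).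

Definition coord_sets (I : Type) (R : realType) : set (set (I -> R)) :=
  [set A | exists i (B : set R), measurable B /\ A = (fun x => x i) @^-1` B].

Definition RI (I : Type) (R : realType) := g_sigma_algebraType (@coord_sets I R).

(** mu = N(0, C) on R^I: every finite-dimensional marginal (on R^J, J finite)
    is centered Gaussian with covariance matrix (C i j)_{i,j in J}; a random
    vector of R^J being centered Gaussian with covariance matrix C means that
    every linear combination sum_j t_j x_j has law N(0, t^T C t). *)
Definition is_centered_gaussian {I : countType} {R : realType}
    (mu : set (RI I R) -> \bar R) (C : I -> I -> R) :=
  forall (J : seq I) (t : I -> R), uniq J ->
    forall B : set R, measurable B ->
      mu ((fun x : I -> R => \sum_(j <- J) t j * x j) @^-1` B) =
      gauss1 0 (\sum_(i <- J) \sum_(j <- J) t i * t j * C i j) B.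

Definition stable_conv {R : realType} {d : measure_display} {T : measurableType d}
    {I : countType} (P : probability T R) (Z : nat -> T -> (I -> R))
    (beta : T -> probability (RI I R) R) :=
  random_prob beta /\ forall A : set T, measurable A ->
  forall g : (I -> R) -> R, continuous (g : {ptws I -> R} -> R) ->
    (exists M : R, forall x, `|g x| <= M) ->
    (fun n => (\int[P]_(w in A) (g (Z n w))%:E)%E) @ \oo -->
      (\int[P]_(w in A) (\int[beta w]_y (g y)%:E))%E.

Definition Sn {R : realType} {d : measure_display} {T : measurableType d}
    {I : countType} (P : probability T R) (G : nat -> set (set T))
    (X : nat -> I -> T -> R) (n : nat) (w : T) : I -> R :=
  fun i => (Num.sqrt (n%:R))^-1 *
    \sum_(1 <= k < n.+1) (X k i w - cond_exp P (G k.-1) (X k i) w).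

(* Main.v *)
Require Import Defs.
From HB Require Import structures.
From mathcomp Require Import all_boot all_order all_algebra.
From mathcomp Require Import all_classical all_reals all_analysis.
From mathcomp Require Import measurable_realfun normal_distribution.
From mathcomp Require Import ring lra.
Import Order.TTheory GRing.Theory Num.Theory.
Import numFieldNormedType.Exports.

Set Implicit Arguments.
Unset Strict Implicit.
Unset Printing Implicit Defensive.

Local Open Scope classical_set_scope.
Local Open Scope ring_scope.

(** Stable convergence reduces to [E[1_A cos (th + t . S_n)]] for finitely supported
    [t] and phases [th] (which stand in for complex exponentials): the [S_n] have
    second moments bounded coordinatewise, hence are tight in [R^I], and a bounded
    continuous [g] on [R^I] is approximated, uniformly on compact boxes and with the
    same sup norm, by trigonometric polynomials in finitely many coordinates.

    For the cosines, [1_A] is replaced by a [G_m]-measurable variable, and the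
    Gaussian factor is traded for martingale increments one index at a time. The
    Taylor errors are controlled by the conditional variances given [G_k], which
    converge to the variances of the directing measures; unbounded variables are
    truncated at a level independent of [n]. The covariances of distinct columns
    vanish because, given the other columns of row [k + 1], partial conditional
    identity in distribution replaces [f X_{k+1,j}] by [f X_{k+l,j}] for every [l],
    hence by [alpha_j f], and [E[f X_{k+1,j} | G_k]] is close to [alpha_j f]. *)

(** * Bounded and integrable random variables *)

(** The event [A] is arbitrary and need not belong to any [G n]; this is what stability adds to
    convergence in law. The martingale [E[1_A | G_m]] is Cauchy in L^2, so for large [m] its term of
    index [m] can replace [1_A] against every variable bounded by 1 and measurable for a later
    [G_n], in particular against functions of [S_n].

    The limiting variance is random, so it cannot be put in an exponent next to a function of the
    past and still leave a variable measurable for that past. It is therefore frozen at the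
    conditional variance of the same time [m]; the increments before [m] are negligible after
    division by the square root of [n]. For bounded increments each exchange costs order [n^(-3/2)]
    plus [1/n] times the freezing error, which is affordable [n] times.

    Weak convergence of the predictive laws only speaks of bounded continuous functions, which is
    why a continuous truncation of the array is treated first. The truncation remainder is again a
    normalized martingale, and its second moment is bounded uniformly in [n] because each column is
    identically distributed. *)

Lemma cvgn_unique {R : realType} (u : nat -> R) (a b : R) :
  u n @[n --> \oo] --> a -> u n @[n --> \oo] --> b -> a = b.
Proof. by move=> ua; apply: cvg_unique ua. Qed.

Lemma cvgn_le_cst {R : realType} (u : nat -> R) (l C : R) :
  u n @[n --> \oo] --> l -> (forall n, u n <= C) -> l <= C.
Proof.
move=> ul uC; have /cvg_lim <- // := ul; apply: limr_le; last exact: nearW.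
by apply/cvg_ex; exists l.
Qed.

Section bounded_variables.
Context {R : realType} {d : measure_display} {T : measurableType d}.
Implicit Types f g : T -> R.

Definition bounded_rv f :=
  measurable_fun [set: T] f /\ exists M : R, forall x, `|f x| <= M.

Lemma bounded_rv_measurable f : bounded_rv f -> measurable_fun setT f.
Proof. by case. Qed.

Lemma bounded_rv_cst c : bounded_rv (fun _ => c).
Proof. by split; [exact: measurable_cst | exists `|c|]. Qed.

Lemma bounded_rvD f g : bounded_rv f -> bounded_rv g ->
  bounded_rv (fun x => f x + g x).
Proof.
move=> [mf [M fM]] [mg [N gN]]; split; first exact: measurable_funD.
by exists (M + N) => x; rewrite (le_trans (ler_normD _ _))// lerD.
Qed.

Lemma bounded_rvN f : bounded_rv f -> bounded_rv (fun x => - f x).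
Proof.
move=> [mf [M fM]]; split; first exact: measurableT_comp.
by exists M => x; rewrite normrN.
Qed.

Lemma bounded_rvB f g : bounded_rv f -> bounded_rv g ->
  bounded_rv (fun x => f x - g x).
Proof. by move=> bf bg; apply: bounded_rvD => //; exact: bounded_rvN. Qed.

Lemma bounded_rvM f g : bounded_rv f -> bounded_rv g ->
  bounded_rv (fun x => f x * g x).
Proof.
move=> [mf [M fM]] [mg [N gN]]; split; first exact: measurable_funM.
by exists (M * N) => x; rewrite normrM ler_pM.
Qed.

Lemma bounded_rvX f n : bounded_rv f -> bounded_rv (fun x => f x ^+ n).
Proof.
move=> bf; elim: n => [|n ih]; first by under eq_fun do rewrite expr0; exact: bounded_rv_cst.
by under eq_fun do rewrite exprS; exact: bounded_rvM.
Qed.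

Lemma bounded_rv_sum (J : Type) (s : seq J) (h : J -> T -> R) :
  (forall j, bounded_rv (h j)) -> bounded_rv (fun x => \sum_(j <- s) h j x).
Proof.
move=> bh; elim: s => [|a s ih].
  by under eq_fun do rewrite big_nil; exact: bounded_rv_cst.
by under eq_fun do rewrite big_cons; exact: bounded_rvD.
Qed.

Lemma bounded_rv_norm f : bounded_rv f -> bounded_rv (fun x => `|f x|).
Proof.
move=> [mf [M fM]]; split; first exact: measurableT_comp.
by exists M => x; rewrite normr_id.
Qed.

Lemma measurable_norm_le f (c : R) : measurable_fun setT f ->
  measurable [set x | `|f x| <= c].
Proof.
move=> mf; rewrite -[X in measurable X]setTI.
by apply: measurable_fun_le => //; exact: measurableT_comp.
Qed.

Lemma bounded_rv_indic (A : set T) : measurable A -> bounded_rv (\1_A : T -> R).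
Proof.
move=> mA; split; first exact: measurable_indic.
by exists 1 => x; rewrite indicE; case: (_ \in _); rewrite ?normr1 ?normr0.
Qed.

Lemma bounded_rv_comp (h : R -> R) f : measurable_fun setT h ->
  (exists M, forall x, `|h x| <= M) -> measurable_fun setT f ->
  bounded_rv (fun x => h (f x)).
Proof.
move=> mh [M hM] mf; split; first exact: measurableT_comp.
by exists M => x.
Qed.

Lemma measurable_cos (D : set R) : measurable_fun D (cos : R -> R).
Proof.
by apply: measurable_funTS; apply: continuous_measurable_fun; exact: continuous_cos.
Qed.

Lemma measurable_sin (D : set R) : measurable_fun D (sin : R -> R).
Proof.
by apply: measurable_funTS; apply: continuous_measurable_fun; exact: continuous_sin.
Qed.

Lemma cos_norm_le1 (x : R) : `|cos x| <= 1.
Proof. by rewrite ler_norml cos_geN1 cos_le1. Qed.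

Lemma sin_norm_le1 (x : R) : `|sin x| <= 1.
Proof. by rewrite ler_norml sin_geN1 sin_le1. Qed.

Lemma bounded_rv_cos f : measurable_fun setT f -> bounded_rv (fun x => cos (f x)).
Proof.
move=> mf; apply: bounded_rv_comp => //; first exact: measurable_cos.
by exists 1; exact: cos_norm_le1.
Qed.

Lemma bounded_rv_sin f : measurable_fun setT f -> bounded_rv (fun x => sin (f x)).
Proof.
move=> mf; apply: bounded_rv_comp => //; first exact: measurable_sin.
by exists 1; exact: sin_norm_le1.
Qed.

Lemma bounded_rv_expN f : measurable_fun setT f -> (forall x, 0 <= f x) ->
  bounded_rv (fun x => expR (- f x)).
Proof.
move=> mf f0; split.
  by apply: measurableT_comp => //; exact: measurableT_comp.
by exists 1 => x; rewrite ger0_norm ?expR_ge0// expR_le1 oppr_le0.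
Qed.

Import HBSimple HBNNSimple.

(** The standard machine as an induction principle, with bounded pointwise limits so that dominated
    convergence settles the last case. Simple functions approximate a nonnegative bounded function
    from below, hence stay under its bound. *)
Lemma bounded_rv_ind (Q : (T -> R) -> Prop) :
  (forall A, measurable A -> Q \1_A) ->
  (forall c f g, bounded_rv f -> bounded_rv g -> Q f -> Q g ->
     Q (fun x => c * f x + g x)) ->
  (forall (h : nat -> T -> R) f (M : R), (forall n, bounded_rv (h n)) -> bounded_rv f ->
     (forall n x, `|h n x| <= M) -> (forall x, h n x @[n --> \oo] --> f x) ->
     (forall n, Q (h n)) -> Q f) ->
  forall f, bounded_rv f -> Q f.
Proof.
move=> Q1 QD Qlim f bf.
have Q0 : Q (fun _ => 0).
  by have := Q1 set0 measurable0; rewrite indic0.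
have Qsum (J : Type) (s : seq J) (c : J -> R) (B : J -> set T) :
    (forall j, measurable (B j)) -> Q (fun x => \sum_(j <- s) c j * \1_(B j) x).
  move=> mB; elim: s => [|a s ih].
    by under [X in Q X]eq_fun do rewrite big_nil.
  under [X in Q X]eq_fun do rewrite big_cons.
  apply: QD => //; [exact: bounded_rv_indic|apply: bounded_rv_sum => j| exact: Q1].
  by apply: bounded_rvM; [exact: bounded_rv_cst|exact: bounded_rv_indic].
have Qge0 g : bounded_rv g -> (forall x, 0 <= g x) -> Q g.
  move=> /[dup] bg [mg [M gM]] g0.
  have mE : measurable_fun setT (EFin \o g) by exact/measurable_EFinP.
  pose h := nnsfun_approx measurableT mE.
  have hcv x : h n x @[n --> \oo] --> g x.
    have : EFin \o h ^~ x @ \oo --> (EFin \o g) x.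
      apply: (@cvg_nnsfun_approx _ _ _ _ measurableT _ mE) => //.
      by move=> y _; rewrite /= lee_fin.
    by move/fine_cvg.
  have hle n x : `|h n x| <= M.
    rewrite ger0_norm//; apply: le_trans (gM x); apply: le_trans (ler_norm _).
    have /cvg_lim <- // := hcv x.
    apply: nondecreasing_cvgn_le; last by apply/cvg_ex; exists (g x).
    by move=> a b ab; have /lefP := nd_nnsfun_approx measurableT mE ab; exact.
  apply: (Qlim (fun n => h n : T -> R) g M) => // n.
    by split=> //; exists M.
  have [s hs] : exists s : seq R, forall x,
      h n x = \sum_(y <- s) y * \1_(h n @^-1` [set y]) x.
    by eexists => x; rewrite fimfunE fsbig_finite//; reflexivity.
  rewrite (_ : (h n : T -> R) = (fun x => \sum_(y <- s)
      y * \1_(h n @^-1` [set y]) x)); last exact/funext.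
  by apply: Qsum => j; exact: measurable_sfunP.
have [mf [M fM]] := bf.
have bM : bounded_rv (fun x => f x + M).
  by apply: bounded_rvD => //; exact: bounded_rv_cst.
(* Adding the bound [M] makes the function nonnegative; the constant is returned as a multiple of an
   indicator. *)
have -> : f = (fun x => - M * \1_[set: T] x + (f x + M)).
  by apply/funext => x; rewrite indicE in_setT mulr1; lra.
apply: QD => //; [exact: bounded_rv_indic|exact: Q1|apply: Qge0 => // x].
by have := fM x; rewrite ler_norml => /andP[]; lra.
Qed.

End bounded_variables.

Section expectation.
Context {R : realType} {d : measure_display} {T : measurableType d}.
Variable P : probability T R.
Implicit Types f g : T -> R.

Definition integrable_rv f := P.-integrable setT (EFin \o f).

(** An infinite integral is sent to 0, so integrability has to be carried separately. *)
Definition expect f : R := fine (\int[P]_x (f x)%:E)%E.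

Lemma integrable_rv_measurable f : integrable_rv f -> measurable_fun setT f.
Proof. by move/measurable_int/measurable_EFinP. Qed.

Lemma bounded_integrable f : bounded_rv f -> integrable_rv f.
Proof.
move=> [mf [M fM]]; apply: measurable_bounded_integrable => //.
  by rewrite -ge0_fin_numE// fin_num_measure.
exists M; split; first exact: num_real.
by move=> N MN x _ /=; rewrite (le_trans (fM x))// ltW.
Qed.

Lemma integrable_rvD f g : integrable_rv f -> integrable_rv g ->
  integrable_rv (fun x => f x + g x).
Proof. by move=> fi gi; apply: (integrableD _ fi gi). Qed.

Lemma integrable_rvB f g : integrable_rv f -> integrable_rv g ->
  integrable_rv (fun x => f x - g x).
Proof. by move=> fi gi; apply: (integrableB _ fi gi). Qed.

Lemma integrable_rvZ c f : integrable_rv f -> integrable_rv (fun x => c * f x).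
Proof. by move=> fi; apply: (integrableZl _ c fi). Qed.

Lemma integrable_rv_norm f : integrable_rv f -> integrable_rv (fun x => `|f x|).
Proof. by move=> fi; apply: (integrable_abse fi). Qed.

Lemma integrable_rv_le f g : measurable_fun setT f -> integrable_rv g ->
  (forall x, `|f x| <= g x) -> integrable_rv f.
Proof.
move=> mf gi fg; apply: le_integrable gi => //.
  exact/measurable_EFinP.
by move=> x _ /=; rewrite lee_fin (le_trans (fg x))// ler_norm.
Qed.

Lemma integrable_rvMb f g : bounded_rv f -> integrable_rv g ->
  integrable_rv (fun x => f x * g x).
Proof.
move=> [mf [M fM]] gi.
apply: (@integrable_rv_le _ (fun x => M * `|g x|)).
- by apply: measurable_funM => //; exact: integrable_rv_measurable.
- by apply: integrable_rvZ; exact: integrable_rv_norm.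
- by move=> x; rewrite normrM ler_wpM2r.
Qed.

Lemma integrable_rv_sum (J : Type) (s : seq J) (h : J -> T -> R) :
  (forall j, integrable_rv (h j)) -> integrable_rv (fun x => \sum_(j <- s) h j x).
Proof.
move=> bh; elim: s => [|a s ih].
  by under eq_fun do rewrite big_nil; apply: bounded_integrable; exact: bounded_rv_cst.
by under eq_fun do rewrite big_cons; exact: integrable_rvD.
Qed.

Lemma expectK f : integrable_rv f -> (\int[P]_x (f x)%:E)%E = (expect f)%:E.
Proof. by move=> fi; rewrite /expect fineK//; exact: integrable_fin_num. Qed.

Lemma expect_cst c : expect (fun _ => c) = c.
Proof.
rewrite /expect (integral_cst P)//.
by have /= -> := @probability_setT _ _ _ P; rewrite mule1.
Qed.

Lemma expectD f g : integrable_rv f -> integrable_rv g ->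
  expect (fun x => f x + g x) = expect f + expect g.
Proof. by move=> fi gi; apply: (@RintegralD _ _ _ P setT f g). Qed.

Lemma expectB f g : integrable_rv f -> integrable_rv g ->
  expect (fun x => f x - g x) = expect f - expect g.
Proof. by move=> fi gi; apply: (@RintegralB _ _ _ P setT f g). Qed.

Lemma expectZ c f : integrable_rv f -> expect (fun x => c * f x) = c * expect f.
Proof. by move=> fi; apply: (@RintegralZl _ _ _ P setT f c). Qed.

Lemma expect_sum (J : Type) (s : seq J) (h : J -> T -> R) :
  (forall j, integrable_rv (h j)) ->
  expect (fun x => \sum_(j <- s) h j x) = \sum_(j <- s) expect (h j).
Proof.
move=> hi; elim: s => [|a s ih].
  by under [in LHS]eq_fun do rewrite big_nil; rewrite big_nil expect_cst.
under [in LHS]eq_fun do rewrite big_cons.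
by rewrite big_cons expectD ?ih//; exact: integrable_rv_sum.
Qed.

Lemma expect_le f g : integrable_rv f -> integrable_rv g ->
  (forall x, f x <= g x) -> expect f <= expect g.
Proof. by move=> fi gi fg; apply: (@le_Rintegral _ _ _ P setT f g). Qed.

Lemma expect_ge0 f : (forall x, 0 <= f x) -> 0 <= expect f.
Proof. by move=> f0; apply: (@Rintegral_ge0 _ _ _ P setT f). Qed.

Lemma expect_norm f : integrable_rv f -> `|expect f| <= expect (fun x => `|f x|).
Proof. by move=> fi; apply: (@le_normr_Rintegral _ _ _ P setT f). Qed.

Lemma expect_norm_le f g : integrable_rv f -> integrable_rv g ->
  (forall x, `|f x| <= g x) -> `|expect f| <= expect g.
Proof.
move=> fi gi fg; rewrite (le_trans (expect_norm fi))//.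
by apply: expect_le => //; exact: integrable_rv_norm.
Qed.

Lemma expect_bound f M : integrable_rv f -> (forall x, `|f x| <= M) ->
  `|expect f| <= M.
Proof.
move=> fi fM; rewrite -[leRHS](expect_cst M); apply: expect_norm_le => //.
by apply: bounded_integrable; exact: bounded_rv_cst.
Qed.

Lemma eq_expect_ae f g : measurable_fun setT f -> measurable_fun setT g ->
  {ae P, forall x, f x = g x} -> expect f = expect g.
Proof.
move=> mf mg fg; rewrite /expect; congr fine; apply: ae_eq_integral => //.
- exact/measurable_EFinP.
- exact/measurable_EFinP.
- by apply: filterS fg => x /= ->.
Qed.

(* AM-GM stands in for the Cauchy-Schwarz inequality. *)
Lemma expect_norm_sqr f e : 0 < e -> measurable_fun setT f ->
  integrable_rv (fun x => f x ^+ 2) ->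
  integrable_rv f /\ expect (fun x => `|f x|) <= e + expect (fun x => f x ^+ 2) / e.
Proof.
move=> e0 mf fi.
have b x : `|f x| <= e + e^-1 * f x ^+ 2.
  rewrite -(real_normK (num_real (f x))); set a := `|f x|.
  have a0 : 0 <= a by exact: normr_ge0.
  have [ae|ea] := leP a e.
    by rewrite (le_trans ae)// lerDl mulr_ge0// ?invr_ge0 ?exprn_ge0// ltW.
  rewrite (@le_trans _ _ (e^-1 * a ^+ 2))//; last by rewrite lerDr ltW.
  by rewrite mulrC ler_pdivlMr// expr2 ler_wpM2l// ltW.
have gi : integrable_rv (fun x => e + e^-1 * f x ^+ 2).
  apply: integrable_rvD; last exact: integrable_rvZ.
  by apply: bounded_integrable; exact: bounded_rv_cst.
have fi1 : integrable_rv f by exact: integrable_rv_le gi b.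
split=> //; rewrite (le_trans (expect_le _ gi b))//.
  exact: integrable_rv_norm.
rewrite expectD; first by rewrite expect_cst expectZ// mulrC.
  by apply: bounded_integrable; exact: bounded_rv_cst.
exact: integrable_rvZ.
Qed.

Lemma expect_dominated_cvg (f_ : nat -> T -> R) f g :
  (forall n, measurable_fun setT (f_ n)) -> measurable_fun setT f ->
  integrable_rv g -> (forall n x, `|f_ n x| <= g x) ->
  {ae P, forall x, f_ n x @[n --> \oo] --> f x} ->
  expect (f_ n) @[n --> \oo] --> expect f.
Proof.
move=> mf_ mf gi fg ff.
have [fi _ cv] : [/\ P.-integrable setT (EFin \o f),
    [sequence \int[P]_x `|(f_ n x)%:E - (f x)%:E|]_n @ \oo --> 0 &
    [sequence \int[P]_x (f_ n x)%:E]_n @ \oo --> \int[P]_x (f x)%:E]%E.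
  apply: (@dominated_convergence _ _ _ P setT measurableT
      (fun n => EFin \o f_ n) (EFin \o f) (EFin \o g)) => //.
  - by move=> n; exact/measurable_EFinP.
  - exact/measurable_EFinP.
  - by apply: filterS ff => x fx _ /=; apply/cvg_EFin; [exact: nearW|exact: fx].
  - by apply: aeW => x n _ /=; rewrite lee_fin.
by apply: fine_cvg; rewrite -expectK.
Qed.

Lemma expect_bounded_cvg (f_ : nat -> T -> R) f M :
  (forall n, measurable_fun setT (f_ n)) -> measurable_fun setT f ->
  (forall n x, `|f_ n x| <= M) ->
  {ae P, forall x, f_ n x @[n --> \oo] --> f x} ->
  expect (f_ n) @[n --> \oo] --> expect f.
Proof.
move=> mf_ mf fM ff; apply: (@expect_dominated_cvg f_ f (fun=> M)) => //.
by apply: bounded_integrable; exact: bounded_rv_cst.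
Qed.

Lemma integrable_rv_fatou (f_ : nat -> T -> R) f C :
  (forall n, integrable_rv (f_ n)) -> measurable_fun setT f ->
  (forall n x, 0 <= f_ n x) -> (forall x, f_ n x @[n --> \oo] --> f x) ->
  (forall n, expect (f_ n) <= C) -> integrable_rv f /\ expect f <= C.
Proof.
move=> fi mf f0 ff fC.
have f0' x : 0 <= f x.
  have /cvg_lim <- // := ff x; apply: limr_ge; last exact: nearW.
  by apply/cvg_ex; exists (f x).
have le : (\int[P]_x (f x)%:E <= C%:E)%E.
  have -> : (\int[P]_x (f x)%:E = \int[P]_x limn_einf (fun n => (f_ n x)%:E))%E.
    apply: eq_integral => x _; apply/esym.
    have cv : (f_ n x)%:E @[n --> \oo] --> (f x)%:E.
      by apply/cvg_EFin; [exact: nearW|exact: ff].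
    by rewrite is_cvg_limn_einfE; [apply/cvg_lim|apply/cvg_ex; exists (f x)%:E].
  rewrite (le_trans (fatou P measurableT _ _))//.
  - by move=> n; apply/measurable_EFinP; exact: integrable_rv_measurable (fi n).
  - by move=> n x _; rewrite lee_fin.
  rewrite limn_einf_lim; apply: lime_le; first exact: is_cvg_einfs.
  apply: nearW => n; apply: (@le_trans _ _ (\int[P]_x (f_ n x)%:E)%E).
    by apply: ereal_inf_lbound; exists n => /=.
  by rewrite expectK// lee_fin.
have fint : integrable_rv f.
  apply/integrableP; split; first exact/measurable_EFinP.
  apply: le_lt_trans (ltry C); apply: le_trans le.
  by apply: ge0_le_integral => //;
    [exact/measurableT_comp/measurable_EFinP|exact/measurable_EFinP|
     move=> x _ /=; rewrite lee_fin ger0_norm].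
by split => //; rewrite -lee_fin -expectK.
Qed.

End expectation.

(** * Elementary real inequalities *)

Section real_inequalities.
Context {R : realType}.
Implicit Types x y a : R.

(** The mean value theorem in a form that can be iterated: the Taylor inequalities below are
    differentiated until a known inequality appears. *)
Lemma ge0_of_derive (f f' : R -> R) : (forall x, is_derive x 1 f (f' x)) ->
  (forall x, 0 <= x -> 0 <= f' x) -> f 0 = 0 -> forall x, 0 <= x -> 0 <= f x.
Proof.
move=> df f'0 f0 x; rewrite le_eqVlt => /predU1P[<-|x0]; first by rewrite f0.
have cf : {within `[0, x], continuous f}.
  apply: continuous_subspaceT => z; apply: differentiable_continuous.
  exact/derivable1_diffP/(@ex_derive _ _ _ _ _ _ _ (df z)).
have [c /[!in_itv]/= /andP[c0 _]] := MVT x0 (fun z _ => df z) cf.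
rewrite f0 subr0 subr0 => ->; rewrite mulr_ge0 ?f'0 //; exact: ltW.
Qed.

Lemma sin_le_id x : 0 <= x -> sin x <= x.
Proof.
rewrite -[in X in _ -> X]subr_ge0.
apply: (@ge0_of_derive (fun x => x - sin x) (fun x => 1 - cos x)) => [y _|].
- by rewrite subr_ge0 cos_le1.
- by rewrite sin0 subr0.
Qed.

Lemma cos_ge_taylor2 x : 0 <= x -> 0 <= cos x - 1 + x ^+ 2 / 2.
Proof.
apply: (@ge0_of_derive (fun x => cos x - 1 + x ^+ 2 / 2) (fun x => x - sin x)) => [y|y y0|].
- apply: is_derive_eq; rewrite /GRing.scale /= ; lra.
- by rewrite subr_ge0 sin_le_id.
- by rewrite cos0 expr0n /=; lra.
Qed.

Lemma sin_ge_taylor3 x : 0 <= x -> 0 <= sin x - x + x ^+ 3 / 6.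
Proof.
apply: (@ge0_of_derive (fun x => sin x - x + x ^+ 3 / 6)
  (fun x => cos x - 1 + x ^+ 2 / 2)) => [y|y y0|].
- apply: is_derive_eq; rewrite /GRing.scale /= ; lra.
- exact: cos_ge_taylor2.
- by rewrite sin0 expr0n /=; lra.
Qed.

Lemma cos_le_taylor3 x : 0 <= x -> 0 <= 1 - x ^+ 2 / 2 + x ^+ 3 / 6 - cos x.
Proof.
apply: (@ge0_of_derive (fun x => 1 - x ^+ 2 / 2 + x ^+ 3 / 6 - cos x)
  (fun x => - x + x ^+ 2 / 2 + sin x)) => [y|y y0|].
- apply: is_derive_eq; rewrite /GRing.scale /= ; lra.
- apply: (@ge0_of_derive (fun x => - x + x ^+ 2 / 2 + sin x)
    (fun x => - 1 + x + cos x)) y0 => [z|z z0|].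
  + apply: is_derive_eq; rewrite /GRing.scale /= ; lra.
  + apply: (@ge0_of_derive (fun x => - 1 + x + cos x) (fun x => 1 - sin x)) z0 => [t|t _|].
    * apply: is_derive_eq; rewrite /GRing.scale /= ; lra.
    * by rewrite subr_ge0 sin_le1.
    * by rewrite cos0; lra.
  + by rewrite sin0 expr0n /=; lra.
- by rewrite cos0 !expr0n /=; lra.
Qed.

Lemma sin_taylor x : `|sin x - x| <= `|x| ^+ 3.
Proof.
wlog x0 : x / 0 <= x => [H|].
  have [|xN] := leP 0 x; first exact: H.
  have := H (- x); rewrite sinN opprK -opprB normrN normrN addrC; apply.
  by rewrite oppr_ge0 ltW.
rewrite (ger0_norm x0) ler0_norm ?subr_le0 ?sin_le_id//.
have := sin_ge_taylor3 x0; have : 0 <= x ^+ 3 by exact: exprn_ge0.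
lra.
Qed.

Lemma cos_taylor x : `|cos x - 1 + x ^+ 2 / 2| <= `|x| ^+ 3.
Proof.
wlog x0 : x / 0 <= x => [H|].
  have [|xN] := leP 0 x; first exact: H.
  by have := H (- x); rewrite cosN sqrrN normrN; apply; rewrite oppr_ge0 ltW.
rewrite (ger0_norm x0) ger0_norm ?cos_ge_taylor2//.
have := cos_le_taylor3 x0; have : 0 <= x ^+ 3 by exact: exprn_ge0.
lra.
Qed.

(** The remainder must be uniform in the phase [a], which will be a random sum of past
    increments. *)
Lemma cosD_taylor a x :
  `|cos (a + x) - (cos a - x * sin a - x ^+ 2 / 2 * cos a)| <= 2 * `|x| ^+ 3.
Proof.
rewrite cosD (_ : _ - _ = cos a * (cos x - 1 + x ^+ 2 / 2) - sin a * (sin x - x)).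
  rewrite (le_trans (ler_normB _ _))// mulrDl mul1r !normrM lerD//.
    by rewrite -[leRHS]mul1r ler_pM// ?cos_norm_le1 ?cos_taylor.
  by rewrite -[leRHS]mul1r ler_pM// ?sin_norm_le1 ?sin_taylor.
by field.
Qed.

Lemma sin_norm_le x : `|sin x| <= `|x|.
Proof.
wlog x0 : x / 0 <= x => [H|].
  have [|xN] := leP 0 x; first exact: H.
  by have := H (- x); rewrite sinN !normrN; apply; rewrite oppr_ge0 ltW.
rewrite (ger0_norm x0).
have [x1|x1] := leP x 1; last by rewrite (le_trans (sin_norm_le1 _))// ltW.
rewrite ler_norml sin_le_id// andbT.
have := sin_ge_taylor3 x0; have : x ^+ 3 <= x.
  by rewrite exprS -[leRHS]mulr1 ler_wpM2l// expr_le1.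
lra.
Qed.

Lemma cos_sub1_norm_le x : `|cos x - 1| <= `|x|.
Proof.
rewrite ler0_norm ?subr_le0 ?cos_le1// opprB.
wlog x0 : x / 0 <= x => [H|].
  have [|xN] := leP 0 x; first exact: H.
  by have := H (- x); rewrite cosN normrN; apply; rewrite oppr_ge0 ltW.
rewrite (ger0_norm x0).
have [x2|x2] := leP x 2; last by have := cos_geN1 x; lra.
have := cos_ge_taylor2 x0; have : x ^+ 2 <= x * 2 by rewrite expr2 ler_wpM2l.
lra.
Qed.

Lemma cos_lipschitz x y : `|cos x - cos y| <= 2 * `|x - y|.
Proof.
rewrite (_ : cos x = cos (y + (x - y))); last by congr cos; ring.
rewrite cosD (_ : _ - _ = cos y * (cos (x - y) - 1) - sin y * sin (x - y)); last by ring.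
rewrite (le_trans (ler_normB _ _))// mulrDl mul1r !normrM lerD//.
  by rewrite -[leRHS]mul1r ler_pM// ?cos_norm_le1 ?cos_sub1_norm_le.
by rewrite -[leRHS]mul1r ler_pM// ?sin_norm_le1 ?sin_norm_le.
Qed.

Lemma expRN_taylor x : 0 <= x -> `|expR (- x) - (1 - x)| <= x ^+ 2.
Proof.
move=> x0; have h y : 1 - y <= expR (- y) by exact: expR_ge1Dx.
rewrite ger0_norm ?subr_ge0//.
have : 0 <= x ^+ 2 / 2 - (expR (- x) - 1 + x).
  apply: (@ge0_of_derive (fun x => x ^+ 2 / 2 - (expR (- x) - 1 + x))
    (fun x => x + expR (- x) - 1)) x0 => [y|y y0|].
  - apply: is_derive_eq; rewrite /GRing.scale /= ; lra.
  - by have := h y; lra.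
  - by rewrite oppr0 expR0 expr0n /=; lra.
by have := sqr_ge0 x; lra.
Qed.

Lemma expRN_lipschitz x y : 0 <= x -> 0 <= y ->
  `|expR (- x) - expR (- y)| <= `|x - y|.
Proof.
wlog xy : x y / x <= y => [H|x0 y0].
  have [xy|yx] := leP x y; first exact: H.
  by move=> x0 y0; rewrite distrC [leRHS]distrC H// ltW.
rewrite ger0_norm ?subr_ge0 ?ler_expR ?lerN2// distrC ger0_norm ?subr_ge0//.
rewrite (_ : - y = - x + - (y - x)); last by ring.
rewrite expRD -[X in X - _]mulr1 -mulrBr -[leRHS]mul1r ler_pM ?expR_ge0//.
- by rewrite subr_ge0 expR_le1 oppr_le0 subr_ge0.
- by rewrite expR_le1 oppr_le0.
- by have := expR_ge1Dx (- (y - x)); lra.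
Qed.

(** Truncation by projection on [[-c, c]] rather than by an indicator: it is continuous, so weak
    convergence applies to it. *)
Definition clip (c x : R) := Num.min c (Num.max (- c) x).

Lemma clip_cases c x : 0 <= c ->
  [\/ clip c x = x /\ - c <= x <= c, clip c x = c /\ c < x | clip c x = - c /\ x < - c].
Proof.
move=> c0; rewrite /clip minElt maxElt.
have [h1|h1] := ltP (- c) x; have [h2|h2] := ltP c _.
- by apply: Or32.
- by apply: Or31; rewrite (ltW h1).
- by move: h2 c0; lra.
- move: h1; rewrite le_eqVlt => /predU1P[->|h1]; last exact: Or33.
  by apply: Or31; rewrite lexx; split => //; move: c0; lra.
Qed.

Lemma clip_norm_le c x : 0 <= c -> `|clip c x| <= c.
Proof.
move=> c0; rewrite ler_norml.
by have [[-> ?]|[-> ?]|[-> ?]] := clip_cases x c0; lra.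
Qed.

Lemma clip_id c x : `|x| <= c -> clip c x = x.
Proof.
move=> /[dup] xc; rewrite ler_norml => xc'.
have c0 : 0 <= c by exact: le_trans (normr_ge0 _) xc.
by have [[-> ?]|[-> ?]|[-> ?]] := clip_cases x c0; lra.
Qed.

Lemma clip_sub_norm_le c x : 0 <= c -> `|x - clip c x| <= `|x|.
Proof.
move=> c0; have [[-> ?]|[-> ?]|[-> ?]] := clip_cases x c0.
- by rewrite subrr normr0 normr_ge0.
- by rewrite ger0_norm ?ger0_norm; lra.
- by rewrite ler0_norm ?ler0_norm; lra.
Qed.

Lemma clip_norm_le_norm c x : 0 <= c -> `|clip c x| <= `|x|.
Proof.
move=> c0; have [[-> ?]|[-> ?]|[-> ?]] := clip_cases x c0 => //.
- by rewrite !ger0_norm //; lra.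
- by rewrite normrN ger0_norm // ler0_norm; lra.
Qed.

(** The obtuse angle property of the projection [p] of [y] on an interval that contains [x]:
    [(y - p) (p - x) >= 0]. *)
Lemma clip_projection c x y : `|x| <= c ->
  (y - clip c y) ^+ 2 <= (y - clip c y) * (y - x).
Proof.
move=> /[dup] xc; rewrite ler_norml => /andP[xc1 xc2].
have c0 : 0 <= c by exact: le_trans (normr_ge0 _) xc.
rewrite expr2; have [[-> ?]|[-> ?]|[-> ?]] := clip_cases y c0.
- by rewrite subrr !mul0r.
- by rewrite ler_wpM2l; lra.
- by rewrite ler_wnM2l; lra.
Qed.

Lemma continuous_clip c : continuous (clip c : R -> R).
Proof.
move=> x; apply: continuous_min; first exact: cvg_cst.
by apply: continuous_max; [exact: cvg_cst|exact: cvg_id].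
Qed.

Lemma measurable_clip c : measurable_fun setT (clip c : R -> R).
Proof. by apply: continuous_measurable_fun; exact: continuous_clip. Qed.

Lemma sqrB_le x y : (x - y) ^+ 2 <= 2 * x ^+ 2 + 2 * y ^+ 2.
Proof. by have := sqr_ge0 (x + y); lra. Qed.

Lemma mul_norm_le_sqr x y : `|x * y| <= x ^+ 2 + y ^+ 2.
Proof.
rewrite normrM -(real_normK (num_real x)) -(real_normK (num_real y)).
have := sqr_ge0 (`|x| - `|y|); have := mulr_ge0 (normr_ge0 x) (normr_ge0 y).
by set a := `|x|; set b := `|y|; nra.
Qed.

End real_inequalities.

(** * Conditional expectations *)

Section sub_sigma_algebra.
Context {R : realType} {d : measure_display} {T : measurableType d}.
Variable G : set (set T).
Hypothesis GP : sub_sigma G.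

Notation GT := (g_sigma_algebraType G).

Lemma sub_sigma_measurableE (A : set T) : measurable (A : set GT) <-> G A.
Proof. by rewrite measurable_g_measurableTypeE//; case: GP. Qed.

Lemma sub_sigma_measurable (A : set T) : measurable (A : set GT) -> measurable A.
Proof. by move/sub_sigma_measurableE; exact: GP.2. Qed.

Lemma G_measurableP (f : T -> R) :
  G_measurable G f <-> measurable_fun setT (f : GT -> R).
Proof.
split=> [Gf _ B mB|mf B mB].
  by rewrite setTI; apply/sub_sigma_measurableE; exact: Gf.
by apply/sub_sigma_measurableE; rewrite -[X in measurable X]setTI; exact: mf.
Qed.

Lemma sub_sigma_measurable_fun d' (U : measurableType d') (f : T -> U) :
  measurable_fun setT (f : GT -> U) -> measurable_fun setT f.
Proof.
move=> mf _ B mB; rewrite setTI; case: GP => _; apply.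
by apply/sub_sigma_measurableE; rewrite -[X in measurable X]setTI; exact: mf.
Qed.

Lemma sub_sigma_bounded_rv (f : T -> R) :
  bounded_rv (f : GT -> R) -> bounded_rv f.
Proof. by move=> [mf bf]; split => //; exact: sub_sigma_measurable_fun. Qed.

Lemma measurable_sub_sigma_id : measurable_fun setT (id : T -> GT).
Proof. exact: (@sub_sigma_measurable_fun _ GT id). Qed.

End sub_sigma_algebra.

(** * Measures restricted to a sub-sigma-algebra *)

Section restricted_measures.
Context {R : realType} {d : measure_display} {T : measurableType d}.
Variables (P : probability T R) (G : set (set T)).
Local Open Scope ereal_scope.
Notation GT := (g_sigma_algebraType G).

(** The proof of [sub_sigma G] is an argument so that the measure instance below can be attached to
    the term: additivity on [GT] rests on its sets being measurable in [T]. *)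
Definition sub_sigma_prob of sub_sigma G : set GT -> \bar R :=
  pushforward P (id : T -> GT).

Section instances.
Variable GP : sub_sigma G.
Let mu := sub_sigma_prob GP.

Let mu0 : mu set0 = 0. Proof. exact: (measure0 P). Qed.

Let mu_ge0 A : 0 <= mu A. Proof. exact: (measure_ge0 P). Qed.

Let mu_sigma_additive : semi_sigma_additive mu.
Proof.
move=> F mF tF mUF; apply: (@measure_semi_sigma_additive _ _ _ P) => //.
  by move=> n; exact: (sub_sigma_measurable GP (mF n)).
exact: (sub_sigma_measurable GP mUF).
Qed.

HB.instance Definition _ := isMeasure.Build _ _ _ mu mu0 mu_ge0 mu_sigma_additive.

Let mu_setT : mu setT = 1. Proof. exact: (@probability_setT _ _ _ P). Qed.

HB.instance Definition _ := Measure_isProbability.Build _ _ _ mu mu_setT.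
End instances.

(** The signed measure that sends [A] to the integral of [X] over [A], seen on [G] only; its density
    is the conditional expectation. *)
Definition sub_sigma_charge (X : T -> R) (Xi : P.-integrable setT (EFin \o X))
  of sub_sigma G : set GT -> \bar R := induced_charge Xi.

Section charge_instance.
Variables (X : T -> R) (Xi : P.-integrable setT (EFin \o X)) (GP : sub_sigma G).
Let nu := sub_sigma_charge Xi GP.

Let nu0 : nu set0 = 0. Proof. exact: (charge0 (induced_charge Xi)). Qed.

Let finnu A : measurable A -> nu A \is a fin_num.
Proof.
move=> mA; apply: (fin_num_measure (induced_charge Xi)).
exact: (sub_sigma_measurable GP mA).
Qed.

Let snu : semi_sigma_additive nu.
Proof.
move=> F mF tF mUF; apply: (@charge_semi_sigma_additive _ _ _ (induced_charge Xi)) => //.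
  by move=> n; exact: (sub_sigma_measurable GP (mF n)).
exact: (sub_sigma_measurable GP mUF).
Qed.

HB.instance Definition _ := isCharge.Build _ _ _ nu nu0 finnu snu.
End charge_instance.

Lemma integral_sub_sigma_prob (GP : sub_sigma G) (f : T -> \bar R) (A : set T) :
  measurable_fun setT (f : GT -> \bar R) ->
  (sub_sigma_prob GP).-integrable setT f -> G A ->
  P.-integrable setT f /\
  \int[sub_sigma_prob GP]_(x in A) f x = \int[P]_(x in A) f x.
Proof.
move=> mf fi GA; have mid := measurable_sub_sigma_id GP.
have mA : measurable (A : set GT) by exact/sub_sigma_measurableE.
have fiP : P.-integrable setT f.
  apply/integrableP; split; first exact: sub_sigma_measurable_fun mf.
  move/integrableP : fi => [_]; apply: le_lt_trans.
  rewrite (ge0_integral_pushforward mid)//; last exact: measurableT_comp.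
split=> //; rewrite (@integral_pushforward _ _ _ _ _ _ mid P A f)//.
by apply: (integrableS measurableT) fiP => //; exact: GP.2.
Qed.

End restricted_measures.

Section conditional_expectation.
Context {R : realType} {d : measure_display} {T : measurableType d}.
Variables (P : probability T R) (G : set (set T)).
Hypothesis GP : sub_sigma G.
Notation GT := (g_sigma_algebraType G).

(** Radon-Nikodym on [GT], followed by a transfer of the density and of its integrals back to
    [P]. *)
Lemma cond_exp_exists (X : T -> R) : integrable_rv P X ->
  exists Y, is_cond_exp P G X Y.
Proof.
move=> Xi; pose nu := sub_sigma_charge Xi GP; pose mu := sub_sigma_prob P GP.
have numu : nu `<< mu.
  apply/null_content_dominatesP => A mA muA; rewrite /nu /sub_sigma_charge.
  have GA : G A by exact/(sub_sigma_measurableE GP).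
  apply: null_set_integral => //; first exact: GP.2.
  by apply: measurable_funTS; exact: measurable_int Xi.
have [f [ffin fi fE]] : exists f : GT -> \bar R, [/\ (forall x, f x \is a fin_num),
    mu.-integrable [set: GT] f &
    forall A, measurable A -> nu A = \int[mu]_(x in A) f x]%E.
  exists (@Radon_Nikodym _ GT R (sub_sigma_charge Xi GP) (sub_sigma_prob P GP)); split.
  - by move=> x; exact: Radon_Nikodym_fin_num.
  - exact: Radon_Nikodym_integrable.
  - move=> A mA.
    exact: (@Radon_Nikodym_integral _ GT R (sub_sigma_charge Xi GP)
              (sub_sigma_prob P GP) A numu mA).
have mf : measurable_fun setT (f : GT -> \bar R) by exact: measurable_int fi.
have fEF : f = EFin \o (fine \o f) by apply/funext => x /=; rewrite fineK.
have GT1 : G setT by apply/(sub_sigma_measurableE GP).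
exists (fine \o f); split.
- by apply/(G_measurableP GP); apply: measurableT_comp.
- by rewrite -fEF; have [] := integral_sub_sigma_prob mf fi GT1.
- move=> A GA; have [_ AE] := integral_sub_sigma_prob mf fi GA.
  have <- : (\int[P]_(w in A) f w = \int[P]_(w in A) ((fine \o f) w)%:E)%E.
    by rewrite [in LHS]fEF.
  by rewrite -AE -fE//; exact/(sub_sigma_measurableE GP).
Qed.

Lemma cond_expP (X : T -> R) : integrable_rv P X ->
  is_cond_exp P G X (cond_exp P G X).
Proof.
move=> /cond_exp_exists[Y XY].
exact: (@xgetPex _ (fun _ => 0) [set Y | is_cond_exp P G X Y]) (ex_intro _ Y XY).
Qed.

Lemma expect_indicM (A : set T) (X : T -> R) : measurable A ->
  expect P (fun x => \1_A x * X x) = fine (\int[P]_(x in A) (X x)%:E)%E.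
Proof.
move=> mA; rewrite /expect [in RHS]integral_mkcond; congr fine.
apply: eq_integral => x _; rewrite /patch indicE.
by case: (x \in A); rewrite ?mul1r ?mul0r.
Qed.

Lemma is_cond_exp_integrable (X Y : T -> R) :
  is_cond_exp P G X Y -> integrable_rv P Y.
Proof. by case. Qed.

Lemma is_cond_exp_measurable (X Y : T -> R) :
  is_cond_exp P G X Y -> measurable_fun setT (Y : GT -> R).
Proof. by case => /(G_measurableP GP). Qed.

Lemma is_cond_exp_indic (X Y : T -> R) (A : set T) :
  is_cond_exp P G X Y -> G A ->
  expect P (fun x => \1_A x * Y x) = expect P (fun x => \1_A x * X x).
Proof.
move=> [_ _ XY] GA; rewrite !expect_indicM ?XY//; exact: GP.2.
Qed.

Lemma is_cond_expP (X Y : T -> R) : integrable_rv P X -> integrable_rv P Y ->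
  measurable_fun setT (Y : GT -> R) ->
  (forall A, G A ->
    expect P (fun x => \1_A x * Y x) = expect P (fun x => \1_A x * X x)) ->
  is_cond_exp P G X Y.
Proof.
move=> Xi Yi mY XY; split => //; first exact/(G_measurableP GP).
move=> A GA; have mA := GP.2 _ GA; have := XY A GA.
have fin Z : integrable_rv P Z -> (\int[P]_(x in A) (Z x)%:E \is a fin_num)%E.
  by move=> Zi; apply: integrable_fin_num => //; exact: (integrableS measurableT) Zi.
rewrite !expect_indicM// => XYA.
by rewrite -(fineK (fin _ Yi)) -(fineK (fin _ Xi)) XYA.
Qed.

Lemma is_cond_expB (X Y X' Y' : T -> R) : integrable_rv P X -> integrable_rv P X' ->
  is_cond_exp P G X Y -> is_cond_exp P G X' Y' ->
  is_cond_exp P G (fun x => X x - X' x) (fun x => Y x - Y' x).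
Proof.
move=> Xi X'i XY XY'; have Yi := is_cond_exp_integrable XY.
have Y'i := is_cond_exp_integrable XY'.
apply: is_cond_expP; [exact: integrable_rvB|exact: integrable_rvB| |].
  by apply: measurable_funB; [exact: is_cond_exp_measurable XY|exact: is_cond_exp_measurable XY'].
move=> A GA; have bA : bounded_rv (\1_A : T -> R).
  by apply: bounded_rv_indic; exact: GP.2.
under eq_fun do rewrite mulrBr; under [in RHS]eq_fun do rewrite mulrBr.
by rewrite !expectB ?(is_cond_exp_indic XY) ?(is_cond_exp_indic XY')//; exact: integrable_rvMb.
Qed.

(** [bounded_rv_ind] is applied on the measurable space [GT], so that it ranges over [G]-measurable
    [H]. Working with [D = Y - X] leaves a single expectation that has to vanish. *)
Lemma is_cond_exp_expectM (X Y H : T -> R) : integrable_rv P X ->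
  is_cond_exp P G X Y -> bounded_rv (H : GT -> R) ->
  expect P (fun x => H x * Y x) = expect P (fun x => H x * X x).
Proof.
move=> Xi XY; have Yi := is_cond_exp_integrable XY; pose D x := Y x - X x.
have Di : integrable_rv P D by exact: integrable_rvB.
have DA A : G A -> expect P (fun x => \1_A x * D x) = 0.
  move=> GA; have bA : bounded_rv (\1_A : T -> R).
    by apply: bounded_rv_indic; exact: GP.2.
  rewrite /D; under eq_fun do rewrite mulrBr.
  rewrite expectB ?(is_cond_exp_indic XY) ?subrr//; exact: integrable_rvMb.
move=> bH; have bH' := sub_sigma_bounded_rv GP bH.
suff : expect P (fun x => H x * D x) = 0.
  rewrite /D; under eq_fun do rewrite mulrBr.
  rewrite expectB; [|exact: integrable_rvMb..].
  by move/eqP; rewrite subr_eq0 => /eqP.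
pose Q (H' : GT -> R) := expect P (fun x => H' x * D x) = 0.
apply: (@bounded_rv_ind _ _ GT Q) bH; rewrite /Q.
- by move=> A /(sub_sigma_measurableE GP); exact: DA.
- move=> c f g /(sub_sigma_bounded_rv GP) bf /(sub_sigma_bounded_rv GP) bg f0 g0.
  under eq_fun do rewrite mulrDl -mulrA.
  rewrite expectD ?expectZ ?f0 ?g0 ?mulr0 ?addr0//; try exact: integrable_rvMb.
  by apply: integrable_rvZ; exact: integrable_rvMb.
- move=> h f M bh bf hM hf h0.
  have mD := integrable_rv_measurable Di.
  have cv : expect P (fun x => h n x * D x) @[n --> \oo] -->
            expect P (fun x => f x * D x).
    apply: (@expect_dominated_cvg _ _ _ _ _ _ (fun x => M * `|D x|)).
    - move=> n; apply: measurable_funM => //; apply: bounded_rv_measurable.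
      exact: (sub_sigma_bounded_rv GP).
    - apply: measurable_funM => //; apply: bounded_rv_measurable.
      exact: (sub_sigma_bounded_rv GP).
    - by apply: integrable_rvZ; exact: integrable_rv_norm.
    - by move=> n x; rewrite normrM ler_wpM2r.
    - by apply: aeW => x; apply: cvgMl; exact: hf.
  have : expect P (fun x => h n x * D x) @[n --> \oo] --> (0 : R).
    by under eq_fun do rewrite h0; exact: cvg_cst.
  by apply: cvg_unique cv.
Qed.

(** Square integrability of [Y] is not known in advance, so [Y] is cut off to [H = Y 1_{|Y| <= n}].
    Then [E[H^2] = E[H Y] = E[H X] <= (E[H^2] + E[X^2]) / 2], where [E[H^2]] is finite and can be
    cancelled; Fatou removes the cutoff. *)
Lemma is_cond_exp_sqr (X Y : T -> R) : measurable_fun setT X ->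
  integrable_rv P (fun x => X x ^+ 2) -> is_cond_exp P G X Y ->
  integrable_rv P (fun x => Y x ^+ 2) /\
  expect P (fun x => Y x ^+ 2) <= expect P (fun x => X x ^+ 2).
Proof.
move=> mX X2 XY; have [Xi _] := expect_norm_sqr (@ltr01 R) mX X2.
have mY := is_cond_exp_measurable XY.
pose H n x := Y x * \1_[set y | `|Y y| <= n%:R] x.
have mA n : measurable ([set y | `|Y y| <= n%:R] : set GT).
  exact: (@measurable_norm_le _ _ GT Y).
have bH n : bounded_rv (H n : GT -> R).
  split; first by apply: measurable_funM => //; exact: measurable_indic.
  exists n%:R => x; rewrite /H indicE; have [|_] := boolP (x \in _).
    by rewrite inE /= mulr1.
  by rewrite mulr0 normr0.
have bH' n := sub_sigma_bounded_rv GP (bH n).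
apply: (@integrable_rv_fatou _ _ _ _ (fun n x => H n x ^+ 2)).
- by move=> n; apply: bounded_integrable; exact: bounded_rvX.
- by apply: measurable_funX; exact: (sub_sigma_measurable_fun GP).
- by move=> n x; exact: sqr_ge0.
- move=> x; apply: cvg_near_cst; near=> n; rewrite /H indicE mem_set ?mulr1//=.
  near: n; exact: nbhs_infty_ger.
- move=> n; have HY := is_cond_exp_expectM Xi XY (bH n).
  have -> : expect P (fun x => H n x ^+ 2) = expect P (fun x => H n x * X x).
    rewrite -HY; congr (expect P _); apply/funext => x.
    by rewrite /H indicE; case: (x \in _); rewrite ?mulr1 ?expr2// !mulr0 mul0r.
  have i2 : integrable_rv P (fun x => H n x ^+ 2).
    by apply: bounded_integrable; exact: bounded_rvX.
  have : expect P (fun x => H n x * X x) <=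
      expect P (fun x => 2^-1 * (H n x ^+ 2 + X x ^+ 2)).
    apply: expect_le; first exact: integrable_rvMb.
      by apply: integrable_rvZ; exact: integrable_rvD.
    move=> x; rewrite -subr_ge0.
    rewrite (_ : _ - _ = 2^-1 * (H n x - X x) ^+ 2); last by field.
    by rewrite mulr_ge0// sqr_ge0.
  rewrite expectZ; last exact: integrable_rvD.
  rewrite expectD// -HY (_ : (fun x => _ * Y x) = (fun x => H n x ^+ 2)); first lra.
  apply/funext => x.
  by rewrite /H indicE; case: (x \in _); rewrite ?mulr1 ?expr2// !mulr0 mul0r.
Unshelve. all: by end_near. Qed.

(** Needed for unbounded martingales as test variables: [H] is cut off and [H^2 + Z^2] dominates the
    products with [Z = X] and [Z = Y]. *)
Lemma is_cond_exp_expectM_sqr (X Y H : T -> R) : measurable_fun setT X ->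
  integrable_rv P (fun x => X x ^+ 2) -> is_cond_exp P G X Y ->
  measurable_fun setT (H : GT -> R) -> integrable_rv P (fun x => H x ^+ 2) ->
  expect P (fun x => H x * Y x) = expect P (fun x => H x * X x).
Proof.
move=> mX X2 XY mH H2; have [Xi _] := expect_norm_sqr (@ltr01 R) mX X2.
have [Y2 _] := is_cond_exp_sqr mX X2 XY.
have mA n : measurable ([set y | `|H y| <= n%:R] : set GT).
  exact: (@measurable_norm_le _ _ GT H).
pose h n x := H x * \1_[set y | `|H y| <= n%:R] x.
have hH n x : `|h n x| <= `|H x|.
  by rewrite /h indicE; case: (x \in _); rewrite ?mulr1// mulr0 normr0.
have bH n : bounded_rv (h n : GT -> R).
  split; first by apply: measurable_funM => //; exact: measurable_indic.
  exists n%:R => x; rewrite /h indicE; have [|_] := boolP (x \in _).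
    by rewrite inE /= mulr1.
  by rewrite mulr0 normr0.
have cv (Z : T -> R) : measurable_fun setT Z -> integrable_rv P (fun x => Z x ^+ 2) ->
    expect P (fun x => h n x * Z x) @[n --> \oo] --> expect P (fun x => H x * Z x).
  move=> mZ Z2.
  apply: (@expect_dominated_cvg _ _ _ _ _ _ (fun x => H x ^+ 2 + Z x ^+ 2)).
  - move=> n; apply: measurable_funM => //; apply: (sub_sigma_measurable_fun GP).
    exact: bounded_rv_measurable.
  - by apply: measurable_funM => //; exact: (sub_sigma_measurable_fun GP).
  - exact: integrable_rvD.
  - move=> n x; rewrite normrM (@le_trans _ _ (`|H x| * `|Z x|))//.
      by rewrite ler_wpM2r.
    rewrite -(real_normK (num_real (H x))) -(real_normK (num_real (Z x))).
    rewrite -subr_ge0; set a := `|H x|; set b := `|Z x|.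
    rewrite (_ : _ - _ = (a - b) ^+ 2 + a * b); last by ring.
    by rewrite addr_ge0 ?sqr_ge0 ?mulr_ge0 ?normr_ge0.
  - apply: aeW => x; apply: cvgMl.
    apply: cvg_near_cst; near=> n; rewrite /h indicE mem_set ?mulr1//=.
    near: n; exact: nbhs_infty_ger.
have := cv Y (sub_sigma_measurable_fun GP (is_cond_exp_measurable XY)) Y2.
under eq_fun do rewrite (is_cond_exp_expectM Xi XY)//.
by move=> cvY; exact: cvgn_unique cvY (cv _ mX X2).
Unshelve. all: by end_near. Qed.

End conditional_expectation.

(** * Integration against regular conditional distributions *)

Section regular_conditional_distribution.
Context {R : realType} {d : measure_display} {T : measurableType d}.
Variables (P : probability T R) (G : set (set T)).
Hypothesis GP : sub_sigma G.
Notation GT := (g_sigma_algebraType G).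

Lemma expect_indic d' (U : measurableType d') (Q : probability U R) (B : set U) :
  measurable B -> expect Q \1_B = fine (Q B).
Proof. by move=> mB; rewrite /expect integral_indic// setIT. Qed.

(** The definition covers indicators; the induction also carries the [G]-measurability of the
    integrals, which the limit case needs. *)
Lemma reg_cond_distrP (Y : T -> R) (K : T -> probability R R) (f : R -> R) :
  measurable_fun setT Y -> reg_cond_distr P G Y K -> bounded_rv f ->
  is_cond_exp P G (f \o Y) (fun w => expect (K w) f).
Proof.
move=> mY YK bf; have [_ [M fM]] := bf.
have bfY g : bounded_rv g -> integrable_rv P (g \o Y).
  move=> [mg [N gN]]; apply: bounded_integrable; split.
    exact: measurableT_comp.
  by exists N => x /=.
pose Q (f : R -> R) := measurable_fun setT ((fun w => expect (K w) f) : GT -> R) /\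
  forall A, G A -> expect P (fun x => \1_A x * expect (K x) f) =
                   expect P (fun x => \1_A x * f (Y x)).
have Ki g : bounded_rv g -> measurable_fun setT ((fun w => expect (K w) g) : GT -> R) ->
    integrable_rv P (fun w => expect (K w) g).
  move=> bg mg; apply: bounded_integrable; split.
    exact: (sub_sigma_measurable_fun GP).
  have [_ [N gN]] := bg; exists N => w.
  by apply: expect_bound => //; exact: bounded_integrable.
suff [mf fE] : Q f by apply: is_cond_expP => //; [exact: bfY|exact: Ki].
apply: bounded_rv_ind bf; rewrite {}/Q.
- move=> B mB; have YB := YK B mB.
  have E w : expect (K w) \1_B = fine (K w B) by exact: expect_indic.
  split; first by under eq_fun do rewrite E; exact: is_cond_exp_measurable YB.
  move=> A GA; under eq_fun do rewrite E.
  by rewrite (is_cond_exp_indic GP YB).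
- move=> c g h bg bh [mg gE] [mh hE].
  have E : (fun w => expect (K w) (fun x => c * g x + h x)) =
           (fun w => c * expect (K w) g + expect (K w) h).
    apply/funext => w; rewrite expectD ?expectZ//; try exact: bounded_integrable.
    by apply: integrable_rvZ; exact: bounded_integrable.
  rewrite E; split; first by apply: measurable_funD => //; exact: measurable_funM.
  move=> A GA; have bA : bounded_rv (\1_A : T -> R).
    by apply: bounded_rv_indic; exact: GP.2.
  rewrite (_ : (fun x => _ * expect _ _) = (fun x =>
      c * (\1_A x * expect (K x) g) + \1_A x * expect (K x) h)); last first.
    by apply/funext => x; rewrite (congr1 (fun F => F x) E) mulrDr mulrCA.
  rewrite [in RHS](_ : (fun x => _) = (fun x =>
      c * (\1_A x * g (Y x)) + \1_A x * h (Y x))); last first.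
    by apply/funext => x; rewrite mulrDr mulrCA.
  rewrite expectD; [|apply: integrable_rvZ; apply: integrable_rvMb => //; exact: Ki|
    by apply: integrable_rvMb => //; exact: Ki].
  rewrite [RHS]expectD; [|by apply: integrable_rvZ; apply: integrable_rvMb => //; exact: bfY|
    by apply: integrable_rvMb => //; exact: bfY].
  rewrite !expectZ ?gE ?hE//; apply: integrable_rvMb => //; first exact: bfY.
  exact: Ki.
- move=> h g N bh bg hN hg hE.
  have cvK w : expect (K w) (h n) @[n --> \oo] --> expect (K w) g.
    apply: (@expect_bounded_cvg _ _ _ _ _ _ N) => //.
    + by move=> n; exact: bounded_rv_measurable.
    + exact: bounded_rv_measurable.
    + exact: aeW.
  have mg : measurable_fun setT ((fun w => expect (K w) g) : GT -> R).
    apply: (@measurable_fun_cvg _ GT R setT (fun n w => expect (K w) (h n))).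
      by move=> n; have [] := hE n.
    by move=> w _; exact: cvK.
  split=> // A GA; have bA : bounded_rv (\1_A : T -> R).
    by apply: bounded_rv_indic; exact: GP.2.
  have A1 x : `|\1_A x : R| <= 1.
    by rewrite indicE; case: (_ \in _); rewrite ?normr1 ?normr0.
  have cv1 : expect P (fun x => \1_A x * expect (K x) (h n)) @[n --> \oo] -->
             expect P (fun x => \1_A x * expect (K x) g).
    apply: (@expect_bounded_cvg _ _ _ _ _ _ N).
    + move=> n; apply: measurable_funM; first exact: bounded_rv_measurable bA.
      by apply: (sub_sigma_measurable_fun GP); have [] := hE n.
    + apply: measurable_funM; first exact: bounded_rv_measurable bA.
      exact: (sub_sigma_measurable_fun GP).
    + move=> n x; rewrite normrM -[leRHS]mul1r ler_pM//.
      by apply: expect_bound => //; exact: bounded_integrable.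
    + by apply: aeW => x; apply: cvgMr; exact: cvK.
  have cv2 : expect P (fun x => \1_A x * h n (Y x)) @[n --> \oo] -->
             expect P (fun x => \1_A x * g (Y x)).
    apply: (@expect_bounded_cvg _ _ _ _ _ _ N).
    + move=> n; apply: measurable_funM; first exact: bounded_rv_measurable bA.
      by apply: measurableT_comp => //; exact: bounded_rv_measurable.
    + apply: measurable_funM; first exact: bounded_rv_measurable bA.
      by apply: measurableT_comp => //; exact: bounded_rv_measurable.
    + by move=> n x; rewrite normrM -[leRHS]mul1r ler_pM.
    + by apply: aeW => x; apply: cvgMr; exact: hg.
  move: cv1; under eq_fun do rewrite (hE _).2//.
  by move=> cv1; exact: cvgn_unique cv1 cv2.
Qed.

End regular_conditional_distribution.

Section bounded_conditional_expectation.
Context {R : realType} {d : measure_display} {T : measurableType d}.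
Variable P : probability T R.

(** The bound holds everywhere and not only almost surely, which spares exceptional sets in the
    later pointwise estimates. Clipping an arbitrary version does not change its class. *)
Lemma bounded_cond_exp (G : set (set T)) (X : T -> R) (M : R) : sub_sigma G ->
  measurable_fun setT X -> (forall x, `|X x| <= M) ->
  exists Y : T -> R, [/\ measurable_fun setT (Y : g_sigma_algebraType G -> R),
    forall x, `|Y x| <= M &
    forall H : T -> R, bounded_rv (H : g_sigma_algebraType G -> R) ->
      expect P (fun x => H x * Y x) = expect P (fun x => H x * X x)].
Proof.
move=> GP mX XM; have bX : bounded_rv X by split => //; exists M.
have Xi := bounded_integrable P bX; have [Y0 XY0] := cond_exp_exists GP Xi.
have X2 : integrable_rv P (fun x => X x ^+ 2).
  by apply: bounded_integrable; exact: bounded_rvX.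
have mY0 := is_cond_exp_measurable GP XY0.
have [Y02 _] := is_cond_exp_sqr GP mX X2 XY0.
have Y0i := is_cond_exp_integrable XY0.
pose Y x := clip M (Y0 x).
have mY : measurable_fun setT (Y : g_sigma_algebraType G -> R).
  exact: (measurableT_comp (measurable_clip M)).
have MM (x : T) : 0 <= M := le_trans (normr_ge0 _) (XM x).
have YM x : `|Y x| <= M := clip_norm_le _ (MM x).
have bY : bounded_rv (Y : g_sigma_algebraType G -> R) by split => //; exists M.
have bY' := sub_sigma_bounded_rv GP bY.
exists Y; split => // H bH; have bH' := sub_sigma_bounded_rv GP bH.
pose D x := Y0 x - Y x.
have mD : measurable_fun setT (D : g_sigma_algebraType G -> R).
  exact: measurable_funB.
have D2 : integrable_rv P (fun x => D x ^+ 2).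
  apply: (@integrable_rv_le _ _ _ _ _ (fun x => 2 * Y0 x ^+ 2 + 2 * Y x ^+ 2)).
  - by apply: measurable_funX; exact: (sub_sigma_measurable_fun GP).
  - apply: integrable_rvD; apply: integrable_rvZ => //.
    by apply: bounded_integrable; exact: bounded_rvX.
  - by move=> x; rewrite ger0_norm ?sqr_ge0// /D sqrB_le.
have Di : integrable_rv P D.
  by apply: integrable_rvB => //; exact: bounded_integrable.
(* [Y] is the pointwise projection of [Y0] on [-M, M], which contains [X]. *)
have DE0 : expect P (fun x => D x ^+ 2) <= 0.
  have := is_cond_exp_expectM_sqr GP mX X2 XY0 mD D2 => DE.
  have DY0 : integrable_rv P (fun x => D x * Y0 x).
    apply: (@integrable_rv_le _ _ _ _ _ (fun x => D x ^+ 2 + Y0 x ^+ 2)).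
    - apply: measurable_funM; exact: (sub_sigma_measurable_fun GP).
    - exact: integrable_rvD.
    - by move=> x; exact: mul_norm_le_sqr.
  have DX : integrable_rv P (fun x => D x * X x).
    by under eq_fun do rewrite mulrC; exact: integrable_rvMb.
  rewrite -(subrr (expect P (fun x => D x * X x))) -{1}DE -expectB//.
  apply: expect_le => //; first exact: integrable_rvB.
  by move=> x; rewrite -mulrBr; exact: clip_projection.
have D0 : expect P (fun x => `|D x|) <= 0.
  apply/ler_addgt0Pr => e e0; rewrite add0r.
  have [_] := expect_norm_sqr e0 (sub_sigma_measurable_fun GP mD) D2.
  move=> /le_trans; apply; rewrite gerDl.
  by rewrite pmulr_lle0// invr_gt0.
have HD0 : expect P (fun x => H x * D x) = 0.
  have [_ [N HN]] := bH.
  apply/eqP; rewrite -normr_le0.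
  have -> : 0 = N * 0 :> R by rewrite mulr0.
  apply: (@le_trans _ _ (expect P (fun x => N * `|D x|))).
    apply: expect_norm_le; first exact: integrable_rvMb.
      by apply: integrable_rvZ; exact: integrable_rv_norm.
    by move=> x; rewrite normrM ler_wpM2r.
  rewrite expectZ; last exact: integrable_rv_norm.
  have -> : expect P (fun x => `|D x|) = 0.
    by apply/eqP; rewrite eq_le D0 expect_ge0.
  by [].
rewrite -(is_cond_exp_expectM GP Xi XY0 bH) -[LHS]addr0 -HD0 -expectD.
- by congr expect; apply/funext => x; rewrite /D; ring.
- by apply: integrable_rvMb => //; exact: bounded_integrable.
- exact: integrable_rvMb.
Qed.

End bounded_conditional_expectation.

(** * Approximation of an event along a filtration *)

Section filtrations.
Context {R : realType} {d : measure_display} {T : measurableType d}.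
Variables (P : probability T R) (G : nat -> set (set T)).
Hypothesis GF : filtration G.
Notation GT n := (g_sigma_algebraType (G n)).

Lemma filtration_sub n : sub_sigma (G n).
Proof. by case: GF. Qed.

Lemma filtration_le m n : (m <= n)%N -> G m `<=` G n.
Proof.
elim: n => [|n ih]; first by rewrite leqn0 => /eqP ->.
rewrite leq_eqVlt => /predU1P[-> //|]; rewrite ltnS => /ih mn.
by apply: subset_trans mn _; case: GF.
Qed.

Lemma filtration_measurable m n (f : T -> R) : (m <= n)%N ->
  measurable_fun setT (f : GT m -> R) -> measurable_fun setT (f : GT n -> R).
Proof.
move=> mn /(G_measurableP (filtration_sub m)) mf.
by apply/(G_measurableP (filtration_sub n)) => B mB; exact/(filtration_le mn)/mf.
Qed.

Lemma filtration_bounded m n (f : T -> R) : (m <= n)%N ->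
  bounded_rv (f : GT m -> R) -> bounded_rv (f : GT n -> R).
Proof. by move=> mn [mf bf]; split => //; exact: filtration_measurable mf. Qed.

(* Orthogonality of martingale increments makes [E[Y_m^2]] nondecreasing in
   [m], which yields convergence without identifying the limit. *)
Lemma bounded_martingale_approx (A : set T) (e : R) : measurable A -> 0 < e ->
  exists m0, forall m, (m0 <= m)%N -> exists Y : T -> R,
    [/\ measurable_fun setT (Y : GT m -> R), forall x, `|Y x| <= 1 &
    forall n (Z : T -> R), (m <= n)%N -> measurable_fun setT (Z : GT n -> R) ->
      (forall x, `|Z x| <= 1) ->
      `|expect P (fun x => \1_A x * Z x) - expect P (fun x => Y x * Z x)| <= e].
Proof.
move=> mA e0.
have b1 : bounded_rv (\1_A : T -> R) := bounded_rv_indic mA.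
have n1 x : `|\1_A x : R| <= 1.
  by rewrite indicE; case: (_ \in _); rewrite ?normr1 ?normr0.
have /choice[Y YP] : forall m, exists Y : T -> R,
    [/\ measurable_fun setT (Y : GT m -> R), forall x, `|Y x| <= 1 &
    forall H : T -> R, bounded_rv (H : GT m -> R) ->
      expect P (fun x => H x * Y x) = expect P (fun x => H x * \1_A x)].
  by move=> m; apply: bounded_cond_exp => //; exact: filtration_sub.
have bY m : bounded_rv (Y m : GT m -> R).
  by have [mY Y1 _] := YP m; split => //; exists 1.
have bY' m : bounded_rv (Y m) := sub_sigma_bounded_rv (filtration_sub m) (bY m).
pose q m := expect P (fun x => Y m x ^+ 2).
have iY2 m : integrable_rv P (fun x => Y m x ^+ 2).
  by apply: bounded_integrable; exact: bounded_rvX.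
have qdiff m n : (m <= n)%N -> expect P (fun x => (Y n x - Y m x) ^+ 2) = q n - q m.
  move=> mn.
  have E1 : expect P (fun x => Y m x * Y n x) = q m.
    have [_ _ ->] := YP n; last exact: filtration_bounded (bY m).
    have [_ _ <-//] := YP m.
  rewrite (_ : (fun x => _) = (fun x => (Y n x ^+ 2 - 2 * (Y m x * Y n x)) + Y m x ^+ 2)).
    rewrite expectD// ?expectB// ?expectZ ?E1 -/(q m) -/(q n).
    - ring.
    - by apply: bounded_integrable; exact: bounded_rvM.
    - by apply: integrable_rvZ; apply: bounded_integrable; exact: bounded_rvM.
    - apply: integrable_rvB => //; apply: integrable_rvZ; apply: bounded_integrable.
      exact: bounded_rvM.
  by apply/funext => x; ring.
have q1 m : q m <= 1.
  rewrite -[leRHS](expect_cst P); apply: expect_le => //.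
    by apply: bounded_integrable; exact: bounded_rv_cst.
  move=> x; rewrite -(real_normK (num_real _)) expr_le1//; by have [] := YP m.
have qnd : nondecreasing_seq q.
  move=> m n mn; rewrite -subr_ge0 -qdiff//; apply: expect_ge0 => x; exact: sqr_ge0.
have qcv : q n @[n --> \oo] --> limn q.
  apply: nondecreasing_is_cvgn => //; exists 1 => _ [n _ <-]; exact: q1.
(* [expect_norm_sqr] will be used with threshold [e / 2] and a second moment at most [(e / 2)^2],
   which adds up to [e]. *)
have e20 : 0 < e / 2 by rewrite divr_gt0.
have [m0 _ m0P] : \forall n \near \oo, limn q - q n < (e / 2) ^+ 2.
  have /cvgrPdist_lt/(_ _ (exprn_gt0 2 e20)) := qcv.
  by apply: filterS => n /=; apply: le_lt_trans; exact: ler_norm.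
exists m0 => m m0m; exists (Y m); have [mY Y1 _] := YP m; split => // n Z mn mZ Z1.
have bZ : bounded_rv (Z : GT n -> R) by split => //; exists 1.
have bZ' := sub_sigma_bounded_rv (filtration_sub n) bZ.
have [_ _ YnE] := YP n.
(* Since [Z] is [G n]-measurable, [1_A] may be replaced by [Y n], and only [Y n - Y m] has to be
   small in L^1. *)
rewrite (_ : expect P (fun x => \1_A x * Z x) = expect P (fun x => Z x * Y n x)); last first.
  by rewrite YnE//; congr expect; apply/funext => x; rewrite mulrC.
rewrite -expectB; [|by apply: bounded_integrable; exact: bounded_rvM..].
apply: (@le_trans _ _ (expect P (fun x => `|Y n x - Y m x|))).
  apply: expect_norm_le.
  - by apply: bounded_integrable; apply: bounded_rvB; exact: bounded_rvM.
  - by apply: bounded_integrable; apply: bounded_rv_norm; exact: bounded_rvB.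
  - move=> x; rewrite [Y m x * _]mulrC -mulrBr normrM -[leRHS]mul1r ler_pM//.
have bD : bounded_rv (fun x => Y n x - Y m x) by exact: bounded_rvB.
have [_] := expect_norm_sqr (P := P) e20 (bounded_rv_measurable bD)
  (bounded_integrable P (bounded_rvX 2 bD)).
move=> /le_trans; apply; rewrite qdiff// [leRHS](splitr e) lerD2l ler_pdivrMr// -expr2.
apply: le_trans (ltW (m0P m m0m)); rewrite lerD2r.
by apply: nondecreasing_cvgn_le => //; apply/cvg_ex; exists (limn q).
Qed.

End filtrations.

(** * A central limit theorem for bounded martingales *)

Section martingale_clt.
Context {R : realType} {d : measure_display} {T : measurableType d}.
Variables (P : probability T R) (G : nat -> set (set T)).
Hypothesis GF : filtration G.
Notation GT n := (g_sigma_algebraType (G n)).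
Variables (D V : nat -> T -> R) (c : nat -> R) (C B : R).
Hypothesis D_measurable : forall k, measurable_fun setT (D k : GT k.+1 -> R).
Hypothesis D_le : forall k x, `|D k x| <= C.
Hypothesis V_measurable : forall k, measurable_fun setT (V k : GT k -> R).
Hypothesis V_ge0 : forall k x, 0 <= V k x.
Hypothesis V_le : forall k x, V k x <= B.
Hypothesis D_martingale : forall k (H : T -> R), bounded_rv (H : GT k -> R) ->
  expect P (fun x => H x * D k x) = 0.
(** [V k] is the conditional variance only up to an error [c k], measured against test variables:
    for an array the covariances between columns are small rather than zero. *)
Hypothesis D_variance : forall k (H : T -> R), measurable_fun setT (H : GT k -> R) ->
  (forall x, `|H x| <= 1) -> `|expect P (fun x => H x * (D k x ^+ 2 - V k x))| <= c k.

Let sums n x := \sum_(k < n) D k x.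

Let bD k : bounded_rv (D k).
Proof.
apply: (sub_sigma_bounded_rv (filtration_sub GF k.+1)).
by split; [exact: D_measurable|exists C].
Qed.

Let V_norm k x : `|V k x| <= B.
Proof. by rewrite ger0_norm. Qed.

Let bVG k : bounded_rv (V k : GT k -> R).
Proof. by split => //; exists B. Qed.

Let bV k : bounded_rv (V k).
Proof. exact: (sub_sigma_bounded_rv (filtration_sub GF k)). Qed.

Lemma sums_measurable n : measurable_fun setT (sums n : GT n -> R).
Proof.
apply: measurable_sum => k.
by apply: (@filtration_measurable _ _ _ _ GF k.+1 n).
Qed.

Let sums_bounded n : bounded_rv (sums n).
Proof. by apply: bounded_rv_sum. Qed.

Let sums_le n x : `|sums n x| <= n%:R * C.
Proof.
rewrite (le_trans (ler_norm_sum _ _ _))// (le_trans (ler_sum _ (fun (i : 'I_n) _ => D_le i x)))//.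
by rewrite sumr_const card_ord mulr_natl.
Qed.

Let expRNW_le1 (W : T -> R) (a : R) x : 0 <= a -> 0 <= W x ->
  `|expR (- (a * W x))| <= 1.
Proof.
by move=> a0 W0; rewrite ger0_norm ?expR_ge0// expR_le1 oppr_le0 mulr_ge0.
Qed.

(** One increment leaves the cosine and [h V_m] enters the exponent. To second order both changes
    agree: the linear term is killed by the martingale property, and [s^2 D_k^2 / 2] is close in
    conditional mean to [h V_k], then to [h V_m]. With [V] frozen at time [m], the exponential stays
    [G k]-measurable for all [k >= m]. *)
Lemma clt_step m k (Y : T -> R) (th s a h : R) : (m <= k)%N ->
  measurable_fun setT (Y : GT m -> R) -> (forall x, `|Y x| <= 1) ->
  0 <= s -> 0 <= a -> 0 <= C -> h = s ^+ 2 / 2 ->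
  `|expect P (fun x => Y x * expR (- (a * V m x)) * cos (th + s * sums k.+1 x)) -
    expect P (fun x => Y x * expR (- ((a + h) * V m x)) * cos (th + s * sums k x))| <=
  h * (c k + expect P (fun x => `|V k x - V m x|)) + (2 * (s * C) ^+ 3 + (h * B) ^+ 2).
Proof.
move=> mk mY Y1 s0 a0 C0 hE.
have h0 : 0 <= h by rewrite hE divr_ge0// sqr_ge0.
have B0 (x : T) : 0 <= B by exact: le_trans (V_ge0 0 x) (V_le 0 x).
pose A x := th + s * sums k x.
pose F x := Y x * expR (- (a * V m x)).
have mA : measurable_fun setT (A : GT k -> R).
  by apply: measurable_funD => //; apply: measurable_funM => //; exact: sums_measurable.
have bF : bounded_rv (F : GT k -> R).
  apply: (filtration_bounded GF mk); apply: bounded_rvM; first by split => //; exists 1.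
  apply: bounded_rv_expN => [|x]; last exact: mulr_ge0.
  by apply: measurable_funM.
have F1 x : `|F x| <= 1.
  by rewrite /F normrM -[leRHS]mul1r ler_pM ?expRNW_le1.
have bc : bounded_rv ((fun x => F x * cos (A x)) : GT k -> R).
  by apply: bounded_rvM => //; exact: bounded_rv_cos.
have bs : bounded_rv ((fun x => F x * sin (A x)) : GT k -> R).
  by apply: bounded_rvM => //; exact: bounded_rv_sin.
have Gk := filtration_sub GF k.
have bc' := sub_sigma_bounded_rv Gk bc.
have bs' := sub_sigma_bounded_rv Gk bs.
have bF' := sub_sigma_bounded_rv Gk bF.
have mA' := sub_sigma_measurable_fun Gk mA.
pose r x := F x * ((cos (A x + s * D k x) -
   (cos (A x) - s * D k x * sin (A x) - (s * D k x) ^+ 2 / 2 * cos (A x)))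
   - cos (A x) * (expR (- (h * V m x)) - (1 - h * V m x))).
have cF1 x : `|F x * cos (A x)| <= 1.
  by rewrite normrM -[leRHS]mul1r ler_pM ?cos_norm_le1.
(* An exact decomposition into the martingale term, the conditional variance term, the freezing
   term, and the remainder [r] that collects both Taylor errors. *)
have E x : Y x * expR (- (a * V m x)) * cos (th + s * sums k.+1 x) -
     Y x * expR (- ((a + h) * V m x)) * cos (th + s * sums k x) =
  - s * (F x * sin (A x) * D k x) + (- h * (F x * cos (A x) * (D k x ^+ 2 - V k x)) +
   (- h * (F x * cos (A x) * (V k x - V m x)) + r x)).
  rewrite /r (_ : th + s * sums k.+1 x = A x + s * D k x); last first.
    by rewrite /A /sums big_ord_recr /= mulrDr addrA.
  rewrite mulrDl opprD expRD -/(A x) /F hE; by field.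
have br : bounded_rv r.
  apply: bounded_rvM => //; apply: bounded_rvB; last first.
    apply: bounded_rvM; first exact: bounded_rv_cos.
    apply: bounded_rvB.
      apply: bounded_rv_expN; first by apply: measurable_funM => //; exact: bounded_rv_measurable.
      by move=> y; exact: mulr_ge0.
    apply: bounded_rvB; first exact: bounded_rv_cst.
    by apply: bounded_rvM => //; exact: bounded_rv_cst.
  have bsD : bounded_rv (fun x => s * D k x).
    by apply: bounded_rvM => //; exact: bounded_rv_cst.
  apply: bounded_rvB.
    by apply: bounded_rv_cos; apply: measurable_funD => //; exact: bounded_rv_measurable.
  apply: bounded_rvB.
    apply: bounded_rvB; first exact: bounded_rv_cos.
    by apply: bounded_rvM => //; exact: bounded_rv_sin.
  apply: bounded_rvM; last exact: bounded_rv_cos.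
  by apply: bounded_rvM; [exact: bounded_rvX|exact: bounded_rv_cst].
have rle x : `|r x| <= 2 * (s * C) ^+ 3 + (h * B) ^+ 2.
  rewrite /r normrM -[leRHS]mul1r ler_pM//.
  rewrite (le_trans (ler_normB _ _))// lerD//.
    rewrite (le_trans (cosD_taylor _ _))// ler_wpM2l// lerXn2r ?nnegrE ?mulr_ge0//.
    by rewrite normrM (ger0_norm s0) ler_wpM2l.
  rewrite normrM -[leRHS]mul1r ler_pM ?cos_norm_le1//.
  rewrite (le_trans (expRN_taylor _))// ?mulr_ge0// lerXn2r ?nnegrE ?mulr_ge0//.
  - exact: (B0 x).
  - exact: ler_wpM2l.
have i1 : integrable_rv P (fun x => F x * sin (A x) * D k x).
  by apply: bounded_integrable; exact: bounded_rvM.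
have i2 : integrable_rv P (fun x => F x * cos (A x) * (D k x ^+ 2 - V k x)).
  apply: bounded_integrable; apply: bounded_rvM => //; apply: bounded_rvB => //.
  exact: bounded_rvX.
have bVV : bounded_rv (fun x => V k x - V m x) by exact: bounded_rvB.
have i3 : integrable_rv P (fun x => F x * cos (A x) * (V k x - V m x)).
  by apply: bounded_integrable; apply: bounded_rvM.
have ir := bounded_integrable P br.
rewrite -expectB; last 2 first.
- apply: bounded_integrable; apply: bounded_rvM => //.
  apply: bounded_rv_cos; apply: measurable_funD => //; apply: measurable_funM => //.
  exact: bounded_rv_measurable (sums_bounded k.+1).
- apply: bounded_integrable; apply: bounded_rvM => //; last exact: bounded_rv_cos.
  apply: bounded_rvM.
    apply: (sub_sigma_bounded_rv (filtration_sub GF m)).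
    by split => //; exists 1.
  apply: bounded_rv_expN => [|x]; last by rewrite mulr_ge0// addr_ge0.
  by apply: measurable_funM => //; exact: bounded_rv_measurable.
under eq_fun do rewrite E.
rewrite expectD; [|exact: integrable_rvZ|
  by repeat (apply: integrable_rvD || apply: integrable_rvZ)].
rewrite expectD; [|exact: integrable_rvZ|
  by repeat (apply: integrable_rvD || apply: integrable_rvZ)].
rewrite expectD; [|exact: integrable_rvZ|by []].
rewrite !expectZ// D_martingale// mulr0 add0r mulrDr -addrA.
rewrite (le_trans (ler_normD _ _))// lerD//.
  rewrite normrM normrN (ger0_norm h0) ler_wpM2l// D_variance//.
  exact: bounded_rv_measurable bc.
rewrite (le_trans (ler_normD _ _))// lerD//.
  rewrite normrM normrN (ger0_norm h0) ler_wpM2l// expect_norm_le//.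
    by apply: bounded_integrable; exact: bounded_rv_norm.
  by move=> x; rewrite normrM -[leRHS]mul1r ler_pM.
exact: expect_bound.
Qed.

(** From [n s^2 = 1] and [h = s^2 / 2], exchanging all [n] indices would build exactly the exponent
    [V_m / 2], while the cubic errors sum to order [n s^3 = s]. *)
Lemma clt_telescope m (Y : T -> R) (th s h e : R) n : (m <= n)%N ->
  measurable_fun setT (Y : GT m -> R) -> (forall x, `|Y x| <= 1) ->
  0 <= s -> 0 <= C -> 0 <= B -> h = s ^+ 2 / 2 -> n%:R * s ^+ 2 = 1 ->
  (forall k, (m <= k)%N -> c k + expect P (fun x => `|V k x - V m x|) <= e) ->
  `|expect P (fun x => Y x * cos (th + s * sums n x)) -
    expect P (fun x => Y x * (cos th * expR (- (V m x / 2))))| <=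
  e + s * (2 * m%:R * C + 2 * C ^+ 3) + s ^+ 2 * (m%:R * B + B ^+ 2).
Proof.
move=> mn mY Y1 s0 C0 B0 hE ns eP.
have h0 : 0 <= h by rewrite hE divr_ge0// sqr_ge0.
have bY' : bounded_rv Y.
  apply: (sub_sigma_bounded_rv (filtration_sub GF m)).
  by split => //; exists 1.
have bexp a : 0 <= a -> bounded_rv (fun x => expR (- (a * V m x))).
  move=> a0; apply: bounded_rv_expN => [|x]; last exact: mulr_ge0.
  by apply: measurable_funM => //; exact: bounded_rv_measurable.
have bcos k : bounded_rv (fun x => cos (th + s * sums k x)).
  apply: bounded_rv_cos; apply: measurable_funD => //; apply: measurable_funM => //.
  exact: bounded_rv_measurable.
(* Interpolation: the [n - k] increments absent from the cosine are represented by Gaussian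
   variance. *)
pose u k := expect P (fun x => Y x * expR (- ((n - k)%:R * h * V m x)) *
  cos (th + s * sums k x)).
pose dl := h * e + (2 * (s * C) ^+ 3 + (h * B) ^+ 2).
have e0 : 0 <= e.
  apply: le_trans (eP m (leqnn m)); rewrite addr_ge0 ?expect_ge0//.
  apply: le_trans (@D_variance m (fun _ => 0) _ _) => // x.
  by rewrite normr0.
have dl0 : 0 <= dl.
  by rewrite /dl !addr_ge0 ?mulr_ge0 ?exprn_ge0 ?mulr_ge0.
have step j : (m + j <= n)%N -> `|u (m + j)%N - u m| <= j%:R * dl.
  elim: j => [|j ih] jn; first by rewrite addn0 subrr normr0 mul0r.
  have jn' : (m + j < n)%N by rewrite -addnS.
  rewrite (_ : u _ - u m = (u (m + j.+1)%N - u (m + j)%N) + (u (m + j)%N - u m)); last by ring.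
  rewrite -natr1 mulrDl mul1r addrC (le_trans (ler_normD _ _))// addrC [leRHS]addrC.
  rewrite lerD ?ih 1?ltnW// /u addnS.
  have := @clt_step m (m + j)%N Y th s ((n - (m + j).+1)%:R * h) h
    (leq_addr _ _) mY Y1 s0 (mulr_ge0 (ler0n _ _) h0) C0 hE.
  have -> : (n - (m + j).+1)%:R * h + h = (n - (m + j))%:R * h.
    by rewrite -[X in _ + X]mul1r -mulrDl natr1 -subSn// subSS.
  move=> /le_trans; apply; by rewrite /dl lerD2r ler_wpM2l// eP// leq_addr.
have {step} := step (n - m)%N; rewrite subnKC// => /(_ (leqnn _)) step.
have un : u n = expect P (fun x => Y x * cos (th + s * sums n x)).
  rewrite /u subnn; congr expect; apply/funext => x.
  by rewrite !mul0r oppr0 expR0 mulr1.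
rewrite -un.
(* The cost of the first [m] indices: their increments are dropped from the cosine, and the exponent
   [(n - m) h V_m] is completed to [n h V_m = V_m / 2]. *)
have um : `|u m - expect P (fun x => Y x * (cos th * expR (- (V m x / 2))))| <=
    2 * s * (m%:R * C) + m%:R * h * B.
  rewrite /u -expectB; last 2 first.
  - apply: bounded_integrable; apply: bounded_rvM => //; apply: bounded_rvM => //.
    by apply: bexp; rewrite mulr_ge0.
  - apply: bounded_integrable; apply: bounded_rvM => //; apply: bounded_rvM.
      exact: bounded_rv_cst.
    have -> : (fun x => expR (- (V m x / 2))) = (fun x => expR (- (2^-1 * V m x))).
      by apply/funext => x; rewrite mulrC.
    exact: bexp.
  apply: expect_bound => [|x].
    apply: bounded_integrable; apply: bounded_rvB.
      apply: bounded_rvM => //; apply: bounded_rvM => //.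
      by apply: bexp; rewrite mulr_ge0.
    apply: bounded_rvM => //; apply: bounded_rvM; first exact: bounded_rv_cst.
    have -> : (fun x => expR (- (V m x / 2))) = (fun x => expR (- (2^-1 * V m x))).
      by apply/funext => y; rewrite mulrC.
    exact: bexp.
  set E1 := expR _; set E2 := expR _; set c1 := cos _; set c2 := cos _.
  rewrite (_ : _ - _ = Y x * (E1 * (c1 - c2) + c2 * (E1 - E2))); last by ring.
  rewrite normrM -[leRHS]mul1r ler_pM// (le_trans (ler_normD _ _))// lerD//.
    rewrite normrM -[leRHS]mul1r ler_pM//.
      by apply: expRNW_le1 => //; rewrite mulr_ge0.
    rewrite (le_trans (cos_lipschitz _ _))// addrAC subrr add0r normrM (ger0_norm s0).
    by rewrite -mulrA ler_wpM2l// ler_wpM2l// sums_le.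
  rewrite normrM -[leRHS]mul1r ler_pM ?cos_norm_le1//.
  rewrite (le_trans (expRN_lipschitz _ _))// ?mulr_ge0//.
  have -> : (n - m)%:R * h * V m x - V m x / 2 = - (m%:R * h * V m x).
    rewrite natrB// hE (_ : _ - _ = (n%:R * s ^+ 2 - 1) * (V m x / 2) -
      m%:R * (s ^+ 2 / 2) * V m x); last by field.
    by rewrite ns subrr mul0r sub0r.
  by rewrite normrN !normrM !ger0_norm// ler_wpM2l// mulr_ge0.
rewrite (_ : u n - _ = (u n - u m) +
  (u m - expect P (fun x => Y x * (cos th * expR (- (V m x / 2)))))); last by ring.
rewrite (le_trans (ler_normD _ _))// (le_trans (lerD step um))//.
have nm : (n - m)%:R * dl <= n%:R * dl by rewrite ler_wpM2r// ler_nat leq_subr.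
have ndl : n%:R * dl = e / 2 + s * (2 * C ^+ 3) + s ^+ 2 * (B ^+ 2 / 4).
  rewrite /dl hE (_ : n%:R * _ = (n%:R * s ^+ 2) * (e / 2) +
    (n%:R * s ^+ 2) * s * (2 * C ^+ 3) + (n%:R * s ^+ 2) * s ^+ 2 * (B ^+ 2 / 4)).
    by rewrite ns !mul1r.
  by field.
apply: (le_trans (lerD nm (lexx _))); rewrite ndl -subr_ge0 hE.
rewrite (_ : _ - _ = e / 2 + s ^+ 2 * (B ^+ 2 * (3 / 4)) + s ^+ 2 * (m%:R * B / 2)); last by field.
by rewrite !addr_ge0 ?mulr_ge0 ?exprn_ge0 ?divr_ge0 ?mulr_ge0.
Qed.

Lemma invr_sqrtn_cvg0 : (Num.sqrt n%:R)^-1 @[n --> \oo] --> (0 : R).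
Proof.
apply/cvgrPdist_le => e e0; near=> n.
have e1 : 0 < e^-1 by rewrite invr_gt0.
have en : e^-1 ^+ 2 <= n%:R by near: n; exact: nbhs_infty_ger.
rewrite sub0r normrN ger0_norm ?invr_ge0 ?sqrtr_ge0//.
have se : e^-1 <= Num.sqrt n%:R.
  by rewrite -(ger0_norm (ltW e1)) -sqrtr_sqr ler_sqrt// (le_trans _ en)// sqr_ge0.
by rewrite -[leRHS]invrK lef_pV2// posrE (lt_le_trans e1 se).
Unshelve. all: by end_near. Qed.

Variable Vinf : T -> R.
Hypothesis Vinf_measurable : measurable_fun setT Vinf.
Hypothesis Vinf_ge0 : forall x, 0 <= Vinf x.
Hypothesis Vinf_le : forall x, Vinf x <= B.
Hypothesis V_cvg : {ae P, forall x, V k x @[k --> \oo] --> Vinf x}.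
Hypothesis c_cvg : c k @[k --> \oo] --> (0 : R).

Theorem bounded_martingale_stable_clt (A : set T) (th : R) : measurable A ->
  expect P (fun x => \1_A x * cos (th + (Num.sqrt n%:R)^-1 * sums n x))
    @[n --> \oo] -->
  expect P (fun x => \1_A x * (cos th * expR (- (Vinf x / 2)))).
Proof.
move=> mA.
have x0 : T := point.
have C0 : 0 <= C by exact: le_trans (normr_ge0 _) (D_le 0 x0).
have B0 : 0 <= B by exact: le_trans (V_ge0 0 x0) (V_le 0 x0).
have bVinf : bounded_rv Vinf by split => //; exists B => x; rewrite ger0_norm.
pose v k := expect P (fun x => `|V k x - Vinf x|).
have v_cvg : v k @[k --> \oo] --> (0 : R).
  rewrite -(expect_cst P 0); apply: (@expect_bounded_cvg _ _ _ _ _ _ (2 * B)).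
  - move=> k; apply: bounded_rv_measurable; apply: bounded_rv_norm; exact: bounded_rvB.
  - exact: measurable_cst.
  - move=> k x; rewrite normr_id (le_trans (ler_normB _ _))// mulrDl mul1r lerD//.
    by rewrite ger0_norm.
  - apply: filterS V_cvg => x Vx; rewrite -(normr0 R) -(subrr (Vinf x)).
    by apply: cvg_norm; apply: cvgB => //; exact: cvg_cst.
have v_tri k m : expect P (fun x => `|V k x - V m x|) <= v k + v m.
  rewrite -expectD; [|by apply: bounded_integrable; apply: bounded_rv_norm; exact: bounded_rvB..].
  apply: expect_le.
  - by apply: bounded_integrable; apply: bounded_rv_norm; exact: bounded_rvB.
  - by apply: integrable_rvD; apply: bounded_integrable; apply: bounded_rv_norm; exact: bounded_rvB.
  - by move=> x; rewrite (distrC (V m x)) ler_distD.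
have b1 : bounded_rv (\1_A : T -> R) := bounded_rv_indic mA.
(* Seven eighths are spent: two on passing from [1_A] to [Y] and back, three on the telescope
   ([c k], [v k] and [v m]), one on its vanishing tail, one on [V m] against [Vinf]. *)
apply/cvgrPdist_le => e e0; have e6 : 0 < e / 8 by rewrite divr_gt0.
have [m0 m0P] := bounded_martingale_approx P GF mA e6.
have [m1 _ m1P] : \forall k \near \oo, c k <= e / 8 /\ v k <= e / 8.
  have /cvgrPdist_le/(_ _ e6) c1 := c_cvg; have /cvgrPdist_le/(_ _ e6) v1 := v_cvg.
  near=> k; split.
    have : `|0 - c k| <= e / 8 by near: k.
    by rewrite sub0r normrN; apply: le_trans; exact: ler_norm.
  have : `|0 - v k| <= e / 8 by near: k.
  by rewrite sub0r normrN; apply: le_trans; exact: ler_norm.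
pose m := maxn m0 m1.
have mm1 k : (m <= k)%N -> c k <= e / 8 /\ v k <= e / 8.
  by move=> mk; apply: m1P => /=; rewrite (leq_trans _ mk)// leq_maxr.
have [Y [mY Y1 YP]] := m0P m (leq_maxl _ _).
have bY : bounded_rv Y.
  apply: (sub_sigma_bounded_rv (filtration_sub GF m)).
  by split => //; exists 1.
have tail : \forall n \near \oo,
    (Num.sqrt n%:R)^-1 * (2 * m%:R * C + 2 * C ^+ 3) +
    (Num.sqrt n%:R)^-1 ^+ 2 * (m%:R * B + B ^+ 2) <= e / 8.
  pose K1 := 2 * m%:R * C + 2 * C ^+ 3; pose K2 := m%:R * B + B ^+ 2.
  have := invr_sqrtn_cvg0 => s_cvg.
  have : (Num.sqrt n%:R)^-1 * K1 + (Num.sqrt n%:R)^-1 ^+ 2 * K2 @[n --> \oo] -->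
      (0 * K1 + 0 * 0 * K2 : R).
    apply: cvgD; first by apply: cvgM => //; exact: cvg_cst.
    by apply: cvgM; [under eq_fun do rewrite expr2; exact: cvgM|exact: cvg_cst].
  rewrite !mul0r addr0 => /cvgrPdist_le/(_ _ e6).
  by apply: filterS => n; rewrite sub0r normrN; apply: le_trans; exact: ler_norm.
near=> n.
set s := (Num.sqrt n%:R)^-1.
have n0 : (0 < n)%N by near: n; exact: nbhs_infty_gt.
have mn : (m <= n)%N by near: n; exact: nbhs_infty_ge.
have ns : n%:R * s ^+ 2 = 1.
  by rewrite exprVn sqr_sqrtr// divff// pnatr_eq0 -lt0n.
have s0 : 0 <= s by rewrite invr_ge0 sqrtr_ge0.
pose W (U : T -> R) := fun x => cos th * expR (- (U x / 2)).
have bW (U : T -> R) : measurable_fun setT U -> (forall x, 0 <= U x) -> bounded_rv (W U).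
  move=> mU U0; apply: bounded_rvM; first exact: bounded_rv_cst.
  by apply: bounded_rv_expN => [|x]; [exact: measurable_funM|rewrite divr_ge0].
have W1 (U : T -> R) x : 0 <= U x -> `|W U x| <= 1.
  move=> U0; rewrite normrM -[leRHS]mul1r ler_pM ?cos_norm_le1//.
  by rewrite ger0_norm ?expR_ge0// expR_le1 oppr_le0 divr_ge0.
have mcos : measurable_fun setT ((fun x => cos (th + s * sums n x)) : GT n -> R).
  apply: measurableT_comp; first exact: measurable_cos.
  by apply: measurable_funD => //; apply: measurable_funM => //; exact: sums_measurable.
have h1 := YP n (fun x => cos (th + s * sums n x)) mn mcos (fun x => cos_norm_le1 _).
have h2 := @clt_telescope m Y th s (s ^+ 2 / 2) (3 * (e / 8)) n mn mY Y1 s0 C0 B0 erefl ns.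
have {}h2 := h2 ltac:(by move=> k mk; have [ck vk] := mm1 k mk; have [_ vm] := mm1 m (leqnn m);
  have := v_tri k m; move: ck vk vm; lra).
have mWm : measurable_fun setT (W (V m) : GT m -> R).
  apply: measurable_funM => //; apply: measurableT_comp => //.
  by apply: measurableT_comp => //; apply: measurable_funM.
have h3 := YP m (W (V m)) (leqnn m) mWm (fun x => W1 (V m) x (V_ge0 m x)).
have h4 : `|expect P (fun x => \1_A x * W (V m) x) -
            expect P (fun x => \1_A x * W Vinf x)| <= e / 8.
  have [_ vm] := mm1 m (leqnn m); apply: le_trans vm.
  rewrite -expectB; last 2 first.
  - apply: bounded_integrable; apply: bounded_rvM => //; apply: bW => //.
    exact: bounded_rv_measurable.
  - by apply: bounded_integrable; apply: bounded_rvM => //; exact: bW.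
  apply: expect_norm_le.
  - apply: bounded_integrable; apply: bounded_rvB; apply: bounded_rvM => //; apply: bW => //.
    exact: bounded_rv_measurable.
  - by apply: bounded_integrable; apply: bounded_rv_norm; exact: bounded_rvB.
  move=> x; rewrite -mulrBr normrM -[leRHS]mul1r ler_pM//.
    by rewrite indicE; case: (_ \in _); rewrite ?normr1 ?normr0.
  rewrite /W -mulrBr normrM -[leRHS]mul1r ler_pM ?cos_norm_le1//.
  rewrite (le_trans (expRN_lipschitz _ _))// ?divr_ge0//.
  rewrite -mulrBl normrM (ger0_norm (_ : 0 <= 2^-1))//.
  by have := normr_ge0 (V m x - Vinf x); lra.
have h5 : s * (2 * m%:R * C + 2 * C ^+ 3) + s ^+ 2 * (m%:R * B + B ^+ 2) <= e / 8.
  by rewrite /s; near: n.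
move: h1 h2 h3 h4 h5; rewrite -/(W (V m)) -/(W Vinf).
set a1 := expect P _; set a2 := expect P _; set a3 := expect P _; set a4 := expect P _.
set a5 := expect P _.
rewrite distrC !ler_distl => /andP[? ?] /andP[? ?] /andP[? ?] /andP[? ?] ?.
by apply/andP; split; lra.
Unshelve. all: by end_near. Qed.

End martingale_clt.

(** * Partially c.i.d. arrays: bounded functions *)

Lemma cvgr_sum {R : realType} (J : Type) (s : seq J) (u : J -> nat -> R) (l : J -> R) :
  (forall j, u j n @[n --> \oo] --> l j) ->
  \sum_(j <- s) u j n @[n --> \oo] --> \sum_(j <- s) l j.
Proof.
move=> ul; elim: s => [|j s ih].
  by rewrite big_nil; under eq_fun do rewrite big_nil; exact: cvg_cst.
by rewrite big_cons; under eq_fun do rewrite big_cons; apply: cvgD.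
Qed.

Lemma ae_forall_countable {R : realType} {d : measure_display} {T : measurableType d}
    {I : countType} (mu : {measure set T -> \bar R}) (Q : I -> T -> Prop) :
  (forall i, {ae mu, forall x, Q i x}) -> {ae mu, forall x i, Q i x}.
Proof.
move=> h; have : {ae mu, forall x n, forall i : I, unpickle n = Some i -> Q i x}.
  apply/ae_foralln => n; case: (unpickle n) => [i|]; last exact: aeW.
  by apply: filterS (h i) => x Qx _ [<-].
by apply: filterS => x Qx i; apply: (Qx (pickle i)); exact: pickleK.
Qed.

Section random_probabilities.
Context {R : realType} {d : measure_display} {T : measurableType d}.

Lemma measurable_expect_random_prob {d'} {U : measurableType d'}
    (mu : T -> probability U R) (f : U -> R) :
  random_prob mu -> bounded_rv f -> measurable_fun setT (fun w => expect (mu w) f).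
Proof.
move=> rmu; pose Q f := measurable_fun setT (fun w => expect (mu w) f).
apply: (bounded_rv_ind (Q := Q)); rewrite {}/Q.
- move=> B mB; under eq_fun do rewrite expect_indic//.
  by apply: measurableT_comp => //; exact: rmu.
- move=> c g h bg bh mg mh.
  rewrite (_ : (fun w => _) = (fun w => c * expect (mu w) g + expect (mu w) h)).
    by apply: measurable_funD => //; exact: measurable_funM.
  apply/funext => w; rewrite expectD ?expectZ//; try exact: bounded_integrable.
  by apply: integrable_rvZ; exact: bounded_integrable.
- move=> h g M bh bg hM hg mh.
  apply: (@measurable_fun_cvg _ T R setT (fun n w => expect (mu w) (h n))) => // w _.
  apply: (@expect_bounded_cvg _ _ _ _ _ _ M) => //.
  + by move=> n; exact: bounded_rv_measurable.
  + exact: bounded_rv_measurable.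
  + exact: aeW.
Qed.

Lemma bounded_expect_random_prob {d'} {U : measurableType d'}
    (mu : T -> probability U R) (f : U -> R) :
  random_prob mu -> bounded_rv f -> bounded_rv (fun w => expect (mu w) f).
Proof.
move=> rmu bf; split; first exact: measurable_expect_random_prob.
have [_ [M fM]] := bf; exists M => w.
by apply: expect_bound => //; exact: bounded_integrable.
Qed.

Lemma expect_variance_ge0 {d'} {U : measurableType d'} (mu : probability U R) (f : U -> R) :
  integrable_rv mu f -> integrable_rv mu (fun x => f x ^+ 2) ->
  0 <= expect mu (fun x => f x ^+ 2) - expect mu f ^+ 2.
Proof.
move=> fi f2i; set m := expect mu f.
have ci c : integrable_rv mu (fun _ => c).
  by apply: bounded_integrable; exact: bounded_rv_cst.
suff -> : expect mu (fun x => f x ^+ 2) - m ^+ 2 = expect mu (fun x => (f x - m) ^+ 2).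
  by apply: expect_ge0 => x; exact: sqr_ge0.
rewrite [in RHS](_ : (fun x => _) = (fun x => f x ^+ 2 - 2 * m * f x + m ^+ 2)).
  rewrite expectD// ?expectB ?expectZ ?expect_cst -/m//; first ring.
  - exact: integrable_rvZ.
  - by apply: integrable_rvB => //; exact: integrable_rvZ.
by apply/funext => x; ring.
Qed.

End random_probabilities.

Section partially_cid_arrays.
Context {R : realType} {d : measure_display} {T : measurableType d} {I : countType}.
Variables (P : probability T R) (G : nat -> set (set T)) (X : nat -> I -> T -> R).
Hypothesis cid : partially_cid P G X.
Notation GT n := (g_sigma_algebraType (G n)).
Notation GJ n j := (g_sigma_algebraType (Gnj G X n j)).

Lemma cid_filtration : filtration G.
Proof. by case: cid. Qed.

Lemma cid_sub n : sub_sigma (G n).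
Proof. by case: cid_filtration. Qed.

Lemma cid_adapted n i : measurable_fun setT (X n.+1 i : GT n.+1 -> R).
Proof.
apply/(G_measurableP (cid_sub n.+1)); case: cid => _ + _; exact.
Qed.

Lemma cid_measurable n i : measurable_fun setT (X n.+1 i).
Proof. by apply: (sub_sigma_measurable_fun (cid_sub n.+1)); exact: cid_adapted. Qed.

(** This lets a factor that involves the other columns of row [n + 1] be tested against the
    predictive laws from time [n + 1] on. *)
Lemma Gnj_subS n j : Gnj G X n j `<=` G n.+1.
Proof.
apply: smallest_sub; first by case: (cid_sub n.+1).
move=> A [GA|[i [B [ij mB ->]]]]; first by case: cid_filtration => _; apply.
by case: cid => _ + _; apply.
Qed.

Lemma Gnj_sub n j : sub_sigma (Gnj G X n j).
Proof.
split; first exact: smallest_sigma_algebra.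
by apply: subset_trans (Gnj_subS (j:=j)) _; case: (cid_sub n.+1).
Qed.

Lemma Gnj_measurable n j (f : T -> R) :
  measurable_fun setT (f : GT n -> R) -> measurable_fun setT (f : GJ n j -> R).
Proof.
move=> /(G_measurableP (cid_sub n)) mf; apply/(G_measurableP (Gnj_sub n j)) => B mB.
by apply: sub_sigma_algebra; left; exact: mf.
Qed.

Lemma Gnj_measurable_other n i j : i != j ->
  measurable_fun setT (X n.+1 i : GJ n j -> R).
Proof.
move=> ij; apply/(G_measurableP (Gnj_sub n j)) => B mB.
by apply: sub_sigma_algebra; right; exists i, B.
Qed.

Lemma Gnj_measurableS n j (f : T -> R) :
  measurable_fun setT (f : GJ n j -> R) -> measurable_fun setT (f : GT n.+1 -> R).
Proof.
move=> /(G_measurableP (Gnj_sub n j)) mf; apply/(G_measurableP (cid_sub n.+1)) => B mB.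
by apply: (@Gnj_subS n j); exact: mf.
Qed.

Lemma bounded_rv_X (f : R -> R) n i : bounded_rv f -> bounded_rv (fun w => f (X n.+1 i w)).
Proof. by move=> [mf bf]; apply: bounded_rv_comp => //; exact: cid_measurable. Qed.

Lemma cid_expect_shift n k j (f : R -> R) (H : T -> R) : bounded_rv f ->
  bounded_rv (H : GJ n j -> R) ->
  expect P (fun w => H w * f (X n.+1 j w)) = expect P (fun w => H w * f (X (n + k.+1)%N j w)).
Proof.
move=> bf bH; rewrite addnS.
have b1 := bounded_integrable P (bounded_rv_X n j bf).
have b2 := bounded_integrable P (bounded_rv_X (n + k)%N j bf).
have Y1 := cond_expP (Gnj_sub n j) b1; have Y2 := cond_expP (Gnj_sub n j) b2.
rewrite -(is_cond_exp_expectM (Gnj_sub n j) b1 Y1 bH).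
rewrite -(is_cond_exp_expectM (Gnj_sub n j) b2 Y2 bH).
have mH := (sub_sigma_bounded_rv (Gnj_sub n j) bH).1.
apply: eq_expect_ae.
- apply: measurable_funM => //.
  exact: (sub_sigma_measurable_fun (Gnj_sub n j) (is_cond_exp_measurable (Gnj_sub n j) Y1)).
- apply: measurable_funM => //.
  exact: (sub_sigma_measurable_fun (Gnj_sub n j) (is_cond_exp_measurable (Gnj_sub n j) Y2)).
- case: cid => _ _ /(_ j n k.+1 f erefl bf.1 bf.2); rewrite addnS.
  by apply: filterS => w /= ->.
Qed.

(** Time 0 and the test variable 1 show that each column is identically distributed; the uniformity
    in time of all truncation estimates comes from here. *)
Lemma cid_expect n j (f : R -> R) : bounded_rv f ->
  expect P (fun w => f (X n.+1 j w)) = expect P (fun w => f (X 1 j w)).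
Proof.
move=> bf; have b1 : bounded_rv ((fun _ => 1 : R) : GJ 0 j -> R) by exact: bounded_rv_cst.
have := cid_expect_shift n bf b1; rewrite add0n.
by under eq_fun do rewrite mul1r; under [in RHS]eq_fun do rewrite mul1r.
Qed.

Variable K : I -> nat -> T -> probability R R.
Variable alpha : I -> T -> probability R R.
Hypothesis K_distr : forall i n, reg_cond_distr P (G n) (X n.+1 i) (K i n).
Hypothesis K_weak : forall i, {ae P, forall w, weak_conv (fun n => K i n w) (alpha i w)}.
Hypothesis alpha_random : forall i, random_prob (alpha i).

Lemma K_cond_exp i n (f : R -> R) : bounded_rv f ->
  is_cond_exp P (G n) (fun w => f (X n.+1 i w)) (fun w => expect (K i n w) f).
Proof.
move=> bf.
exact: (reg_cond_distrP (cid_sub n) (cid_measurable n i) (K_distr i n) bf).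
Qed.

Lemma K_bounded i n (f : R -> R) : bounded_rv f ->
  bounded_rv ((fun w => expect (K i n w) f) : GT n -> R).
Proof.
move=> bf; split; first exact: (is_cond_exp_measurable (cid_sub n) (K_cond_exp i n bf)).
have [_ [M fM]] := bf; exists M => w.
by apply: expect_bound => //; exact: bounded_integrable.
Qed.

Lemma K_expectM i n (f : R -> R) (H : T -> R) : bounded_rv f ->
  bounded_rv (H : GT n -> R) ->
  expect P (fun w => H w * expect (K i n w) f) = expect P (fun w => H w * f (X n.+1 i w)).
Proof.
move=> bf bH; apply: is_cond_exp_expectM bH; first exact: cid_sub.
  by apply: bounded_integrable; exact: bounded_rv_X.
exact: K_cond_exp.
Qed.

Lemma K_cvg i (f : R -> R) : continuous f -> bounded_rv f ->
  {ae P, forall w, expect (K i n w) f @[n --> \oo] --> expect (alpha i w) f}.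
Proof.
move=> cf bf; apply: filterS (K_weak i) => w /(_ f cf bf.2) h.
by apply: fine_cvg; rewrite -expectK//; exact: bounded_integrable.
Qed.

Section bounded_function.
Variables (f : R -> R) (c : R).
Hypothesis f_continuous : continuous f.
Hypothesis f_le : forall x, `|f x| <= c.

Let bf : bounded_rv f.
Proof. by split; [exact: continuous_measurable_fun|exists c]. Qed.

Let bf2 : bounded_rv (fun x => f x ^+ 2).
Proof. exact: bounded_rvX. Qed.

Let f2_continuous : continuous (fun x => f x ^+ 2).
Proof.
move=> y; under eq_fun do rewrite expr2.
by apply: cvgM; exact: f_continuous.
Qed.

Let c0 : 0 <= c.
Proof. exact: le_trans (normr_ge0 _) (f_le 0). Qed.

Let x i n w := f (X n.+1 i w).
Let m i n w := expect (K i n w) f.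
Let m2 i n w := expect (K i n w) (fun x => f x ^+ 2).
Let a i w := expect (alpha i w) f.

Let bx i n : bounded_rv (x i n).
Proof. exact: bounded_rv_X. Qed.

Let bmG i n : bounded_rv (m i n : GT n -> R).
Proof. exact: K_bounded. Qed.

Let bm i n : bounded_rv (m i n).
Proof. exact: (sub_sigma_bounded_rv (cid_sub n)). Qed.

Let bm2G i n : bounded_rv (m2 i n : GT n -> R).
Proof. exact: K_bounded. Qed.

Let bm2 i n : bounded_rv (m2 i n).
Proof. exact: (sub_sigma_bounded_rv (cid_sub n)). Qed.

Let ba i : bounded_rv (a i).
Proof. exact: bounded_expect_random_prob. Qed.

Let m_le i n w : `|m i n w| <= c.
Proof. by apply: expect_bound => //; exact: bounded_integrable. Qed.

Let a_le i w : `|a i w| <= c.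
Proof. by apply: expect_bound => //; exact: bounded_integrable. Qed.

Let xG i n : measurable_fun setT (x i n : GT n.+1 -> R).
Proof. by apply: measurableT_comp; [exact: bf.1|exact: cid_adapted]. Qed.

Let GF := cid_filtration.

Lemma centered_expectM i n (H : T -> R) : bounded_rv (H : GT n -> R) ->
  expect P (fun w => H w * (x i n w - m i n w)) = 0.
Proof.
move=> bH; have bH' := sub_sigma_bounded_rv (cid_sub n) bH.
under eq_fun do rewrite mulrBr.
rewrite expectB; try by apply: bounded_integrable; exact: bounded_rvM.
by rewrite K_expectM// subrr.
Qed.

Lemma diagonal_variance i n (H : T -> R) : bounded_rv (H : GT n -> R) ->
  expect P (fun w => H w * ((x i n w - m i n w) * (x i n w - m i n w) -
    (m2 i n w - m i n w ^+ 2))) = 0.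
Proof.
move=> bH; have bH' := sub_sigma_bounded_rv (cid_sub n) bH.
rewrite (_ : (fun w => _) = (fun w => (H w * x i n w ^+ 2 - H w * m2 i n w) -
  2 * (H w * m i n w * (x i n w - m i n w)))); last by apply/funext => w; ring.
have b1 : bounded_rv (fun w => H w * m i n w * (x i n w - m i n w)).
  by apply: bounded_rvM; [exact: bounded_rvM|exact: bounded_rvB].
have b2 : bounded_rv (fun w => H w * x i n w ^+ 2).
  by apply: bounded_rvM => //; exact: bounded_rvX.
have b3 : bounded_rv (fun w => H w * m2 i n w) by exact: bounded_rvM.
rewrite expectB; [|by apply: bounded_integrable; exact: bounded_rvB|
  by apply: integrable_rvZ; exact: bounded_integrable].
rewrite expectB; try exact: bounded_integrable.
rewrite expectZ; last exact: bounded_integrable.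
rewrite centered_expectM ?mulr0 ?subr0; last exact: bounded_rvM.
by rewrite (@K_expectM i n (fun x => f x ^+ 2))// subrr.
Qed.

(* Off the diagonal, [U := H (x_i - m_i)] is measurable for the enlarged
   sigma-algebra of column [j], so that [x_j] may be replaced inside [E[U x_j]]
   by the values of column [j] at arbitrarily late times. *)
Lemma offdiagonal_covariance i j n (H : T -> R) : i != j ->
  measurable_fun setT (H : GT n -> R) -> (forall w, `|H w| <= 1) ->
  `|expect P (fun w => H w * ((x i n w - m i n w) * (x j n w - m j n w)))| <=
  2 * c * expect P (fun w => `|m j n w - a j w|).
Proof.
move=> ij mH H1; have bH : bounded_rv (H : GT n -> R) by split => //; exists 1.
pose U w := H w * (x i n w - m i n w).
have U_le w : `|U w| <= 2 * c.
  rewrite normrM -[leRHS]mul1r ler_pM// (le_trans (ler_normB _ _))//.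
  by rewrite mulrDl mul1r lerD//; exact: f_le.
have mU : measurable_fun setT (U : GJ n j -> R).
  apply: measurable_funM; first exact: Gnj_measurable.
  apply: measurable_funB; last by apply: Gnj_measurable; exact: (bmG i n).1.
  by apply: measurableT_comp; [exact: bf.1|exact: Gnj_measurable_other].
have bUJ : bounded_rv (U : GJ n j -> R) by split => //; exists (2 * c).
have bU : bounded_rv U := sub_sigma_bounded_rv (Gnj_sub n j) bUJ.
(* The predictive means are taken from time [n + q.+1] on because [U] is known to be measurable for
   [G n.+1]. For every [q], conditioning at that time and shifting column [j] back give the
   left-hand side, so the sequence in [q] is constant. *)
have E1 : expect P (fun w => U w * x j n w) = expect P (fun w => U w * a j w).
  have cv : expect P (fun w => U w * m j (n + q.+1)%N w) @[q --> \oo] -->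
      expect P (fun w => U w * a j w).
    apply: (@expect_bounded_cvg _ _ _ _ _ _ (2 * c * c)).
    - move=> q; apply: measurable_funM; [exact: bU.1|exact: (bm _ _).1].
    - by apply: measurable_funM; [exact: bU.1|exact: (ba _).1].
    - by move=> q w; rewrite normrM ler_pM.
    - apply: filterS (K_cvg j f_continuous bf) => w h; apply: cvgMr.
      rewrite (_ : (fun q => m j (n + q.+1)%N w) = (fun q => m j (q + n.+1)%N w)).
        by rewrite (cvg_shiftn n.+1 (fun q => m j q w)).
      by apply/funext => q; rewrite addnS -addSn addnC.
  apply: cvgn_unique cv.
  rewrite (_ : (fun q => _) = fun _ => expect P (fun w => U w * x j n w)).
    exact: cvg_cst.
  apply/funext => q; rewrite K_expectM//; last first.
    have mn : (n.+1 <= n + q.+1)%N by rewrite addnS ltnS leq_addr.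
    apply: (filtration_bounded GF mn).
    by split; [exact: Gnj_measurableS mU|exists (2 * c)].
  by have := cid_expect_shift q.+1 bf bUJ; rewrite addnS => <-.
have E2 : expect P (fun w => U w * m j n w) = 0.
  rewrite (_ : (fun w => _) = (fun w => H w * m j n w * (x i n w - m i n w))).
    by apply: centered_expectM; exact: bounded_rvM.
  by apply/funext => w; rewrite /U; ring.
rewrite (_ : (fun w => _) = (fun w => U w * x j n w - U w * m j n w)); last first.
  by apply/funext => w; rewrite /U; ring.
have iU Y : bounded_rv Y -> integrable_rv P (fun w => U w * Y w).
  by move=> bY; apply: bounded_integrable; exact: bounded_rvM.
rewrite expectB ?E1; [|exact: iU..].
rewrite -expectB; [|exact: iU..].
have bd : bounded_rv (fun w => m j n w - a j w) by exact: bounded_rvB.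
rewrite -expectZ; last by apply: bounded_integrable; exact: bounded_rv_norm.
apply: expect_norm_le.
- by apply: integrable_rvB; exact: iU.
- by apply: integrable_rvZ; apply: bounded_integrable; exact: bounded_rv_norm.
- by move=> w; rewrite -mulrBr normrM distrC ler_wpM2r.
Qed.

Variables (J : seq I) (t : I -> R).

Let D k w := \sum_(j <- J) t j * (x j k w - m j k w).
Let V k w := \sum_(i <- J) \sum_(j <- J)
  t i * t j * (if i == j then m2 i k w - m i k w ^+ 2 else 0).
Let Vinf w := \sum_(i <- J) \sum_(j <- J)
  t i * t j * (if i == j then expect (alpha i w) (fun y => f y ^+ 2) - a i w ^+ 2 else 0).

Lemma double_sum_diag (v : I -> R) : uniq J ->
  \sum_(i <- J) \sum_(j <- J) t i * t j * (if i == j then v i else 0) =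
  \sum_(i <- J) t i ^+ 2 * v i.
Proof.
move=> uJ; apply: eq_big_seq => i iJ.
rewrite (bigD1_seq i)//= eqxx big1 ?addr0 ?expr2// => j ji.
by rewrite eq_sym (negbTE ji) mulr0.
Qed.

Let v_ge0 i k w : 0 <= m2 i k w - m i k w ^+ 2.
Proof. by apply: expect_variance_ge0; apply: bounded_integrable. Qed.

Let f2_le y : `|f y ^+ 2| <= c ^+ 2.
Proof. by rewrite normrX lerXn2r ?nnegrE. Qed.

Let v_le i k w : m2 i k w - m i k w ^+ 2 <= c ^+ 2.
Proof.
rewrite lerBlDr (@le_trans _ _ (c ^+ 2))// ?lerDl ?sqr_ge0//.
apply: le_trans (ler_norm _) _; apply: expect_bound => //; exact: bounded_integrable.
Qed.

Let vinf_ge0 i w : 0 <= expect (alpha i w) (fun y => f y ^+ 2) - a i w ^+ 2.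
Proof. by apply: expect_variance_ge0; apply: bounded_integrable. Qed.

Let vinf_le i w : expect (alpha i w) (fun y => f y ^+ 2) - a i w ^+ 2 <= c ^+ 2.
Proof.
rewrite lerBlDr (@le_trans _ _ (c ^+ 2))// ?lerDl ?sqr_ge0//.
apply: le_trans (ler_norm _) _; apply: expect_bound => //; exact: bounded_integrable.
Qed.

Let e_ i n := expect P (fun w => `|m i n w - a i w|).

Let e_cvg i : e_ i n @[n --> \oo] --> (0 : R).
Proof.
rewrite -(expect_cst P 0); apply: (@expect_bounded_cvg _ _ _ _ _ _ (2 * c)).
- by move=> n; apply: bounded_rv_measurable; apply: bounded_rv_norm; exact: bounded_rvB.
- exact: measurable_cst.
- by move=> n w; rewrite normr_id (le_trans (ler_normB _ _))// mulrDl mul1r lerD.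
- apply: filterS (K_cvg i f_continuous bf) => w h.
  rewrite -(normr0 R) -(subrr (a i w)).
  by apply: cvg_norm; apply: cvgB => //; exact: cvg_cst.
Qed.

Theorem bounded_cid_stable_clt (A : set T) (th : R) : uniq J -> measurable A ->
  expect P (fun w => \1_A w * cos (th + (Num.sqrt n%:R)^-1 * \sum_(k < n) D k w))
    @[n --> \oo] -->
  expect P (fun w => \1_A w * (cos th * expR (- (Vinf w / 2)))).
Proof.
move=> uJ mA.
(* The bound of [offdiagonal_covariance] is kept for the diagonal pairs as well, where the error is
   0, so that the double sum need not be split. *)
pose cc k := \sum_(i <- J) \sum_(j <- J) `|t i * t j| * (2 * c * e_ j k).
have e_ge0 i k : 0 <= e_ i k by apply: expect_ge0.
have bxm i k : bounded_rv (fun w => x i k w - m i k w) by exact: bounded_rvB.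
apply: (@bounded_martingale_stable_clt _ _ _ P G GF D V cc
  (\sum_(j <- J) `|t j| * (2 * c)) (\sum_(j <- J) t j ^+ 2 * c ^+ 2)) => //.
- move=> k; apply: measurable_sum => j; apply: measurable_funM => //.
  apply: measurable_funB; first exact: xG.
  by apply: (@filtration_measurable _ _ _ _ GF k k.+1) => //; exact: (bmG j k).1.
- move=> k w; rewrite (le_trans (ler_norm_sum _ _ _))//; apply: ler_sum => j _.
  rewrite normrM ler_wpM2l// (le_trans (ler_normB _ _))//.
  by rewrite mulrDl mul1r lerD//; exact: f_le.
- move=> k; apply: measurable_sum => i; apply: measurable_sum => j.
  apply: measurable_funM => //; have [_|_] := eqVneq i j; last exact: measurable_cst.
  by apply: measurable_funB; [exact: (bm2G i k).1|apply: measurable_funX; exact: (bmG i k).1].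
- move=> k w; rewrite /V double_sum_diag//; apply: sumr_ge0 => i _.
  by rewrite mulr_ge0 ?sqr_ge0.
- move=> k w; rewrite /V double_sum_diag//; apply: ler_sum => i _.
  by rewrite ler_wpM2l ?sqr_ge0.
- move=> k H bH; have bH' := sub_sigma_bounded_rv (cid_sub k) bH.
  rewrite /D; under eq_fun do rewrite mulr_sumr.
  rewrite expect_sum => [|j].
    apply: big1 => j _; under eq_fun do rewrite mulrCA.
    rewrite expectZ ?centered_expectM ?mulr0//.
    by apply: bounded_integrable; exact: bounded_rvM.
  apply: bounded_integrable; apply: bounded_rvM => //; apply: bounded_rvM => //.
  exact: bounded_rv_cst.
- move=> k H mH H1; have bH : bounded_rv (H : GT k -> R) by split => //; exists 1.
  have bH' := sub_sigma_bounded_rv (cid_sub k) bH.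
  pose F i j w := H w * ((x i k w - m i k w) * (x j k w - m j k w) -
    (if i == j then m2 i k w - m i k w ^+ 2 else 0)).
  have bF i j : bounded_rv (F i j).
    apply: bounded_rvM => //; apply: bounded_rvB; first exact: bounded_rvM.
    have [_|_] := eqVneq i j; last exact: bounded_rv_cst.
    by apply: bounded_rvB => //; exact: bounded_rvX.
  have iF i j : integrable_rv P (fun w => t i * t j * F i j w).
    by apply: integrable_rvZ; exact: bounded_integrable.
  rewrite (_ : (fun w => _) = (fun w => \sum_(i <- J) \sum_(j <- J) t i * t j * F i j w)).
    rewrite expect_sum => [|i]; last exact: integrable_rv_sum.
    rewrite (le_trans (ler_norm_sum _ _ _))//; apply: ler_sum => i _.
    rewrite expect_sum// (le_trans (ler_norm_sum _ _ _))//; apply: ler_sum => j _.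
    rewrite expectZ; last exact: bounded_integrable.
    rewrite normrM ler_wpM2l// /F; have [->|ij] := eqVneq i j.
      by rewrite diagonal_variance// normr0 !mulr_ge0.
    by under eq_fun do rewrite subr0; exact: offdiagonal_covariance.
  apply/funext => w; rewrite expr2 /D big_distrlr/= /V -sumrB mulr_sumr.
  apply: eq_bigr => i _; rewrite -sumrB mulr_sumr; apply: eq_bigr => j _.
  by rewrite /F; ring.
- apply: measurable_sum => i; apply: measurable_sum => j.
  apply: measurable_funM => //; have [_|_] := eqVneq i j; last exact: measurable_cst.
  apply: measurable_funB; last by apply: measurable_funX; exact: (ba i).1.
  exact: measurable_expect_random_prob.
- move=> w; rewrite /Vinf double_sum_diag//; apply: sumr_ge0 => i _.
  by rewrite mulr_ge0 ?sqr_ge0.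
- move=> w; rewrite /Vinf double_sum_diag//; apply: ler_sum => i _.
  by rewrite ler_wpM2l ?sqr_ge0.
- have aecvg : {ae P, forall w i, m i n w @[n --> \oo] --> a i w /\
      m2 i n w @[n --> \oo] --> expect (alpha i w) (fun y => f y ^+ 2)}.
    apply: ae_forall_countable => i.
    apply: filterS2 (K_cvg i f_continuous bf) (K_cvg i f2_continuous bf2) => w h1 h2.
    by split; [exact: h1|exact: h2].
  apply: filterS aecvg => w h; rewrite /V /Vinf double_sum_diag//.
  rewrite (_ : (fun k => _) = (fun k => \sum_(i <- J) t i ^+ 2 * (m2 i k w - m i k w ^+ 2))).
    apply: cvgr_sum => i; apply: cvgMr; have [h1 h2] := h i; apply: cvgB => //.
    by under eq_fun do rewrite expr2; rewrite expr2; exact: cvgM.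
  by apply/funext => k; rewrite double_sum_diag.
- rewrite (_ : 0 = \sum_(i <- J) \sum_(j <- J) `|t i * t j| * (2 * c * 0)); last first.
    by rewrite big1// => i _; rewrite big1// => j _; rewrite !mulr0.
  apply: cvgr_sum => i; apply: cvgr_sum => j; apply: cvgMr; apply: cvgMr; exact: e_cvg.
Qed.

End bounded_function.

End partially_cid_arrays.

(** * Truncation of square-integrable arrays *)

Section square_integrable.
Context {R : realType} {d : measure_display} {T : measurableType d}.
Variable P : probability T R.

Lemma integrable_sqrD (f g : T -> R) : measurable_fun setT f -> measurable_fun setT g ->
  integrable_rv P (fun x => f x ^+ 2) -> integrable_rv P (fun x => g x ^+ 2) ->
  integrable_rv P (fun x => (f x + g x) ^+ 2).
Proof.
move=> mf mg f2 g2.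
apply: (@integrable_rv_le _ _ _ _ _ (fun x => 2 * f x ^+ 2 + 2 * g x ^+ 2)).
- by apply: measurable_funX; exact: measurable_funD.
- by apply: integrable_rvD; exact: integrable_rvZ.
- move=> x; rewrite ger0_norm ?sqr_ge0//.
  by have := sqrB_le (f x) (- g x); rewrite opprK sqrrN.
Qed.

Lemma integrable_sqrB (f g : T -> R) : measurable_fun setT f -> measurable_fun setT g ->
  integrable_rv P (fun x => f x ^+ 2) -> integrable_rv P (fun x => g x ^+ 2) ->
  integrable_rv P (fun x => (f x - g x) ^+ 2).
Proof.
move=> mf mg f2 g2; apply: integrable_sqrD => //; first exact: measurableT_comp.
by under eq_fun do rewrite sqrrN.
Qed.

Lemma integrableM_sqr (f g : T -> R) : measurable_fun setT f -> measurable_fun setT g ->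
  integrable_rv P (fun x => f x ^+ 2) -> integrable_rv P (fun x => g x ^+ 2) ->
  integrable_rv P (fun x => f x * g x).
Proof.
move=> mf mg f2 g2.
apply: (@integrable_rv_le _ _ _ _ _ (fun x => f x ^+ 2 + g x ^+ 2)).
- exact: measurable_funM.
- exact: integrable_rvD.
- by move=> x; exact: mul_norm_le_sqr.
Qed.

(** Increments are orthogonal and [E[(Z_k - W_k)^2] = E[Z_k^2] - E[W_k^2]]. The bound serves twice:
    for [S_n], where it yields tightness, and for the truncation remainder. *)
Lemma centered_martingale_sqr_le (G : nat -> set (set T)) (Z W : nat -> T -> R) (r : R) n :
  filtration G ->
  (forall k, measurable_fun setT (Z k : g_sigma_algebraType (G k.+1) -> R)) ->
  (forall k, integrable_rv P (fun x => Z k x ^+ 2)) ->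
  (forall k, expect P (fun x => Z k x ^+ 2) <= r) ->
  (forall k, is_cond_exp P (G k) (Z k) (W k)) ->
  let M x := \sum_(k < n) (Z k x - W k x) in
  [/\ measurable_fun setT (M : g_sigma_algebraType (G n) -> R),
      integrable_rv P (fun x => M x ^+ 2) & expect P (fun x => M x ^+ 2) <= n%:R * r].
Proof.
move=> GF mZ Z2 Zr ZW /=; have GS k := filtration_sub GF k.
have mZ' k := sub_sigma_measurable_fun (GS k.+1) (mZ k).
have mW k := is_cond_exp_measurable (GS k) (ZW k).
have mW' k := sub_sigma_measurable_fun (GS k) (mW k).
have W2 k := (is_cond_exp_sqr (GS k) (mZ' k) (Z2 k) (ZW k)).1.
pose M n x := \sum_(k < n) (Z k x - W k x).
suff H m : [/\ measurable_fun setT (M m : g_sigma_algebraType (G m) -> R),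
    integrable_rv P (fun x => M m x ^+ 2) & expect P (fun x => M m x ^+ 2) <= m%:R * r].
  exact: (H n).
elim: m => [|{}n [mM M2 Mr]]; rewrite {1}/M.
  have M0 : M 0%N = fun _ => 0 by apply/funext => x; rewrite /M big_ord0.
  rewrite -/(M 0%N) M0; split; first exact: measurable_cst.
  - by apply: bounded_integrable; exact: bounded_rv_cst.
  - by rewrite expect_cst expr0n /= mul0r.
have mM' := sub_sigma_measurable_fun (GS n) mM.
have ZWm := integrableM_sqr (mZ' n) (mW' n) (Z2 n) (W2 n).
have U2 := integrable_sqrB (mZ' n) (mW' n) (Z2 n) (W2 n).
have mU : measurable_fun setT (fun x => Z n x - W n x) by exact: measurable_funB.
have E : M n.+1 = (fun x => M n x + (Z n x - W n x)).
  by apply/funext => x; rewrite /M big_ord_recr.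
rewrite -/(M n.+1) {}E; split.
- apply: measurable_funD; first by apply: (@filtration_measurable _ _ _ _ GF n n.+1).
  by apply: measurable_funB => //; apply: (@filtration_measurable _ _ _ _ GF n n.+1).
- exact: integrable_sqrD.
- have MU := integrableM_sqr mM' mU M2 U2.
  rewrite (_ : (fun x => _) = (fun x => M n x ^+ 2 + 2 * (M n x * (Z n x - W n x)) +
      (Z n x - W n x) ^+ 2)); last by apply/funext => x; ring.
  have MZ := integrableM_sqr mM' (mZ' n) M2 (Z2 n).
  have MW := integrableM_sqr mM' (mW' n) M2 (W2 n).
  have MU0 : expect P (fun x => M n x * (Z n x - W n x)) = 0.
    under eq_fun do rewrite mulrBr; rewrite expectB//.
    by rewrite (is_cond_exp_expectM_sqr (GS n) (mZ' n) (Z2 n) (ZW n) mM M2) subrr.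
  have U2r : expect P (fun x => (Z n x - W n x) ^+ 2) <= r.
    have WZ : integrable_rv P (fun x => W n x * Z n x).
      by under eq_fun do rewrite mulrC.
    rewrite (_ : (fun x => _) = (fun x => Z n x ^+ 2 - 2 * (W n x * Z n x) + W n x ^+ 2)).
      rewrite expectD//; last by apply: integrable_rvB => //; exact: integrable_rvZ.
      rewrite expectB//; last exact: integrable_rvZ.
      rewrite expectZ//.
      rewrite -(is_cond_exp_expectM_sqr (GS n) (mZ' n) (Z2 n) (ZW n) (mW n) (W2 n)).
      rewrite (_ : expect P (fun x => W n x * W n x) = expect P (fun x => W n x ^+ 2))//.
      have := Zr n; have : 0 <= expect P (fun x => W n x ^+ 2).
        by apply: expect_ge0 => x; exact: sqr_ge0.
      by set p := expect _ _; set q := expect _ _; lra.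
    by apply/funext => x; ring.
  rewrite expectD//; last by apply: integrable_rvD => //; exact: integrable_rvZ.
  rewrite expectD//; last exact: integrable_rvZ.
  by rewrite expectZ// MU0 mulr0 addr0 -natr1 mulrDl mul1r lerD.
Qed.

End square_integrable.

(** * Second moments and truncation error of the array *)

Section square_integrable_cid.
Context {R : realType} {d : measure_display} {T : measurableType d} {I : countType}.
Variables (P : probability T R) (G : nat -> set (set T)) (X : nat -> I -> T -> R).
Hypothesis cid : partially_cid P G X.
Hypothesis X2 : forall n i, integrable_rv P (fun w => X n.+1 i w ^+ 2).

(** Removes the boundedness in [cid_expect], which is required for squares: the values of [h] are
    clipped and the level tends to infinity. *)
Lemma cid_expect_ge0 n j (h : R -> R) : measurable_fun setT h -> (forall x, 0 <= h x) ->
  integrable_rv P (fun w => h (X n.+1 j w)) -> integrable_rv P (fun w => h (X 1 j w)) ->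
  expect P (fun w => h (X n.+1 j w)) = expect P (fun w => h (X 1 j w)).
Proof.
move=> mh h0 hn h1.
pose hN (N : nat) x := clip N%:R (h x).
have N0 (N : nat) : 0 <= N%:R :> R by exact: ler0n.
have cv m : integrable_rv P (fun w => h (X m.+1 j w)) ->
    expect P (fun w => hN N (X m.+1 j w)) @[N --> \oo] --> expect P (fun w => h (X m.+1 j w)).
  move=> hi; apply: (@expect_dominated_cvg _ _ _ _ _ _ (fun w => `|h (X m.+1 j w)| *+ 2)).
  - move=> N; apply: (measurableT_comp (measurable_clip _)).
    by apply: measurableT_comp => //; exact: (cid_measurable cid).
  - by apply: measurableT_comp => //; exact: (cid_measurable cid).
  - under eq_fun do rewrite -mulr_natl.
    by apply: integrable_rvZ; exact: integrable_rv_norm.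
  - move=> N w; rewrite mulr2n /hN; set y := h _.
    rewrite -{1}[clip _ _](subrK y) (le_trans (ler_normD _ _))// lerD// distrC.
    exact: clip_sub_norm_le.
  - apply: aeW => w; apply: cvg_near_cst; near=> N; rewrite /hN clip_id//.
    near: N; exact: nbhs_infty_ger.
have bN N : bounded_rv (hN N).
  split; first exact: (measurableT_comp (measurable_clip _)).
  by exists N%:R => x; exact: clip_norm_le.
have := cv n hn; under eq_fun do rewrite (cid_expect cid n j (bN _)).
by move=> cvn; exact: cvgn_unique cvn (cv 0 h1).
Unshelve. all: by end_near. Qed.

Let rest c n i w := X n.+1 i w - clip c (X n.+1 i w).

Let m_rest c : measurable_fun setT (fun x : R => x - clip c x).
Proof. by apply: measurable_funB => //; exact: measurable_clip. Qed.

Let rest2 c n i : 0 <= c -> integrable_rv P (fun w => rest c n i w ^+ 2).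
Proof.
move=> c0; apply: integrable_rv_le (X2 n i) _.
  by apply: measurable_funX; apply: (measurableT_comp (m_rest c)); exact: (cid_measurable cid).
move=> w; rewrite normrX -(real_normK (num_real (X n.+1 i w))).
by rewrite lerXn2r ?nnegrE//; exact: clip_sub_norm_le.
Qed.

(** The truncation level can thus be chosen from the first row alone, before the number of summands
    is known. *)
Lemma rest_expect c n i : 0 <= c ->
  expect P (fun w => rest c n i w ^+ 2) = expect P (fun w => rest c 0 i w ^+ 2).
Proof.
move=> c0; apply: (@cid_expect_ge0 n i (fun x => (x - clip c x) ^+ 2)).
- by apply: measurable_funX; exact: m_rest.
- by move=> x; exact: sqr_ge0.
- exact: rest2.
- exact: rest2.
Qed.

Lemma rest_le c n i : 0 <= c ->
  expect P (fun w => rest c n i w ^+ 2) <= expect P (fun w => rest c 0 i w ^+ 2).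
Proof. by move=> c0; rewrite rest_expect. Qed.

Lemma rest_cvg i : expect P (fun w => rest N%:R 0 i w ^+ 2) @[N --> \oo] --> (0 : R).
Proof.
rewrite -(expect_cst P 0).
apply: (@expect_dominated_cvg _ _ _ _ _ _ (fun w => X 1 i w ^+ 2)) => //.
- move=> N; apply: measurable_funX; apply: (measurableT_comp (m_rest _)).
  exact: (cid_measurable cid).
- move=> N w; rewrite normrX -(real_normK (num_real (X 1 i w))).
  by rewrite lerXn2r ?nnegrE//; exact: clip_sub_norm_le.
- apply: aeW => w; apply: cvg_near_cst; near=> N; rewrite /rest clip_id ?subrr ?expr0n//.
  near: N; exact: nbhs_infty_ger.
Unshelve. all: by end_near. Qed.

Lemma cid_integrable n i : integrable_rv P (X n.+1 i).
Proof. by have [] := expect_norm_sqr (@ltr01 R) (cid_measurable cid n i) (X2 n i). Qed.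

Lemma SnE n w i : Sn P G X n w i = (Num.sqrt n%:R)^-1 *
  \sum_(k < n) (X k.+1 i w - cond_exp P (G k) (X k.+1 i) w).
Proof. by rewrite /Sn big_add1 /= big_mkord. Qed.

Lemma cond_exp_X n i : is_cond_exp P (G n) (X n.+1 i) (cond_exp P (G n) (X n.+1 i)).
Proof. by apply: cond_expP; [exact: (cid_sub cid)|exact: cid_integrable]. Qed.

Lemma X_sqr_le n i : expect P (fun w => X n.+1 i w ^+ 2) <= expect P (fun w => X 1 i w ^+ 2).
Proof.
rewrite (@cid_expect_ge0 n i (fun x => x ^+ 2))//.
by move=> x; exact: sqr_ge0.
Qed.

Lemma Sn_sqr n i : [/\ measurable_fun setT (fun w => Sn P G X n w i),
  integrable_rv P (fun w => Sn P G X n w i ^+ 2) &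
  expect P (fun w => Sn P G X n w i ^+ 2) <= expect P (fun w => X 1 i w ^+ 2)].
Proof.
have [mM M2 Mr] := centered_martingale_sqr_le n (cid_filtration cid)
  (fun k => @cid_adapted _ _ _ _ _ _ _ cid k i) (fun k => X2 k i)
  (fun k => X_sqr_le k i) (fun k => cond_exp_X k i).
have mM' := sub_sigma_measurable_fun (cid_sub cid n) mM.
split.
- by under eq_fun do rewrite SnE; exact: measurable_funM.
- by under eq_fun do rewrite SnE exprMn; exact: integrable_rvZ.
- under eq_fun do rewrite SnE exprMn; rewrite expectZ// exprVn sqr_sqrtr//.
  have [->|n0] := eqVneq n 0%N; first by rewrite invr0 mul0r expect_ge0// => x; exact: sqr_ge0.
  by rewrite ler_pdivrMl// ltr0n lt0n.
Qed.

Variable K : I -> nat -> T -> probability R R.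
Variable alpha : I -> T -> probability R R.
Hypothesis K_distr : forall i n, reg_cond_distr P (G n) (X n.+1 i) (K i n).
Hypothesis K_weak : forall i, {ae P, forall w, weak_conv (fun n => K i n w) (alpha i w)}.
Hypothesis alpha_random : forall i, random_prob (alpha i).

Let clipN (N : nat) (x : R) := clip N%:R x.

Let clipN_le N x : `|clipN N x| <= N%:R.
Proof. exact: clip_norm_le. Qed.

Let bclip N : bounded_rv (clipN N).
Proof. by split; [exact: measurable_clip|exists N%:R]. Qed.

Let clip_cvg x : clipN N x @[N --> \oo] --> x.
Proof.
apply: cvg_near_cst; near=> N; rewrite /clipN clip_id//.
near: N; exact: nbhs_infty_ger.
Unshelve. all: by end_near. Qed.

Let clip_sqr_le N x : clipN N x ^+ 2 <= x ^+ 2.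
Proof.
rewrite -(real_normK (num_real (clipN N x))) -(real_normK (num_real x)).
rewrite lerXn2r ?nnegrE//.
by rewrite clip_norm_le_norm.
Qed.

Let clip_continuous N : continuous (clipN N).
Proof. exact: continuous_clip. Qed.

Let clip_sqr_continuous N : continuous (fun x => clipN N x ^+ 2).
Proof.
move=> y; under eq_fun do rewrite expr2.
by apply: cvgM; exact: clip_continuous.
Qed.

(** For fixed [N], the mean of [alpha_i(clip_N^2)] is the limit in [n] of the means of
    [K_n(clip_N^2)], each at most [E[X_1^2]]. Fatou under [P] makes the lower limit in [N] finite
    almost surely, and Fatou under [alpha_i] passes from [clip_N^2] to the square. *)
Lemma alpha_sqr_integrable :
  {ae P, forall w i, integrable_rv (alpha i w) (fun x => x ^+ 2)}.
Proof.
apply: ae_forall_countable => i.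
set C := expect P (fun w => X 1 i w ^+ 2).
pose phi N w := expect (alpha i w) (fun x => clipN N x ^+ 2).
have bc2 N : bounded_rv (fun x => clipN N x ^+ 2) by exact: bounded_rvX.
have bphi N : bounded_rv (phi N) by exact: bounded_expect_random_prob.
have phiC N : expect P (phi N) <= C.
  have cv : expect P (fun w => expect (K i n w) (fun x => clipN N x ^+ 2)) @[n --> \oo] -->
      expect P (phi N).
    apply: (@expect_bounded_cvg _ _ _ _ _ _ (N%:R ^+ 2)).
    - move=> n; apply: (sub_sigma_measurable_fun (cid_sub cid n)).
      exact: (K_bounded cid K_distr i n (bc2 N)).1.
    - exact: (bphi N).1.
    - move=> n w; apply: expect_bound => [|x]; first exact: bounded_integrable.
      by rewrite normrX lerXn2r ?nnegrE.
    - exact: (K_cvg K_weak).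
  apply: cvgn_le_cst cv _ => n.
  have bK : bounded_rv ((fun w => expect (K i n w) (fun x => clipN N x ^+ 2)) :
    g_sigma_algebraType (G n) -> R) by exact: (K_bounded cid K_distr).
  have b1 : bounded_rv ((fun _ => 1) : g_sigma_algebraType (G n) -> R).
    exact: bounded_rv_cst.
  have := K_expectM cid K_distr i (bc2 N) b1.
  under eq_fun do rewrite mul1r; move=> ->.
  under eq_fun do rewrite mul1r; apply: le_trans (X_sqr_le n i).
  apply: expect_le => //.
  by apply: bounded_integrable; exact: (bounded_rv_X cid n i (bc2 N)).
pose g w := limn_einf (fun N => (phi N w)%:E).
have mg : measurable_fun setT g.
  apply: measurableT_comp => //; apply: measurable_fun_limn_esup => N.
  by apply: measurableT_comp => //; apply/measurable_EFinP; exact: (bphi N).1.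
have phi0 N w : 0 <= phi N w by apply: expect_ge0 => x; exact: sqr_ge0.
have g0 w : (0 <= g w)%E.
  rewrite /g limn_einf_lim; apply: lime_ge; first exact: is_cvg_einfs.
  apply: nearW => N; apply: le_ereal_inf_tmp => _ [M _ <-].
  by rewrite lee_fin.
have ig : P.-integrable setT g.
  apply/integrableP; split => //; apply: le_lt_trans (ltry C).
  under eq_integral do rewrite gee0_abs//.
  rewrite (le_trans (fatou P measurableT _ _))//.
  - by move=> N; apply/measurable_EFinP; exact: (bphi N).1.
  - by move=> N w _; rewrite lee_fin.
  rewrite limn_einf_lim; apply: lime_le; first exact: is_cvg_einfs.
  apply: nearW => N; apply: (@le_trans _ _ (\int[P]_w (phi N w)%:E)%E).
    by apply: ereal_inf_lbound; exists N => /=.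
  by rewrite expectK ?lee_fin//; exact: bounded_integrable.
have := integrable_ae measurableT ig; apply: filterS => w /(_ Logic.I) gw.
have msq : measurable_fun setT (fun x : R => x ^+ 2) by exact: measurable_funX.
apply/integrableP; split; first exact/measurable_EFinP.
apply: (@le_lt_trans _ _ (g w)); last by rewrite ltey_eq gw.
apply: (@le_trans _ _ (\int[alpha i w]_x limn_einf (fun N => (clipN N x ^+ 2)%:E))%E).
  rewrite le_eqVlt; apply/orP; left; apply/eqP; apply: eq_integral => x _ /=.
  rewrite ger0_norm ?sqr_ge0//; apply/esym.
  have cv : (clipN N x ^+ 2)%:E @[N --> \oo] --> (x ^+ 2)%:E.
    apply/cvg_EFin; first exact: nearW.
    by rewrite /comp /=; under eq_fun do rewrite expr2; rewrite expr2; exact: cvgM.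
  by rewrite is_cvg_limn_einfE; [apply/cvg_lim|apply/cvg_ex; exists (x ^+ 2)%:E].
rewrite (le_trans (fatou (alpha i w) measurableT _ _))//.
- by move=> N; apply/measurable_EFinP; exact: (bc2 N).1.
- by move=> N x _; rewrite lee_fin sqr_ge0.
rewrite (_ : (fun N => _) = (fun N => (phi N w)%:E))//.
by apply/funext => N; rewrite expectK//; exact: bounded_integrable.
Qed.

(** The analogue of [Sn] for the clipped array, centered by means of [K] rather than [cond_exp], as
    in [bounded_cid_stable_clt]. *)
Let trunc N n w (j : I) := (Num.sqrt n%:R)^-1 *
  \sum_(k < n) (clipN N (X k.+1 j w) - expect (K j k w) (clipN N)).

(** The right-hand side does not contain [n], which permits the exchange of the limits in [n] and in
    [N]. The difference [Sn - trunc] is a normalized martingale with second moment at most that of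
    the clipped part of the first row, and the cosine is Lipschitz. *)
Lemma clip_approx (A : set T) (J : seq I) (t : I -> R) (th e : R) N n :
  measurable A -> 0 < e ->
  `|expect P (fun w => \1_A w * cos (th + \sum_(j <- J) t j * Sn P G X n w j)) -
    expect P (fun w => \1_A w * cos (th + \sum_(j <- J) t j * trunc N n w j))| <=
  \sum_(j <- J) 2 * `|t j| * (e + expect P (fun w => rest N%:R 0 j w ^+ 2) / e).
Proof.
move=> mA e0.
have b1 : bounded_rv (\1_A : T -> R) := bounded_rv_indic mA.
have mtrunc j : measurable_fun setT (fun w => trunc N n w j).
  apply: measurable_funM => //; apply: measurable_sum => k; apply: measurable_funB.
    exact: (bounded_rv_X cid k j (bclip N)).1.
  apply: (sub_sigma_measurable_fun (cid_sub cid k)).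
  exact: (K_bounded cid K_distr j k (bclip N)).1.
have mS j : measurable_fun setT (fun w => Sn P G X n w j) by have [] := Sn_sqr n j.
have bcos F : (forall j, measurable_fun setT (F^~ j)) ->
    bounded_rv (fun w => cos (th + \sum_(j <- J) t j * F w j)).
  move=> mF; apply: bounded_rv_cos; apply: measurable_funD => //.
  by apply: measurable_sum => j; apply: measurable_funM.
pose M j w := Sn P G X n w j - trunc N n w j.
have ME j w : M j w = (Num.sqrt n%:R)^-1 * \sum_(k < n) (rest N%:R k j w -
    (cond_exp P (G k) (X k.+1 j) w - expect (K j k w) (clipN N))).
  rewrite /M SnE /trunc -mulrBr -sumrB; congr (_ * _); apply: eq_bigr => k _.
  by rewrite /rest /clipN; ring.
have MP j : integrable_rv P (M j) /\
    expect P (fun w => `|M j w|) <= e + expect P (fun w => rest N%:R 0 j w ^+ 2) / e.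
  have [mM M2 Mr] := centered_martingale_sqr_le n (cid_filtration cid)
    (fun k => measurableT_comp (m_rest N%:R) (@cid_adapted _ _ _ _ _ _ _ cid k j))
    (fun k => @rest2 N%:R k j (ler0n _ _))
    (fun k => @rest_le N%:R k j (ler0n _ _))
    (fun k => is_cond_expB (cid_sub cid k) (cid_integrable k j)
       (bounded_integrable P (bounded_rv_X cid k j (bclip N)))
       (cond_exp_X k j) (K_cond_exp cid K_distr j k (bclip N))).
  have mM' := sub_sigma_measurable_fun (cid_sub cid n) mM.
  have EM : M j = (fun w => (Num.sqrt n%:R)^-1 * \sum_(k < n) (rest N%:R k j w -
    (cond_exp P (G k) (X k.+1 j) w - expect (K j k w) (clipN N)))).
    by apply/funext => w; exact: ME.
  have mMj : measurable_fun setT (M j) by rewrite EM; exact: measurable_funM.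
  have iM : integrable_rv P (fun w => M j w ^+ 2).
    by rewrite EM; under eq_fun do rewrite exprMn; exact: integrable_rvZ.
  have [iMj] := expect_norm_sqr e0 mMj iM.
  move=> h; split => //; apply: le_trans h _; rewrite lerD2l ler_wpM2r ?invr_ge0 ?(ltW e0)//.
  rewrite EM; under eq_fun do rewrite exprMn.
  rewrite expectZ// exprVn sqr_sqrtr//.
  have [->|n0] := eqVneq n 0%N; first by rewrite invr0 mul0r expect_ge0// => x; exact: sqr_ge0.
  by rewrite ler_pdivrMl// ltr0n lt0n.
rewrite -expectB; [|by apply: bounded_integrable; apply: bounded_rvM => //; exact: bcos..].
apply: (@le_trans _ _ (expect P (fun w => \sum_(j <- J) 2 * `|t j| * `|M j w|))).
  apply: expect_norm_le.
  - by apply: bounded_integrable; apply: bounded_rvB; apply: bounded_rvM => //; exact: bcos.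
  - apply: integrable_rv_sum => j; apply: integrable_rvZ; apply: integrable_rv_norm.
    by have [] := MP j.
  move=> w; rewrite -mulrBr normrM -[leRHS]mul1r ler_pM//.
    by rewrite indicE; case: (_ \in _); rewrite ?normr1 ?normr0.
  rewrite (le_trans (cos_lipschitz _ _))// opprD addrACA subrr add0r -sumrB.
  under [leRHS]eq_bigr do rewrite -mulrA.
  rewrite -mulr_sumr ler_wpM2l// (le_trans (ler_norm_sum _ _ _))//.
  by apply: ler_sum => j _; rewrite -mulrBr normrM.
rewrite expect_sum => [|j]; last first.
  by apply: integrable_rvZ; apply: integrable_rv_norm; have [] := MP j.
apply: ler_sum => j _; have [iMj Mj] := MP j.
by rewrite expectZ ?ler_wpM2l ?mulr_ge0//; exact: integrable_rv_norm.
Qed.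

Lemma variance_ofE (mu : probability R R) :
  variance_of mu = expect mu (fun x => x ^+ 2) - expect mu id ^+ 2.
Proof. by []. Qed.

Lemma clip_variance_cvg (mu : probability R R) : integrable_rv mu (fun x => x ^+ 2) ->
  expect mu (fun x => clipN N x ^+ 2) - expect mu (clipN N) ^+ 2 @[N --> \oo] -->
  variance_of mu.
Proof.
move=> mu2; have [mu1 _] := expect_norm_sqr (@ltr01 R) (@measurable_id _ _ setT) mu2.
rewrite variance_ofE; apply: cvgB.
  apply: (@expect_dominated_cvg _ _ _ mu (fun N x => clipN N x ^+ 2)
    (fun x => x ^+ 2) (fun x => x ^+ 2)) => //.
  - by move=> N; apply: measurable_funX; exact: (bclip N).1.
  - by move=> N x; rewrite ger0_norm ?sqr_ge0.
  - apply: aeW => x; under eq_fun do rewrite expr2; rewrite expr2; exact: cvgM.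
have cv : expect mu (clipN N) @[N --> \oo] --> expect mu id.
  apply: (@expect_dominated_cvg _ _ _ mu clipN id (fun x => `|x|)) => //.
  - by move=> N; exact: (bclip N).1.
  - exact: integrable_rv_norm.
  - by move=> N x; exact: clip_norm_le_norm.
  - exact: aeW.
by under eq_fun do rewrite expr2; rewrite expr2; exact: cvgM.
Qed.

(** [L] is prescribed almost surely only, since it will be an integral against a kernel that is
    Gaussian almost surely. *)
Theorem cid_stable_cos (A : set T) (J : seq I) (t : I -> R) (th : R) (L : T -> R) :
  uniq J -> measurable A -> measurable_fun setT L ->
  {ae P, forall w, L w = cos th * expR (- ((\sum_(i <- J) \sum_(j <- J) t i * t j *
     (if i == j then variance_of (alpha i w) else 0)) / 2))} ->
  expect P (fun w => \1_A w * cos (th + \sum_(j <- J) t j * Sn P G X n w j))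
    @[n --> \oo] --> expect P (fun w => \1_A w * L w).
Proof.
move=> uJ mA mL LE.
have b1 : bounded_rv (\1_A : T -> R) := bounded_rv_indic mA.
pose V N w := \sum_(i <- J) \sum_(j <- J) t i * t j * (if i == j then
  expect (alpha i w) (fun x => clipN N x ^+ 2) - expect (alpha i w) (clipN N) ^+ 2 else 0).
pose l N := expect P (fun w => \1_A w * (cos th * expR (- (V N w / 2)))).
have trunc_cvg N : expect P (fun w =>
    \1_A w * cos (th + \sum_(j <- J) t j * trunc N n w j)) @[n --> \oo] --> l N.
  have := bounded_cid_stable_clt cid K_distr K_weak alpha_random
    (@clip_continuous N) (@clipN_le N) (t := t) (th := th) uJ mA.
  rewrite [X in X @ \oo --> _ -> _](_ : _ = (fun n => expect P (fun w =>
    \1_A w * cos (th + \sum_(j <- J) t j * trunc N n w j))))//.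
  apply/funext => n; congr expect; apply/funext => w; congr (_ * cos (_ + _)).
  rewrite exchange_big /= mulr_sumr; apply: eq_bigr => j _.
  by rewrite /trunc -mulr_sumr mulrCA.
have V0 N w : 0 <= V N w.
  rewrite /V (@double_sum_diag _ _ _ _ (fun i => expect (alpha i w) (fun x => clipN N x ^+ 2) -
    expect (alpha i w) (clipN N) ^+ 2))//.
  apply: sumr_ge0 => i _; rewrite mulr_ge0 ?sqr_ge0//.
  by apply: expect_variance_ge0; apply: bounded_integrable => //; exact: bounded_rvX.
have mV N : measurable_fun setT (V N).
  apply: measurable_sum => i; apply: measurable_sum => j; apply: measurable_funM => //.
  have [_|_] := eqVneq i j; last exact: measurable_cst.
  apply: measurable_funB; last apply: measurable_funX.
    by apply: measurable_expect_random_prob => //; exact: bounded_rvX.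
  exact: measurable_expect_random_prob.
have l_cvg : l N @[N --> \oo] --> expect P (fun w => \1_A w * L w).
  apply: (@expect_bounded_cvg _ _ _ _ _ _ 1).
  - move=> N; apply: measurable_funM; first exact: b1.1.
    apply: measurable_funM => //; apply: measurableT_comp => //.
    by apply: measurableT_comp => //; exact: measurable_funM.
  - by apply: measurable_funM => //; exact: b1.1.
  - move=> N w; rewrite normrM -[leRHS]mulr1 ler_pM//.
      by rewrite indicE; case: (_ \in _); rewrite ?normr1 ?normr0.
    rewrite normrM -[leRHS]mulr1 ler_pM ?cos_norm_le1//.
    by rewrite ger0_norm ?expR_ge0// expR_le1 oppr_le0 divr_ge0.
  - apply: filterS2 LE alpha_sqr_integrable => w -> a2.
    apply: cvgMr; apply: cvgMr; apply: continuous_cvg; first exact: continuous_expR.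
    apply: cvgN; apply: cvgMl; apply: cvgr_sum => i; apply: cvgr_sum => j; apply: cvgMr.
    have [_|_] := eqVneq i j; last exact: cvg_cst.
    by apply: clip_variance_cvg; exact: a2.
apply/cvgrPdist_le => e e0.
have e4 : 0 < e / 4 by rewrite divr_gt0.
pose S := \sum_(j <- J) 2 * `|t j|.
have S0 : 0 <= S by apply: sumr_ge0 => j _; rewrite mulr_ge0.
(* The threshold of [clip_approx] is fixed before the level [N]: its contribution [S e'] stays below
   [e / 4], and [1 + S] avoids a division by 0. *)
pose e' := e / 4 / (1 + S).
have S1 : 0 < 1 + S by rewrite ltr_pwDl.
have e'0 : 0 < e' by rewrite divr_gt0.
pose r N := \sum_(j <- J) 2 * `|t j| * (e' + expect P (fun w => rest N%:R 0 j w ^+ 2) / e').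
have r_cvg : r N @[N --> \oo] --> \sum_(j <- J) 2 * `|t j| * (e' + 0 / e').
  apply: cvgr_sum => j; apply: cvgMr; apply: cvgD; first exact: cvg_cst.
  by apply: cvgMl; exact: rest_cvg.
have r_le : \sum_(j <- J) 2 * `|t j| * (e' + 0 / e') <= e / 4.
  under eq_bigr do rewrite mul0r addr0.
  rewrite -mulr_suml -/S /e' mulrCA ger_pMr// ler_pdivrMr// mul1r lerDr//.
have [N [rN lN]] : exists N, r N <= e / 4 + e / 4 /\
    `|expect P (fun w => \1_A w * L w) - l N| <= e / 4.
  have /cvgrPdist_le/(_ _ e4) h1 := r_cvg; have /cvgrPdist_le/(_ _ e4) h2 := l_cvg.
  have [N _ NP] := filterI h1 h2; exists N; have [h3 h4] := NP N (leqnn N); split => //.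
  rewrite -(subrK (\sum_(j <- J) 2 * `|t j| * (e' + 0 / e')) (r N)) addrC lerD//.
  by apply: le_trans h3; rewrite distrC ler_norm.
have /cvgrPdist_le/(_ _ e4) := trunc_cvg N; apply: filterS => n h1.
have h2 := le_trans (clip_approx J t th N n mA e'0) rN.
move: h1 h2 lN; set a1 := l N; set a2 := expect _ _; set a3 := expect _ _; set a4 := expect _ _.
rewrite !ler_distl => /andP[? ?] /andP[? ?] /andP[? ?]; apply/andP; split; lra.
Qed.

End square_integrable_cid.

(** * The characteristic function of the normal law *)

Section gaussian_characteristic_function.
Context {R : realType}.
Variable s : R.
Hypothesis s0 : 0 < s.

Notation mu := (@lebesgue_measure R).
Let p := normal_pdf 0 s.

Let sN0 : s != 0. Proof. by rewrite gt_eqF. Qed.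

Let p_ge0 x : 0 <= p x. Proof. exact: normal_pdf_ge0. Qed.

Let mp : measurable_fun setT p. Proof. exact: measurable_normal_pdf. Qed.

Let ip : mu.-integrable setT (EFin \o p). Proof. exact: integrable_normal_pdf. Qed.

Let pE x : p x = normal_peak s * expR (- (x ^+ 2 / (s ^+ 2 * 2))).
Proof. by rewrite /p normal_pdfE// /normal_fun subr0 mulNr -[in LHS]mulr_natr. Qed.

Let lebesgue_integrable_le (f g : R -> R) : measurable_fun setT f ->
  mu.-integrable setT (EFin \o g) -> (forall x, `|f x| <= g x) ->
  mu.-integrable setT (EFin \o f).
Proof.
move=> mf ig fg; apply: le_integrable ig => //; first exact/measurable_EFinP.
by move=> x _ /=; rewrite lee_fin (le_trans (fg x))// ler_norm.
Qed.

Let lebesgue_integrableZ (c : R) (f : R -> R) : mu.-integrable setT (EFin \o f) ->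
  mu.-integrable setT (EFin \o (fun x => c * f x)).
Proof. by move=> fi; apply: (integrableZl _ c fi). Qed.

Let integrable_boundedM (f : R -> R) : bounded_rv f ->
  mu.-integrable setT (EFin \o (fun x => f x * p x)).
Proof.
move=> [mf [M fM]]; apply: (@lebesgue_integrable_le _ (fun x => M * p x)).
- exact: measurable_funM.
- exact: lebesgue_integrableZ.
- by move=> x; rewrite normrM (ger0_norm (p_ge0 x)) ler_wpM2r.
Qed.

Lemma expect_normal_prob (f : R -> R) : bounded_rv f ->
  expect (normal_prob 0 s) f = \int[mu]_x (f x * p x).
Proof.
apply: (bounded_rv_ind (Q := fun f =>
  expect (normal_prob 0 s) f = \int[mu]_x (f x * p x))).
- move=> B mB; rewrite expect_indic// /normal_prob /Rintegral; congr fine.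
  rewrite [LHS]integral_mkcond; apply: eq_integral => x _; rewrite /patch indicE.
  by case: (x \in B); rewrite ?mul1r ?mul0r.
- move=> c g h bg bh gE hE.
  rewrite expectD ?expectZ ?gE ?hE; try exact: bounded_integrable; last first.
    by apply: integrable_rvZ; exact: bounded_integrable.
  under [in RHS]eq_Rintegral do rewrite mulrDl -mulrA.
  rewrite RintegralD// ?RintegralZl//; try exact: integrable_boundedM.
  by apply: lebesgue_integrableZ; exact: integrable_boundedM.
- move=> h g M bh bg hM hg hE.
  have cv1 : expect (normal_prob 0 s) (h n) @[n --> \oo] --> expect (normal_prob 0 s) g.
    apply: (@expect_bounded_cvg _ _ _ _ _ _ M) => //.
    + by move=> n; exact: (bh n).1.
    + exact: bg.1.
    + exact: aeW.
  apply: cvgn_unique cv1 _; rewrite (_ : (fun n => _) = (fun n => \int[mu]_x (h n x * p x))).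
    have [_ _ cv] : [/\ mu.-integrable setT (EFin \o (fun x => g x * p x)%R),
      [sequence \int[mu]_x `|(h n x * p x)%:E - (g x * p x)%:E|]_n @ \oo --> 0 &
      [sequence \int[mu]_x (h n x * p x)%:E]_n @ \oo --> \int[mu]_x (g x * p x)%:E]%E.
      apply: (@dominated_convergence _ _ _ mu setT measurableT
        (fun n => EFin \o (fun x => h n x * p x)) (EFin \o (fun x => g x * p x)%R)
        (EFin \o (fun x => M * p x))).
      + by move=> n; apply/measurable_EFinP; apply: measurable_funM => //; exact: (bh n).1.
      + by apply/measurable_EFinP; apply: measurable_funM => //; exact: bg.1.
      + apply: aeW => x _; apply/cvg_EFin; first exact: nearW.
        by apply: cvgMl; exact: hg.
      + exact: lebesgue_integrableZ.
      + by apply: aeW => x n _ /=; rewrite lee_fin normrM (ger0_norm (p_ge0 x)) ler_wpM2r.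
    apply: fine_cvg; rewrite fineK//.
    by apply: integrable_fin_num => //; exact: integrable_boundedM.
  by apply/funext => n; exact: hE.
Qed.

(** Half of the Gaussian exponent absorbs the factor [|x|]: with [y = x^2 / (4 s^2)],
    [|x| <= s (1 + y) <= s exp(y)]. What remains is a multiple of the normal density of variance
    [2 s^2], whence [s']. *)
Let integrable_xp : mu.-integrable setT (EFin \o (fun x => `|x| * p x)).
Proof.
pose s' := Num.sqrt 2 * s.
have s'0 : 0 < s' by rewrite mulr_gt0// sqrtr_gt0.
have s'2 : s' ^+ 2 = 2 * s ^+ 2 by rewrite exprMn sqr_sqrtr.
apply: (@lebesgue_integrable_le _ (fun x =>
  (s * normal_peak s / normal_peak s') * normal_pdf 0 s' x)).
- by apply: measurable_funM => //; exact: measurableT_comp.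
- by apply: lebesgue_integrableZ; exact: integrable_normal_pdf.
move=> x; rewrite normrM normr_id (ger0_norm (p_ge0 x)) pE normal_pdfE ?gt_eqF//.
rewrite [leRHS]mulrA divfK; last by rewrite gt_eqF// normal_peak_gt0// gt_eqF.
rewrite /normal_fun subr0 mulrCA (mulrC s) -[leRHS]mulrA ler_wpM2l ?normal_peak_ge0//.
pose y := x ^+ 2 / (s ^+ 2 * 4).
have -> : - (x ^+ 2 / (s ^+ 2 * 2)) = - y - y by rewrite /y; field.
have -> : - x ^+ 2 / (s' ^+ 2 *+ 2) = - y by rewrite s'2 -mulr_natr /y; field.
rewrite expRD mulrA ler_wpM2r ?expR_ge0// expRN ler_pdivrMr ?expR_gt0//.
apply: (@le_trans _ _ (s * (1 + y))); last by rewrite ler_pM2l// expR_ge1Dx.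
rewrite /y -(real_normK (num_real x)); set a := `|x|.
rewrite -subr_ge0 (_ : _ - _ = (s - a / 2) ^+ 2 / s); last by field.
by rewrite divr_ge0 ?sqr_ge0// ltW.
Qed.

Variable th : R.
Let F u := \int[mu]_x (cos (u * x + th) * p x).
Let F1 u := \int[mu]_x (sin (u * x + th) * (x * p x)).

Let mlin u : measurable_fun setT (fun x : R => u * x + th).
Proof. by apply: measurable_funD => //; exact: measurable_funM. Qed.

Let bcosl u : bounded_rv (fun x : R => cos (u * x + th)).
Proof. exact: bounded_rv_cos. Qed.

Let isin u : mu.-integrable setT (EFin \o (fun x => sin (u * x + th) * (x * p x))).
Proof.
apply: lebesgue_integrable_le integrable_xp _.
  apply: measurable_funM; first exact: (bounded_rv_sin (mlin u)).1.
  exact: measurable_funM.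
move=> x; rewrite 2!normrM (ger0_norm (p_ge0 x)) -[leRHS]mul1r.
by rewrite ler_wpM2r ?mulr_ge0// sin_norm_le1.
Qed.

Let dp (x : R) : is_derive x (1 : R) p (- (x / s ^+ 2) * p x).
Proof.
rewrite (_ : p = fun x => normal_peak s * expR (- (x ^+ 2 / (s ^+ 2 * 2)))); last first.
  by apply/funext => y; exact: pE.
apply: is_derive_eq; rewrite /GRing.scale /=; by field.
Qed.

Let h u x := sin (u * x + th) * p x.
Let h' u x := u * (cos (u * x + th) * p x) - s ^- 2 * (sin (u * x + th) * (x * p x)).

Let dh (u x : R) : is_derive x (1 : R) (h u) (h' u x).
Proof.
have := dp x => ?; apply: is_derive_eq; rewrite /GRing.scale /= /h'; by field.
Qed.

Let ih' u : mu.-integrable setT (EFin \o h' u).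
Proof.
apply: (@integrableB _ _ _ mu setT measurableT (EFin \o (fun x => u * (cos (u * x + th) * p x)))
  (EFin \o (fun x => s ^- 2 * (sin (u * x + th) * (x * p x))))).
  by apply: lebesgue_integrableZ; exact: (integrable_boundedM (bcosl u)).
exact: lebesgue_integrableZ.
Qed.

Let ch' u : continuous (h' u).
Proof.
have cx : continuous (fun x : R => x) by move=> x; exact: cvg_id.
have cl : continuous (fun x : R => u * x + th).
  by move=> x; apply: cvgD; [apply: cvgMr; exact: cvg_id|exact: cvg_cst].
have cp : continuous p by exact: continuous_normal_pdf.
move=> x; apply: cvgB; apply: cvgMr.
  apply: cvgM; last exact: cp.
  exact: (continuous_comp (cl x) (@continuous_cos R _)).
apply: cvgM; first exact: (continuous_comp (cl x) (@continuous_sin R _)).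
by apply: cvgM; [exact: cx|exact: cp].
Qed.

(** A crude rate from [exp(- y) <= 1 / y] suffices: it only serves to make boundary terms vanish. *)
Let p_decay x : 1 <= `|x| -> p x <= normal_peak s * (2 * s ^+ 2) / `|x|.
Proof.
move=> x1; have x0 : 0 < `|x| by exact: lt_le_trans x1.
rewrite pE -mulrA ler_wpM2l ?normal_peak_ge0// expRN -(real_normK (num_real x)).
set a := `|x| in x0 x1 *; pose y := a ^+ 2 / (s ^+ 2 * 2).
have y0 : 0 < y by rewrite divr_gt0 ?mulr_gt0 ?exprn_gt0.
have ye : y <= expR y by rewrite (le_trans _ (expR_ge1Dx _))// lerDr.
apply: (@le_trans _ _ y^-1); first by rewrite lef_pV2// posrE// expR_gt0.
rewrite /y invf_div (mulrC (s ^+ 2)) ler_wpM2l ?mulr_ge0 ?sqr_ge0 ?(ltW s0)//.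
by rewrite lef_pV2 ?posrE ?exprn_gt0// expr2 ler_peMl// ltW.
Qed.

Let h_decay u x : 1 <= `|x| -> `|h u x| <= normal_peak s * (2 * s ^+ 2) / `|x|.
Proof.
move=> x1; apply: le_trans (p_decay x1); rewrite normrM (ger0_norm (p_ge0 x)).
by rewrite ler_piMl// sin_norm_le1.
Qed.

(** The fundamental theorem of calculus on growing intervals: boundary terms vanish by [h_decay],
    and the integrals converge by dominated convergence. *)
Let int_h'_0 u : \int[mu]_x (h' u x) = 0.
Proof.
pose I n := `[(- n.+1%:R : R), n.+1%:R]%classic.
have mI n : measurable (I n) by exact: measurable_itv.
have E n : \int[mu]_(x in I n) (h' u x) = h u n.+1%:R - h u (- n.+1%:R).
  rewrite /Rintegral (@continuous_FTC2 _ (h' u) (h u)) //.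
  - by rewrite gtrN// ltr0n.
  - by apply: continuous_subspaceT; exact: ch'.
  - split.
    + by move=> x _; exact: (@ex_derive _ _ _ _ _ _ _ (dh u x)).
    + apply: cvg_at_right_filter; apply: differentiable_continuous.
      exact/derivable1_diffP/(@ex_derive _ _ _ _ _ _ _ (dh u _)).
    + apply: cvg_at_left_filter; apply: differentiable_continuous.
      exact/derivable1_diffP/(@ex_derive _ _ _ _ _ _ _ (dh u _)).
  - by move=> x _; rewrite derive1E; exact: (@derive_val _ _ _ _ _ _ _ (dh u x)).
have cv0 : \int[mu]_(x in I n) (h' u x) @[n --> \oo] --> (0 : R).
  under eq_fun do rewrite E; set C := normal_peak s * (2 * s ^+ 2).
  have C0 : 0 <= C by rewrite mulr_ge0 ?normal_peak_ge0// mulr_ge0// sqr_ge0.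
  apply/cvgrPdist_le => e e0; near=> n.
  have n1 : 0 < n.+1%:R :> R by rewrite ltr0n.
  rewrite sub0r normrN (le_trans (ler_normB _ _))//.
  apply: (@le_trans _ _ (C / n.+1%:R + C / n.+1%:R)).
    have nn : `|n.+1%:R| = n.+1%:R :> R by rewrite ger0_norm ?ltW.
    by rewrite lerD//; [have := @h_decay u n.+1%:R|have := @h_decay u (- n.+1%:R)];
      rewrite ?normrN nn ler1n => /(_ isT).
  rewrite -mulrDl ler_pdivrMr// mulrC -ler_pdivrMr//.
  apply: (@le_trans _ _ n%:R); last by rewrite ler_nat.
  by near: n; exact: nbhs_infty_ger.
have cv1 : \int[mu]_(x in I n) (h' u x) @[n --> \oo] --> \int[mu]_x (h' u x).
  rewrite /Rintegral; apply: fine_cvg; rewrite fineK; last first.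
    by apply: (integrable_fin_num (mu := mu)) => //; exact: ih'.
  under eq_fun do rewrite integral_mkcond.
  have [_ _] : [/\ mu.-integrable setT (EFin \o h' u),
      [sequence \int[mu]_x `|((EFin \o h' u) \_ (I n)) x - (h' u x)%:E|]_n @ \oo --> 0 &
      [sequence \int[mu]_x ((EFin \o h' u) \_ (I n)) x]_n @ \oo --> \int[mu]_x (h' u x)%:E]%E.
    apply: (@dominated_convergence _ _ _ mu setT measurableT
      (fun n => (EFin \o h' u) \_ (I n)) (EFin \o h' u) (fun x => `|(h' u x)%:E|%E)).
    - move=> n; apply/(measurable_restrictT _ (mI n)); apply: measurable_funTS.
      exact: measurable_int (ih' u).
    - exact: measurable_int (ih' u).
    - apply: aeW => x _; apply: cvg_near_cst; near=> n; rewrite patchE mem_set// /I /=.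
      rewrite in_itv /= -ler_norml (@le_trans _ _ n%:R) ?ler_nat//.
      by near: n; exact: nbhs_infty_ger.
    - exact: integrable_abse (ih' u).
    - apply: aeW => x n _; rewrite patchE; case: (x \in I n) => //.
      by rewrite abse0.
  exact.
exact: cvgn_unique cv1 cv0.
Unshelve. all: by end_near. Qed.

(** Integration by parts: the two terms of [h'] have opposite integrals. It turns the derivative of
    [F] into a multiple of [F]. *)
Lemma stein u : F1 u = s ^+ 2 * u * F u.
Proof.
have := int_h'_0 u; rewrite /h' RintegralB//; last 2 first.
- by apply: lebesgue_integrableZ; exact: (integrable_boundedM (bcosl u)).
- exact: lebesgue_integrableZ.
rewrite !RintegralZl//; last exact: (integrable_boundedM (bcosl u)).
rewrite -/(F u) -/(F1 u) => /eqP; rewrite subr_eq0 => /eqP E.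
by rewrite -mulrA E mulrA divff ?mul1r// expf_neq0.
Qed.

Let dF (u : R) : is_derive u (1 : R) F (- (s ^+ 2 * u * F u)).
Proof.
pose f (v x : R) := cos (v * x + th) * p x.
have df (v x : R) : is_derive v (1 : R) (f ^~ x) (- (sin (v * x + th) * (x * p x))).
  by apply: is_derive_eq; rewrite /GRing.scale /=; ring.
have d1 v x : partial1of2 f v x = - (sin (v * x + th) * (x * p x)).
  by rewrite partial1of2E; exact: (@derive_val _ _ _ _ _ _ _ (df v x)).
have ua : `](u - 1), (u + 1)[%classic u.
  by rewrite /= in_itv /= ltrBlDr ltrDl ltr01.
have intf v : `](u - 1), (u + 1)[%classic v -> mu.-integrable setT (EFin \o f v).
  by move=> _; apply: integrable_boundedM; exact: bcosl.
have derf v x : `](u - 1), (u + 1)[%classic v -> [set: R] x -> derivable (f ^~ x) v 1.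
  by move=> _ _; exact: (@ex_derive _ _ _ _ _ _ _ (df v x)).
have ub v x : `](u - 1), (u + 1)[%classic v -> [set: R] x ->
    `|partial1of2 f v x| <= `|x| * p x.
  move=> _ _; rewrite d1 normrN 2!normrM (ger0_norm (p_ge0 x)) -[leRHS]mul1r.
  by rewrite ler_wpM2r ?mulr_ge0// sin_norm_le1.
have G0 (x : R) : 0 <= `|x| * p x by rewrite mulr_ge0.
apply: DeriveDef.
  exact: (derivable_under_integral measurableT ua intf derf G0 integrable_xp ub).
rewrite -derive1E (differentiation_under_integral measurableT ua intf derf G0 integrable_xp ub).
under eq_Rintegral do rewrite d1 -mulN1r.
by rewrite RintegralZl// mulN1r -/(F1 u) stein.
Qed.

(** [F] solves [F' = - s^2 u F] with [F 0 = cos th], so its product with the integrating factor is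
    constant; the values at 0 and 1 are compared. *)
Lemma normal_pdf_cos : \int[mu]_x (cos (x + th) * p x) = cos th * expR (- (s ^+ 2 / 2)).
Proof.
pose H u := F u * expR (s ^+ 2 * u ^+ 2 / 2).
have dH (u : R) : is_derive u (1 : R) H 0.
  have := dF u => ?; apply: is_derive_eq; rewrite /GRing.scale /=; by field.
have := is_derive_0_is_cst 1 0 dH; rewrite /H expr1n expr0n /= mulr1 mulr0 mul0r expR0 mulr1.
have -> : F 0 = cos th.
  rewrite /F; under eq_Rintegral do rewrite mul0r add0r.
  by rewrite RintegralZl// /Rintegral integral_normal_pdf /= mulr1.
move=> <-; rewrite -mulrA -expRD subrr expR0 mulr1.
by rewrite /F; under [in RHS]eq_Rintegral do rewrite mul1r.
Qed.

End gaussian_characteristic_function.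

(** * Trigonometric approximation on countable products *)

Section bernstein_weights.
Context {R : realType}.
Implicit Types y c : R.

(** The binomial weight [C(N, k) y^k (1 - y)^(N - k)], given by conditioning on one trial so that
    sums, moments and closure properties go by induction on [N]. *)
Fixpoint bernstein y N k : R :=
  if N is N'.+1 then
    (if k is k'.+1 then y * bernstein y N' k' else 0) + (1 - y) * bernstein y N' k
  else (k == 0%N)%:R.

Lemma bernstein_gt y N k : (N < k)%N -> bernstein y N k = 0.
Proof.
elim: N k => [|N ih] [|k]//= Nk; rewrite !ih ?mulr0 ?addr0//.
exact: ltnW.
Qed.

Lemma bernstein_ge0 y N k : 0 <= y <= 1 -> 0 <= bernstein y N k.
Proof.
move=> /andP[y0 y1]; elim: N k => [|N ih] [|k]//=.
  by rewrite add0r mulr_ge0// subr_ge0.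
by rewrite addr_ge0// mulr_ge0// subr_ge0.
Qed.

Lemma bernstein_sumS y N (h : nat -> R) :
  \sum_(k < N.+2) bernstein y N.+1 k * h k =
  y * \sum_(k < N.+1) bernstein y N k * h k.+1 +
  (1 - y) * \sum_(k < N.+1) bernstein y N k * h k.
Proof.
under eq_bigr do rewrite /= mulrDl -mulrA; rewrite big_split /= -mulr_sumr.
have -> : \sum_(k < N.+2) bernstein y N k * h k = \sum_(k < N.+1) bernstein y N k * h k.
  by rewrite big_ord_recr /= bernstein_gt// mul0r addr0.
rewrite big_ord_recl mul0r add0r; congr (_ + _).
by rewrite mulr_sumr; apply: eq_bigr => k _; rewrite mulrA.
Qed.

Lemma bernstein_sum1 y N : \sum_(k < N.+1) bernstein y N k = 1.
Proof.
under eq_bigr do rewrite -[bernstein _ _ _]mulr1.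
elim: N => [|N ih]; first by rewrite big_ord_recl big_ord0 /= mulr1 addr0.
by rewrite (bernstein_sumS y N (fun _ => 1)) ih !mulr1 addrC subrK.
Qed.

(** The center [c] is arbitrary because a success in the conditioned trial moves it to [c - 1]. *)
Lemma bernstein_variance y N c :
  \sum_(k < N.+1) bernstein y N k * (k%:R - c) ^+ 2 =
  N%:R * (y * (1 - y)) + (N%:R * y - c) ^+ 2.
Proof.
elim: N c => [|N ih] c.
  by rewrite big_ord_recl big_ord0 /= mul1r addr0 !mul0r !sub0r add0r.
rewrite (bernstein_sumS y N (fun k => (k%:R - c) ^+ 2)) ih.
have -> : \sum_(k < N.+1) bernstein y N k * (k.+1%:R - c) ^+ 2 =
    \sum_(k < N.+1) bernstein y N k * (k%:R - (c - 1)) ^+ 2.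
  by apply: eq_bigr => k _; rewrite -natr1 opprB addrA addrAC.
by rewrite ih -natr1; ring.
Qed.

End bernstein_weights.

Section product_weights.
Context {R : realType} (m N : nat).
Variable w : 'I_m -> 'I_N -> R.
Hypothesis w_sum1 : forall a, \sum_(k < N) w a k = 1.

Lemma product_weights_sum1 : \sum_(f : {ffun 'I_m -> 'I_N}) \prod_a w a (f a) = 1.
Proof. by rewrite -bigA_distr_bigA big1. Qed.

(** Independence of coordinates: [h] is attached to the factor of index [a0], the product of sums is
    expanded, and the other factors sum to 1. *)
Lemma product_weights_marginal a0 (h : 'I_N -> R) :
  \sum_(f : {ffun 'I_m -> 'I_N}) (\prod_a w a (f a)) * h (f a0) =
  \sum_(k < N) w a0 k * h k.
Proof.
pose v a k := w a k * (if a == a0 then h k else 1).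
transitivity (\prod_a \sum_(k < N) v a k).
  rewrite bigA_distr_bigA; apply: eq_bigr => f _.
  by rewrite big_split /= -big_mkcond /= big_pred1_eq.
rewrite (bigD1 a0)//= [X in _ * X]big1 ?mulr1 => [|a /negbTE aa].
  by apply: eq_bigr => k _; rewrite /v eqxx.
by under eq_bigr do rewrite /v aa mulr1.
Qed.

End product_weights.

Section trigonometric_polynomials.
Context {R : realType} {I : countType}.
Variable J : seq I.
Implicit Types f g : (I -> R) -> R.

(** A triple holds amplitude, phase and frequencies. Free phases include the sines and close the
    class under products. *)
Definition trig_poly f := exists s : seq (R * R * (I -> R)), forall x,
  f x = \sum_(c <- s) c.1.1 * cos (c.1.2 + \sum_(j <- J) c.2 j * x j).

Lemma trig_poly_cst a : trig_poly (fun _ => a).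
Proof.
exists [:: (a, 0, fun _ => 0)] => x; rewrite big_seq1 /= big1 ?addr0 ?cos0 ?mulr1//.
by move=> j _; rewrite mul0r.
Qed.

Lemma trig_polyD f g : trig_poly f -> trig_poly g -> trig_poly (fun x => f x + g x).
Proof. by move=> [s fs] [s' gs']; exists (s ++ s') => x; rewrite big_cat fs gs'. Qed.

Lemma trig_polyM f g : trig_poly f -> trig_poly g -> trig_poly (fun x => f x * g x).
Proof.
move=> [s fs] [s' gs'].
(* [cos u cos v] is the half sum of [cos (u + v)] and [cos (u - v)]; the sign is [e]. *)
pose F e (c c' : R * R * (I -> R)) : R * R * (I -> R) :=
  (c.1.1 * c'.1.1 / 2, c.1.2 + e * c'.1.2, fun j => c.2 j + e * c'.2 j).
exists ([seq F 1 c c' | c <- s, c' <- s'] ++ [seq F (- 1) c c' | c <- s, c' <- s']) => x.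
rewrite big_cat /= !big_flatten !big_map -big_split /= fs gs' big_distrlr /=.
apply: eq_bigr => c _; rewrite !big_map -big_split /=; apply: eq_bigr => c' _.
set A := \sum_(j <- J) c.2 j * x j; set B := \sum_(j <- J) c'.2 j * x j.
have E e : \sum_(j <- J) (c.2 j + e * c'.2 j) * x j = A + e * B.
  rewrite /A /B mulr_sumr -big_split /=; apply: eq_bigr => j _; ring.
rewrite !E.
have -> : c.1.2 + 1 * c'.1.2 + (A + 1 * B) = (c.1.2 + A) + (c'.1.2 + B) by ring.
have -> : c.1.2 + -1 * c'.1.2 + (A + -1 * B) = (c.1.2 + A) - (c'.1.2 + B) by ring.
by move: (c.1.2 + A) (c'.1.2 + B) => u v; rewrite cosD cosB; field.
Qed.

Lemma trig_poly_sum (K : Type) (r : seq K) (F : K -> (I -> R) -> R) :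
  (forall k, trig_poly (F k)) -> trig_poly (fun x => \sum_(k <- r) F k x).
Proof.
move=> tF; elim: r => [|k r ih].
  by under [X in trig_poly X]eq_fun do rewrite big_nil; exact: trig_poly_cst.
by under [X in trig_poly X]eq_fun do rewrite big_cons; exact: trig_polyD.
Qed.

Lemma trig_poly_prod (K : Type) (r : seq K) (F : K -> (I -> R) -> R) :
  (forall k, trig_poly (F k)) -> trig_poly (fun x => \prod_(k <- r) F k x).
Proof.
move=> tF; elim: r => [|k r ih].
  by under [X in trig_poly X]eq_fun do rewrite big_nil; exact: trig_poly_cst.
by under [X in trig_poly X]eq_fun do rewrite big_cons; exact: trig_polyM.
Qed.

Lemma trig_poly_sin (i : I) (a : R) : uniq J -> i \in J -> trig_poly (fun x => sin (a * x i)).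
Proof.
move=> uJ iJ; exists [:: (1, - (pi / 2), fun j => if j == i then a else 0)] => x.
rewrite big_seq1 /= mul1r (bigD1_seq i)//= eqxx big1 => [|j /negbTE ->]; last by rewrite mul0r.
by rewrite addr0 addrC cosBpihalf.
Qed.

Lemma trig_poly_bernstein f N k : trig_poly f -> trig_poly (fun x => bernstein (f x) N k).
Proof.
move=> tf; elim: N k => [|N ih] k /=; first exact: trig_poly_cst.
apply: trig_polyD.
  by case: k => [|k]; [exact: trig_poly_cst|exact: trig_polyM].
apply: trig_polyM => //; apply: trig_polyD; first exact: trig_poly_cst.
rewrite (_ : (fun x => - f x) = (fun x => - 1 * f x)).
  by apply: trig_polyM => //; exact: trig_poly_cst.
by apply/funext => x; rewrite mulN1r.
Qed.

End trigonometric_polynomials.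

Section first_coordinates.
Context {I : countType}.

(** Numbers that code no index are dropped, so the list may be shorter than [m], for instance when
    [I] is finite. *)
Definition first_coords (m : nat) : seq I := pmap (@pickle_inv I) (iota 0 m).

Lemma first_coords_uniq m : uniq (first_coords m).
Proof. exact: (pmap_uniq (@pickle_invK I) (iota_uniq 0 m)). Qed.

Lemma mem_first_coords m i : (i \in first_coords m) = (pickle i < m)%N.
Proof.
rewrite mem_pmap; apply/mapP/idP => [[k]|im].
  rewrite mem_iota add0n => /andP[_ km] ki.
  by have := @pickle_invK I k; rewrite -ki /= => ->.
by exists (pickle i); rewrite ?mem_iota ?pickleK_inv.
Qed.

End first_coordinates.

(** * Continuity and compactness in the product topology *)

Section product_topology.
Context {R : realType} {I : countType}.

(** A single integer controls both the number of coordinates and the precision, which gives a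
    countable decreasing base of entourages for pointwise convergence. *)
Definition close_upto (n : nat) (x y : I -> R) :=
  forall i, (pickle i < n)%N -> `|x i - y i| <= n.+1%:R^-1.

(** The sets [close_upto n x] generate a filter that converges to [x] coordinatewise, and continuity
    is read along this filter. *)
Lemma continuous_close_upto (g : (I -> R) -> R) (x : I -> R) (e : R) :
  continuous (g : {ptws I -> R} -> R) -> 0 < e ->
  exists n, forall y, close_upto n x y -> `|g x - g y| <= e.
Proof.
move=> cg e0; pose F := filter_from [set: nat] (fun n => [set y | close_upto n x y]).
have FF : Filter F.
  apply: filter_from_filter; first by exists 0%N.
  move=> a b _ _; exists (maxn a b) => // y xy.
  have le k : (k <= maxn a b)%N -> close_upto k x y.
    move=> ki i ik; apply: (le_trans (xy i (leq_trans ik ki))).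
    by rewrite lef_pV2 ?posrE ?ltr0n// ler_nat.
  by split; apply: le; rewrite ?leq_maxl ?leq_maxr.
have Fx : F --> (x : {ptws I -> R}).
  apply: (@pointwise_cvgP (discrete_topology I) _ F x FF).2 => i.
  apply/cvgrPdist_le => d d0.
  have [N dN] : exists N : nat, N.+1%:R^-1 <= d.
    exists (Num.truncn d^-1); rewrite -[leRHS]invrK lef_pV2 ?posrE ?ltr0n ?invr_gt0//.
    by rewrite ltW// truncnS_gt.
  exists (maxn N (pickle i).+1) => // y /(_ i); rewrite leq_max leqnn orbT => /(_ isT).
  move=> /le_trans; apply; apply: le_trans dN.
  by rewrite lef_pV2 ?posrE ?ltr0n// ler_nat ltnS leq_maxl.
have : g y @[y --> F] --> g x by apply: cvg_comp; [exact: Fx|exact: cg].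
by move=> /cvgrPdist_le/(_ _ e0)[n _ h]; exists n.
Qed.

Lemma nbhs_norm_le (a c : R) : 0 < c -> nbhs a [set z | `|a - z| <= c].
Proof. by move=> c0; near=> z; near: z; exact: cvgr_dist_le. Unshelve. all: by end_near. Qed.

(** A form of Heine's theorem in which [y] is not confined to [K]: the grid points compared with [x]
    later may leave the box. *)
Lemma compact_close_upto (K : set (I -> R)) (g : (I -> R) -> R) (e : R) :
  continuous (g : {ptws I -> R} -> R) -> compact (K : set {ptws I -> R}) -> 0 < e ->
  \forall n \near \oo, forall x, K x -> forall y, close_upto n x y -> `|g x - g y| <= e.
Proof.
move=> cg cK e0; have e2 : 0 < e / 2 by rewrite divr_gt0.
apply: ((compact_near_coveringP (K : set {ptws I -> R})).1 cK nat \oo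
  (fun n x => forall y, close_upto n x y -> `|g x - g y| <= e)) => x Kx.
have [n0 n0P] := continuous_close_upto x cg e2.
(* Half of the precision at [x] is left for the passage to a nearby [x'] and half for the passage
   from [x'] to [y]; hence also the requirement [n >= 2 (n0 + 1)]. *)
pose c : R := (2 * n0.+1%:R)^-1.
have c0 : 0 < c by rewrite invr_gt0 mulr_gt0 ?ltr0n.
exists ([set x' : {ptws I -> R} | forall a : 'I_n0,
    oapp (fun i => `|x i - x' i| <= c) true (pickle_inv a)],
  [set n | (2 * n0.+1 <= n)%N]) => /=.
  split; last by exists (2 * n0.+1)%N.
  have near_coord i : nbhs (x : {ptws I -> R}) [set x' : {ptws I -> R} | `|x i - x' i| <= c].
    have xi : (y i) @[y --> nbhs (x : {ptws I -> R})] --> x i.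
      exact: (@proj_continuous I (fun _ => R) i x).
    by apply: (xi [set z : R | `|x i - z| <= c]); exact: nbhs_norm_le.
  have : forall a : 'I_n0, nbhs (x : {ptws I -> R})
      [set x' : {ptws I -> R} | oapp (fun i => `|x i - x' i| <= c) true (pickle_inv a)].
    move=> a; case: (pickle_inv a) => [i|] /=; first exact: near_coord.
    exact: (@filterE _ _ (@nbhs_filter {ptws I -> R} x)).
  by move=> /filter_forall; apply; exact: (@nbhs_filter {ptws I -> R} x).
move=> [x' n] /= [xx' nn] y x'y.
have n0n : (n0 <= n)%N by rewrite (leq_trans _ nn)// (leq_trans (leqnSn _))// leq_pmull.
have cc : c + c = n0.+1%:R^-1 by rewrite /c; field; rewrite nat1r pnatr_eq0.
have xi i : (pickle i < n0)%N -> `|x i - x' i| <= c.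
  by move=> ni; have := xx' (Ordinal ni); rewrite /= pickleK_inv.
have xx : `|g x - g x'| <= e / 2.
  by apply: n0P => i ni; rewrite -cc (le_trans (xi i ni))// lerDr ltW.
have xy : `|g x - g y| <= e / 2.
  apply: n0P => i ni; rewrite -cc (le_trans (ler_distD (x' i) _ _))// lerD ?xi//.
  rewrite (le_trans (x'y i (leq_trans ni n0n)))// lef_pV2 ?posrE ?ltr0n ?mulr_gt0 ?ltr0n//.
  by rewrite -natrM ler_nat (leq_trans nn).
by rewrite [e](splitr e) (le_trans (ler_distD (g x) _ _))// lerD// distrC.
Qed.

Lemma compact_box (M : I -> R) :
  compact ([set x : I -> R | forall i, `|x i| <= M i] : set {ptws I -> R}).
Proof.
rewrite (_ : [set x | _] = [set x : I -> R | forall i, `[- M i, M i]%classic (x i)]).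
  exact: (@tychonoff I (fun _ => R) (fun i => `[- M i, M i]%classic)
    (fun i => @segment_compact R _ _)).
by apply/seteqP; split => x /= xM i; have := xM i; rewrite in_itv /= ler_norml.
Qed.

End product_topology.

(** * Bernstein approximation by trigonometric polynomials *)

Section trigonometric_approximation.
Context {R : realType} {I : countType}.
Variables (g : (I -> R) -> R) (M : R).
Hypothesis g_continuous : continuous (g : {ptws I -> R} -> R).
Hypothesis g_le : forall x, `|g x| <= M.

Let coord (x : I -> R) (a : nat) : R := oapp x 0 (pickle_inv a).

(** The success probability of the binomial law in coordinate [a], chosen so that the grid value
    [L (2 k / N - 1)] has mean [L sin (x_a / L)]. *)
Let angle (L : R) (x : I -> R) a := (1 + sin (L^-1 * coord x a)) / 2.

Let grid (m N : nat) (L : R) (f : {ffun 'I_m -> 'I_N.+1}) (i : I) : R :=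
  if insub (pickle i) is Some a then L * (2 * (f a)%:R / N%:R - 1) else 0.

(* The Bernstein polynomial of [g] on the cube [-L, L]^m, in which the coordinate
   [x_a] is replaced by [L * sin (x_a / L)]: this makes it a trigonometric
   polynomial without leaving the cube. *)
Definition bernstein_approx m N L x := \sum_(f : {ffun 'I_m -> 'I_N.+1})
  (\prod_(a < m) bernstein (angle L x a) N (f a)) * g (grid L f).

Let angle01 L x a : 0 <= angle L x a <= 1.
Proof.
rewrite /angle; have := sin_geN1 (L^-1 * coord x a); have := sin_le1 (L^-1 * coord x a).
by lra.
Qed.

Let weight_ge0 m N L x (f : {ffun 'I_m -> 'I_N.+1}) :
  0 <= \prod_(a < m) bernstein (angle L x a) N (f a).
Proof. by apply: prodr_ge0 => a _; exact: bernstein_ge0. Qed.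

Let weight_sum1 m N L x :
  \sum_(f : {ffun 'I_m -> 'I_N.+1}) \prod_(a < m) bernstein (angle L x a) N (f a) = 1.
Proof.
apply: (product_weights_sum1 (w := fun (a : 'I_m) k => bernstein (angle L x a) N k)) => a.
exact: bernstein_sum1.
Qed.

Lemma bernstein_approx_le m N L x : `|bernstein_approx m N L x| <= M.
Proof.
rewrite (le_trans (ler_norm_sum _ _ _))//.
rewrite [leRHS](_ : M = (\sum_(f : {ffun 'I_m -> 'I_N.+1})
  \prod_(a < m) bernstein (angle L x a) N (f a)) * M); last by rewrite weight_sum1 mul1r.
rewrite mulr_suml.
by apply: ler_sum => f _; rewrite normrM ger0_norm// ler_wpM2l.
Qed.

Lemma trig_poly_bernstein_approx m N L : trig_poly (first_coords m) (bernstein_approx m N L).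
Proof.
apply: trig_poly_sum => f; apply: trig_polyM; last exact: trig_poly_cst.
apply: trig_poly_prod => a; apply: trig_poly_bernstein.
apply: trig_polyM; last exact: trig_poly_cst.
apply: trig_polyD; first exact: trig_poly_cst.
rewrite /coord; case E : (pickle_inv a) => [i|] /=; last exact: trig_poly_cst.
apply: trig_poly_sin; first exact: first_coords_uniq.
rewrite mem_first_coords; have := @pickle_invK I a; rewrite E /= => ->.
exact: ltn_ord.
Qed.

Let coord_grid m N L (f : {ffun 'I_m -> 'I_N.+1}) (a : 'I_m) :
  coord (grid L f) a = if @pickle_inv I a is Some i then L * (2 * (f a)%:R / N%:R - 1) else 0 :> R.
Proof.
rewrite /coord; have := @pickle_invK I a; case: (pickle_inv a) => [i|]//= pia.
by rewrite /grid pia valK.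
Qed.

(* The mean of the grid point in coordinate [a] is [L * sin (x_a / L)] and its
   variance is at most [L^2 / N]. *)
Lemma grid_second_moment m N L x (a : 'I_m) : 0 < L -> (0 < N)%N ->
  \sum_(f : {ffun 'I_m -> 'I_N.+1}) (\prod_(b < m) bernstein (angle L x b) N (f b)) *
    (coord x a - coord (grid L f) a) ^+ 2 <=
  L ^+ 2 / N%:R + (coord x a - L * sin (L^-1 * coord x a)) ^+ 2.
Proof.
move=> L0 N0; have N0' : 0 < N%:R :> R by rewrite ltr0n.
have rhs0 : 0 <= L ^+ 2 / N%:R + (coord x a - L * sin (L^-1 * coord x a)) ^+ 2.
  by rewrite addr_ge0 ?divr_ge0 ?sqr_ge0// ltW.
under eq_bigr do rewrite coord_grid.
case E : (@pickle_inv I a) => [i|]; last first.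
  rewrite big1// => f _; rewrite /coord E /= subr0 expr0n /= mulr0//.
set X := coord x a; set y := angle L x a.
rewrite (product_weights_marginal (w := fun (a : 'I_m) k => bernstein (angle L x a) N k)
  (fun a => bernstein_sum1 _ _) a (fun k => (X - L * (2 * k%:R / N%:R - 1)) ^+ 2)) -/y.
(* The coordinate in grid units, that is [X = L (2 c / N - 1)], which brings the sum to the form of
   [bernstein_variance]. *)
pose c := N%:R * (X / L + 1) / 2.
have -> : \sum_(k < N.+1) bernstein y N k * (X - L * (2 * k%:R / N%:R - 1)) ^+ 2 =
    (2 * L / N%:R) ^+ 2 * \sum_(k < N.+1) bernstein y N k * (k%:R - c) ^+ 2.
  rewrite mulr_sumr; apply: eq_bigr => k _.
  by rewrite /c; field; rewrite !gt_eqF.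
rewrite bernstein_variance mulrDr.
have -> : (2 * L / N%:R) ^+ 2 * (N%:R * y - c) ^+ 2 = (X - L * sin (L^-1 * X)) ^+ 2.
  by rewrite /c /y /angle -/X; field; rewrite !gt_eqF.
rewrite lerD2r.
have -> : (2 * L / N%:R) ^+ 2 * (N%:R * (y * (1 - y))) = (L ^+ 2 / N%:R) * (4 * (y * (1 - y))).
  by field; rewrite gt_eqF.
rewrite ler_piMr ?divr_ge0 ?sqr_ge0 ?(ltW N0')//.
by have := sqr_ge0 (1 - 2 * y); lra.
Qed.

(** Bernstein's argument by Chebyshev: if [z] is not close to [x], one of the first [n] coordinates
    differs by more than [1 / (n + 1)], so [2 M] is at most [2 M (n + 1)^2] times the sum of squared
    differences. Averaging over the grid leaves second moments. *)
Lemma bernstein_approx_dist m N L n x e : 0 < L -> (0 < N)%N -> (n <= m)%N ->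
  (forall z, close_upto n x z -> `|g x - g z| <= e) ->
  `|g x - bernstein_approx m N L x| <= e + 2 * M * n.+1%:R ^+ 2 *
    \sum_(a < n) (L ^+ 2 / N%:R + (coord x a - L * sin (L^-1 * coord x a)) ^+ 2).
Proof.
move=> L0 N0 nm xe.
have M0 : 0 <= M by exact: le_trans (normr_ge0 _) (g_le x).
have e0 : 0 <= e.
  by apply: le_trans (xe x _) => // i _; rewrite subrr normr0 invr_ge0.
pose C := 2 * M * n.+1%:R ^+ 2.
have C0 : 0 <= C by rewrite mulr_ge0 ?mulr_ge0// sqr_ge0.
have gz z : `|g x - g z| <= e + C * \sum_(a < n) (coord x a - coord z a) ^+ 2.
  have [xz|/existsNP[i /not_implyP[ni /negP]]] := pselect (close_upto n x z).
    rewrite (le_trans (xe z xz))// lerDl mulr_ge0// sumr_ge0// => a _; exact: sqr_ge0.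
  rewrite -ltNge => xzi.
  rewrite (@le_trans _ _ (2 * M))//.
    by rewrite (le_trans (ler_normB _ _))// mulrDl mul1r lerD.
  apply: (@le_trans _ _ (C * \sum_(a < n) (coord x a - coord z a) ^+ 2)); last by rewrite lerDr.
  rewrite -[leLHS]mulr1 /C -[leRHS]mulrA ler_wpM2l ?mulr_ge0//.
  rewrite (bigD1 (Ordinal ni))//= mulrDr -[leLHS]addr0 lerD//; last first.
    by rewrite mulr_ge0 ?sqr_ge0 ?sumr_ge0// => a _; exact: sqr_ge0.
  rewrite /coord pickleK_inv /= -exprMn -[leLHS](expr1n _ 2) -[leRHS]real_normK ?num_real//.
  rewrite lerXn2r ?nnegrE// normrM ger0_norm// -ler_pdivrMl ?ltr0n// mulr1.
  exact: ltW.
have -> : g x - bernstein_approx m N L x = \sum_(f : {ffun 'I_m -> 'I_N.+1})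
    (\prod_(a < m) bernstein (angle L x a) N (f a)) * (g x - g (grid L f)).
  under eq_bigr do rewrite mulrBr; rewrite sumrB -mulr_suml weight_sum1 mul1r.
  by [].
rewrite (le_trans (ler_norm_sum _ _ _))//.
apply: (@le_trans _ _ (\sum_(f : {ffun 'I_m -> 'I_N.+1})
    (\prod_(a < m) bernstein (angle L x a) N (f a)) *
    (e + C * \sum_(a < n) (coord x a - coord (grid L f) a) ^+ 2))).
  by apply: ler_sum => f _; rewrite normrM ger0_norm// ler_wpM2l.
under eq_bigr do rewrite mulrDr mulrCA mulr_sumr.
rewrite big_split /= -mulr_suml weight_sum1 mul1r lerD2l -mulr_sumr ler_wpM2l//.
rewrite exchange_big /=; apply: ler_sum => a _.
exact: (@grid_second_moment m N L x (widen_ord nm a)).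
Qed.

(** With [L = m + 1] and [N = (m + 1)^4] the grid variance [L^2 / N] is at most [(m + 1)^(-2)],
    while a growing [L] makes [L sin (x / L)] tend to [x]. *)
Definition trig_approx m := bernstein_approx m (m.+1 ^ 4) m.+1%:R.

(** The cubic Taylor bound gives a defect of at most [Q^3 / L^2]; a rate [1 / L] after squaring is
    enough. *)
Let sin_defect (L X Q : R) : 1 <= L -> `|X| <= Q ->
  (X - L * sin (L^-1 * X)) ^+ 2 <= Q ^+ 6 / L.
Proof.
move=> L1 XQ; have L0 : 0 < L by rewrite (lt_le_trans ltr01).
have Q0 : 0 <= Q by rewrite (le_trans _ XQ).
have h : `|X - L * sin (L^-1 * X)| <= Q ^+ 3 / L.
  rewrite (_ : X - _ = L * (L^-1 * X - sin (L^-1 * X))); last by field; rewrite gt_eqF.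
  rewrite normrM (ger0_norm (ltW L0)) distrC.
  apply: (@le_trans _ _ (L * (L^-1 * Q) ^+ 3)).
    rewrite ler_pM2l// (le_trans (sin_taylor _))// lerXn2r ?nnegrE ?mulr_ge0 ?invr_ge0 ?(ltW L0)//.
    by rewrite normrM normfV (ger0_norm (ltW L0)) ler_pM2l ?invr_gt0.
  rewrite (_ : _ * _ ^+ 3 = (Q ^+ 3 / L) * L^-1); last by field; rewrite gt_eqF.
  by rewrite ler_piMr ?divr_ge0 ?exprn_ge0 ?(ltW L0)// invf_le1.
rewrite -real_normK ?num_real//; apply: (@le_trans _ _ ((Q ^+ 3 / L) ^+ 2)).
  by rewrite lerXn2r ?nnegrE// divr_ge0 ?exprn_ge0// ltW.
rewrite (_ : _ ^+ 2 = (Q ^+ 6 / L) * L^-1); last by field; rewrite gt_eqF.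
by rewrite ler_piMr ?divr_ge0 ?exprn_ge0 ?(ltW L0)// invf_le1.
Qed.

Lemma trig_approx_cvg (b : I -> R) (e : R) : 0 < e ->
  \forall m \near \oo, forall x, (forall i, `|x i| <= b i) -> `|g x - trig_approx m x| <= e.
Proof.
move=> e0; have e2 : 0 < e / 2 by rewrite divr_gt0.
have [n _ nP] := compact_close_upto g_continuous (@compact_box R I b) e2.
have {}nP := nP n (leqnn n).
(* A common bound for the first [n] coordinates on the box; only these enter the error, although the
   polynomial uses [m] of them. *)
pose Q := \sum_(a < n) `|oapp b 0 (@pickle_inv I a)|.
have Q0 : 0 <= Q by exact: sumr_ge0.
have coordQ x (a : 'I_n) : (forall i, `|x i| <= b i) -> `|coord x a| <= Q.
  move=> xb; rewrite /Q (bigD1 a)//= -[leLHS]addr0 lerD ?sumr_ge0// /coord.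
  case: (pickle_inv a) => [i|] /=; last by rewrite normr0.
  by rewrite (le_trans (xb i))// ler_norm.
pose D := 2 * M * n.+1%:R ^+ 2 * (n%:R * (1 + Q ^+ 6)).
near=> m => x xb.
have nm : (n <= m)%N by near: m; exact: nbhs_infty_ge.
have m0 : 0 < m.+1%:R :> R by rewrite ltr0n.
have m1 : 1 <= m.+1%:R :> R by rewrite ler1n.
have M0 : 0 <= M by exact: le_trans (normr_ge0 _) (g_le x).
have /le_trans -> // := bernstein_approx_dist m0 (expn_gt0 m.+1 4 : (0 < m.+1 ^ 4)%N) nm (nP x xb).
rewrite [leRHS](splitr e) lerD2l.
apply: (@le_trans _ _ (D / m.+1%:R)).
  rewrite /D -[leRHS]mulrA ler_wpM2l ?mulr_ge0 ?sqr_ge0//.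
  have -> : n%:R * (1 + Q ^+ 6) / m.+1%:R = \sum_(a < n) (1 + Q ^+ 6) / m.+1%:R.
    by rewrite sumr_const card_ord -[RHS]mulr_natl mulrA.
  apply: ler_sum => a _; rewrite mulrDl mul1r lerD//; last first.
    by apply: sin_defect => //; exact: coordQ.
  rewrite natrX (_ : _ / _ = m.+1%:R^-1 * m.+1%:R^-1); last by field; rewrite gt_eqF.
  by rewrite ler_piMr ?invr_ge0 ?(ltW m0)// invf_le1.
rewrite ler_pdivrMr// mulrC -ler_pdivrMr//.
apply: (@le_trans _ _ m%:R); last by rewrite ler_nat.
by near: m; exact: nbhs_infty_ger.
Unshelve. all: by end_near. Qed.

Lemma trig_approx_cvg_pointwise x : trig_approx m x @[m --> \oo] --> g x.
Proof.
apply/cvgrPdist_le => e e0.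
have := trig_approx_cvg (fun i => `|x i|) e0.
by apply: filterS => m; apply.
Qed.

End trigonometric_approximation.

(** * From characteristic functions to stable convergence *)

Section image_law.
Context {R : realType} {d d' : measure_display}.
Context {T : measurableType d} {U : measurableType d'}.

Lemma expect_image_law (mu : probability T R) (nu : probability U R) (l : T -> U) (f : U -> R) :
  measurable_fun setT l -> (forall B, measurable B -> mu (l @^-1` B) = nu B) ->
  bounded_rv f -> expect mu (fun x => f (l x)) = expect nu f.
Proof.
move=> ml munu bf; have bfl : bounded_rv (fun x => f (l x)).
  by case: bf => mf [M fM]; split; [exact: measurableT_comp|exists M].
rewrite /expect; congr fine.
rewrite -[LHS](@integral_pushforward _ _ _ _ R _ ml mu setT (EFin \o f))//.
- by apply: eq_measure_integral => B mB _; exact: munu.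
- by apply/measurable_EFinP; exact: bf.1.
- exact: bounded_integrable bfl.
Qed.

End image_law.

Lemma expect_cos_gauss1 {R : realType} {d : measure_display} {T : measurableType d}
    (mu : probability T R) (l : T -> R) (v th : R) :
  measurable_fun setT l -> 0 <= v ->
  (forall B : set R, measurable B -> mu (l @^-1` B) = gauss1 0 v B) ->
  expect mu (fun x => cos (th + l x)) = cos th * expR (- (v / 2)).
Proof.
move=> ml v0; rewrite /gauss1.
have bcos : bounded_rv (fun x : R => cos (th + x)).
  by apply: bounded_rv_cos; apply: measurable_funD.
have [->|vN0] := eqVneq v 0 => muE.
  rewrite (@expect_image_law _ _ _ _ _ mu (\d_(0 : R)) l (fun x => cos (th + x)))//.
  rewrite mul0r oppr0 expR0 mulr1 /expect integral_dirac//.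
    by rewrite diracT mul1e addr0.
  by apply/measurable_EFinP; exact: bcos.1.
have s0 : 0 < Num.sqrt v by rewrite sqrtr_gt0 lt_neqAle eq_sym vN0.
rewrite (@expect_image_law _ _ _ _ _ mu (normal_prob 0 (Num.sqrt v)) l (fun x => cos (th + x)))//.
rewrite expect_normal_prob//.
under eq_Rintegral do rewrite addrC.
by rewrite normal_pdf_cos// sqr_sqrtr.
Qed.

(** * Measurability and tightness on countable products *)

Section countable_products.
Context {R : realType} {I : countType}.

Lemma measurable_coord (i : I) : measurable_fun setT (fun x : RI I R => x i).
Proof.
move=> _ B mB; rewrite setTI.
by apply: sub_sigma_algebra; exists i, B.
Qed.

Lemma measurable_linear_form (J : seq I) (t : I -> R) :
  measurable_fun setT (fun x : RI I R => \sum_(j <- J) t j * x j).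
Proof.
by apply: measurable_sum => j; apply: measurable_funM => //; exact: measurable_coord.
Qed.

Lemma measurable_trig_poly (J : seq I) (f : (I -> R) -> R) :
  trig_poly J f -> measurable_fun setT (f : RI I R -> R).
Proof.
move=> [s fs]; rewrite (_ : f = fun x : RI I R =>
  \sum_(c <- s) c.1.1 * cos (c.1.2 + \sum_(j <- J) c.2 j * x j)); last exact/funext.
apply: measurable_sum => c; apply: measurable_funM => //.
apply: bounded_rv_measurable; apply: bounded_rv_cos.
by apply: measurable_funD => //; exact: measurable_linear_form.
Qed.

(** Continuity refers to the product topology and measurability to the product sigma-algebra; they
    are linked by writing [g] as a pointwise limit of trigonometric polynomials in finitely many
    coordinates. *)
Lemma continuous_bounded_rv (g : (I -> R) -> R) : continuous (g : {ptws I -> R} -> R) ->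
  (exists M : R, forall x, `|g x| <= M) -> bounded_rv (g : RI I R -> R).
Proof.
move=> cg [M gM]; split; last by exists M.
apply: (@measurable_fun_cvg _ (RI I R) R setT (fun m => trig_approx g m)) => //.
  by move=> m; exact: (measurable_trig_poly (trig_poly_bernstein_approx _ _ _ _)).
by move=> x _; exact: (trig_approx_cvg_pointwise cg gM).
Qed.

Lemma measurable_family {d} {T : measurableType d} (Z : T -> I -> R) :
  (forall i, measurable_fun setT (Z ^~ i)) -> measurable_fun setT (Z : T -> RI I R).
Proof.
move=> mZ; apply: (@measurability _ _ T (RI I R) setT _ (@coord_sets I R)) => //.
move=> _ [_ [i [B [mB ->]]] <-]; rewrite setTI.
by have := mZ i measurableT B mB; rewrite setTI.
Qed.

(** A union bound over the codes of the indices, with geometric weights that sum to 1. *)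
Lemma box_complement_le {d} {T : measurableType d} (P : probability T R)
    (Y : T -> I -> R) (b : I -> R) (e : R) : 0 <= e ->
  (forall i, measurable_fun setT (Y ^~ i)) ->
  (forall i, (P [set w | (b i < `|Y w i|)%R] <= (e / (2 ^ (pickle i).+1)%:R)%:E)%E) ->
  measurable [set w | exists i, b i < `|Y w i|] /\
  (P [set w | exists i, (b i < `|Y w i|)%R] <= e%:E)%E.
Proof.
move=> e0 mY Ye.
pose F n : set T := if @pickle_inv I n is Some i then [set w | b i < `|Y w i|] else set0.
have mF n : measurable (F n).
  rewrite /F; case: pickle_inv => [i|]; last exact: measurable0.
  rewrite (_ : [set w | _] = ~` [set w | `|Y w i| <= b i]).
    by apply: measurableC; exact: measurable_norm_le.
  by apply/seteqP; split => w /=; rewrite ltNge => /negP.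
have E : [set w | exists i, b i < `|Y w i|] = \bigcup_n F n.
  apply/seteqP; split => w /=.
    by move=> [i iw]; exists (pickle i) => //; rewrite /F pickleK_inv.
  by move=> [n _]; rewrite /F; case: pickle_inv => // i iw; exists i.
have mU : measurable [set w | exists i, b i < `|Y w i|].
  by rewrite E; exact: bigcup_measurable.
split => //; apply: le_trans (epsilon_trick0 xpredT e0).
apply: (@le_trans _ _ (\sum_(0 <= n <oo) P (F n))%E).
  by apply: measure_sigma_subadditive => //; rewrite E.
apply: lee_nneseries => // n _; rewrite /F.
have := @pickle_invK I n; case: pickle_inv => [i /= <-|_]; first exact: Ye.
by rewrite measure0 lee_fin divr_ge0.
Qed.

End countable_products.

(** * Stable convergence from convergence of cosines *)

Section stable_convergence.
Context {R : realType} {d : measure_display} {T : measurableType d} {I : countType}.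
Variables (P : probability T R) (Z : nat -> T -> I -> R).
Variable beta : T -> probability (RI I R) R.
Hypothesis Z_measurable : forall n i, measurable_fun setT (Z n ^~ i).
Hypothesis beta_random : random_prob beta.

Lemma chebyshev_sqr (Y : T -> R) (b : R) : measurable_fun setT Y ->
  integrable_rv P (fun w => Y w ^+ 2) -> 0 < b ->
  (P [set w | (b < `|Y w|)%R] <= (expect P (fun w => Y w ^+ 2) / b ^+ 2)%:E)%E.
Proof.
move=> mY Yi b0; set B := [set w | _].
have mB : measurable B.
  rewrite (_ : B = ~` [set w | `|Y w| <= b]).
    by apply: measurableC; exact: measurable_norm_le.
  by apply/seteqP; split => w /=; rewrite /B /= ltNge => /negP.
rewrite -(fineK (fin_num_measure P B mB)) lee_fin -expect_indic// ler_pdivlMr ?exprn_gt0//.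
rewrite mulrC -expectZ; last by apply: bounded_integrable; exact: bounded_rv_indic.
apply: expect_le => //.
  by apply: integrable_rvZ; apply: bounded_integrable; exact: bounded_rv_indic.
move=> w; rewrite indicE; case: (boolP (w \in B)); last by rewrite mulr0 sqr_ge0.
rewrite inE /B /= mulr1 -(real_normK (num_real (Y w))) => bY.
by rewrite lerXn2r ?nnegrE ?(ltW b0) ?(ltW bY).
Qed.

Lemma integral_set_expect (A : set T) (f : T -> R) : measurable A -> bounded_rv f ->
  (\int[P]_(w in A) (f w)%:E)%E = (expect P (fun w => \1_A w * f w))%:E.
Proof.
move=> mA bf; rewrite expect_indicM// fineK//.
apply: integrable_fin_num => //; apply: (integrableS measurableT) => //.
exact: bounded_integrable.
Qed.

(** The two sides are approximated differently. For [Z n] a box uniform in [n] is needed, supplied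
    by the second moments; on the side of [beta], pointwise convergence and the common bound [M]
    suffice. *)
Theorem stable_conv_cos : (forall i, exists C, forall n,
    integrable_rv P (fun w => Z n w i ^+ 2) /\ expect P (fun w => Z n w i ^+ 2) <= C) ->
  (forall (A : set T) (J : seq I) (t : I -> R) (th : R), measurable A -> uniq J ->
    expect P (fun w => \1_A w * cos (th + \sum_(j <- J) t j * Z n w j)) @[n --> \oo] -->
    expect P (fun w => \1_A w *
      expect (beta w) (fun y => cos (th + \sum_(j <- J) t j * y j)))) ->
  stable_conv P Z beta.
Proof.
move=> Z2 Zcos; split => // A mA g cg gb.
have bg := continuous_bounded_rv cg gb; have [M gM] := gb.
have b1 : bounded_rv (\1_A : T -> R) := bounded_rv_indic mA.
have bgZ h n : bounded_rv (h : RI I R -> R) -> bounded_rv (fun w => h (Z n w)).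
  move=> [mh [N hN]]; split; last by exists N.
  apply: measurableT_comp mh _; exact: measurable_family.
under eq_fun do rewrite (integral_set_expect mA (bgZ _ _ bg)).
under eq_integral do rewrite (expectK (bounded_integrable _ bg)).
rewrite (integral_set_expect mA (bounded_expect_random_prob beta_random bg)).
apply/cvg_EFin; first exact: nearW.
have bcos J t th : bounded_rv (fun y : RI I R => cos (th + \sum_(j <- J) t j * y j)).
  by apply: bounded_rv_cos; apply: measurable_funD => //; exact: measurable_linear_form.
have Ztrig J h : uniq J -> trig_poly J h -> expect P (fun w => \1_A w * h (Z n w)) @[n --> \oo] -->
    expect P (fun w => \1_A w * expect (beta w) h).
  move=> uJ [s hs].
  rewrite (_ : (fun n => _) = fun n => \sum_(c <- s) c.1.1 *
      expect P (fun w => \1_A w * cos (c.1.2 + \sum_(j <- J) c.2 j * Z n w j))); last first.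
    apply/funext => n; under [in LHS]eq_fun do rewrite hs mulr_sumr.
    rewrite expect_sum => [|c].
      apply: eq_bigr => c _; rewrite -expectZ; first by congr expect; apply/funext => w; ring.
      by apply: bounded_integrable; apply: bounded_rvM => //; exact: (bgZ _ _ (bcos _ _ _)).
    apply: bounded_integrable; apply: bounded_rvM => //; apply: bounded_rvM.
      exact: bounded_rv_cst.
    exact: (bgZ _ _ (bcos _ _ _)).
  rewrite (_ : expect P _ = \sum_(c <- s) c.1.1 * expect P (fun w => \1_A w *
      expect (beta w) (fun y => cos (c.1.2 + \sum_(j <- J) c.2 j * y j)))).
    by apply: cvgr_sum => c; apply: cvgMr; exact: Zcos.
  have bb (c : R * R * (I -> R)) : bounded_rv (fun w =>
      expect (beta w) (fun y => cos (c.1.2 + \sum_(j <- J) c.2 j * y j))).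
    exact: bounded_expect_random_prob.
  rewrite (_ : h = fun y => \sum_(c <- s) c.1.1 *
    cos (c.1.2 + \sum_(j <- J) c.2 j * y j)); last exact/funext.
  rewrite (_ : (fun w => _) = fun w => \sum_(c <- s) c.1.1 * (\1_A w *
      expect (beta w) (fun y => cos (c.1.2 + \sum_(j <- J) c.2 j * y j)))).
    rewrite expect_sum => [|c].
      apply: eq_bigr => c _; rewrite expectZ//.
      by apply: bounded_integrable; exact: bounded_rvM.
    apply: bounded_integrable; apply: bounded_rvM; first exact: bounded_rv_cst.
    exact: bounded_rvM.
  apply/funext => w; rewrite expect_sum => [|c].
    rewrite mulr_sumr; apply: eq_bigr => c _; rewrite expectZ; first ring.
    exact: bounded_integrable.
  by apply: integrable_rvZ; exact: bounded_integrable.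
have btrig m : bounded_rv (trig_approx g m : RI I R -> R).
  split; first exact: (measurable_trig_poly (trig_poly_bernstein_approx _ _ _ _)).
  by exists M => x; exact: bernstein_approx_le.
have M0 : 0 <= M by apply: le_trans (gM (fun _ => 0)).
have approx_beta : expect P (fun w => \1_A w * expect (beta w) (trig_approx g m)) @[m --> \oo] -->
    expect P (fun w => \1_A w * expect (beta w) g).
  apply: (@expect_bounded_cvg _ _ _ _ _ _ M).
  - by move=> m; apply: (bounded_rvM b1 _).1; exact: bounded_expect_random_prob.
  - by apply: (bounded_rvM b1 _).1; exact: bounded_expect_random_prob.
  - move=> m w; rewrite normrM -[leRHS]mul1r ler_pM//.
      by rewrite indicE; case: (_ \in _); rewrite ?normr1 ?normr0.
    apply: expect_bound; first exact: bounded_integrable.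
    by move=> x; exact: bernstein_approx_le.
  - apply: aeW => w; apply: cvgMr; apply: (@expect_bounded_cvg _ _ _ _ _ _ M) => //.
    + by move=> m; exact: (btrig m).1.
    + exact: bg.1.
    + by move=> m x; exact: bernstein_approx_le.
    + by apply: aeW => x; exact: (trig_approx_cvg_pointwise cg gM).
apply/cvgrPdist_le => e e0.
have e4 : 0 < e / 4 by rewrite divr_gt0.
(* Outside the box the integrand is only bounded by [2 M], so an exceptional probability [del] costs
   at most [e / 4]. *)
pose del := e / 4 / (1 + 2 * M).
have M1 : 0 < 1 + 2 * M by rewrite ltr_pwDl// mulr_ge0.
have del0 : 0 < del by rewrite divr_gt0.
have [C C_le] := choice Z2.
have C0 i : 0 <= C i.
  by apply: le_trans (C_le i 0%N).2; apply: expect_ge0 => w; exact: sqr_ge0.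
(* As [b i >= 1], the square of [b i] is at least [C i] over the probability allotted to coordinate
   [i], as Chebyshev requires, and no square root is taken. *)
pose b i := 1 + C i / (del / (2 ^ (pickle i).+1)%:R).
have pow0 i : 0 < del / (2 ^ (@pickle I i).+1)%:R by rewrite divr_gt0// ltr0n expn_gt0.
have b_ge1 i : 1 <= b i by rewrite lerDl divr_ge0// ltW.
have tight n : measurable [set w | exists i, b i < `|Z n w i|] /\
    (P [set w | exists i, (b i < `|Z n w i|)%R] <= del%:E)%E.
  apply: box_complement_le; [exact: ltW|by []|move=> i].
  have bi0 : 0 < b i by rewrite (lt_le_trans ltr01).
  apply: le_trans (chebyshev_sqr (Z_measurable n i) (C_le i n).1 bi0) _.
  rewrite lee_fin ler_pdivrMr ?exprn_gt0// (le_trans (C_le i n).2)//.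
  rewrite -ler_pdivrMl// mulrC (@le_trans _ _ (b i))//; first by rewrite /b lerDr.
  by rewrite expr2 ler_peMl// ltW.
have approx_Z m n : (forall x, (forall i, `|x i| <= b i) -> `|g x - trig_approx g m x| <= e / 4) ->
    `|expect P (fun w => \1_A w * g (Z n w)) - expect P (fun w => \1_A w * trig_approx g m (Z n w))|
    <= e / 4 + e / 4.
  move=> gm; have [mB PB] := tight n; set B := [set w | _] in mB PB.
  rewrite -expectB; try by apply: bounded_integrable; apply: bounded_rvM => //; exact: bgZ.
  have bB : bounded_rv (\1_B : T -> R) := bounded_rv_indic mB.
  apply: (@le_trans _ _ (expect P (fun w => e / 4 + 2 * M * \1_B w))).
    apply: expect_norm_le.
    - by apply: bounded_integrable; apply: bounded_rvB; apply: bounded_rvM => //; exact: bgZ.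
    - apply: bounded_integrable; apply: bounded_rvD; first exact: bounded_rv_cst.
      by apply: bounded_rvM => //; exact: bounded_rv_cst.
    - move=> w; rewrite -mulrBr normrM -[leRHS]mul1r ler_pM//.
        by rewrite indicE; case: (_ \in A); rewrite ?normr1 ?normr0.
      rewrite indicE; case: (boolP (w \in B)) => [_|/negP wB].
        rewrite mulr1 (le_trans (ler_normB _ _))// -[leLHS]add0r lerD ?(ltW e4)//.
        by rewrite mulrDl mul1r lerD ?bernstein_approx_le.
      rewrite mulr0 addr0; apply: gm => i; rewrite leNgt; apply/negP => bi.
      by apply: wB; rewrite inE; exists i.
  have i1 := bounded_integrable P bB.
  have i2 : integrable_rv P (fun _ => e / 4).
    by apply: bounded_integrable; exact: bounded_rv_cst.
  rewrite expectD ?expect_cst ?expectZ//; last exact: integrable_rvZ.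
  rewrite lerD2l expect_indic//.
  have {}PB : fine (P B) <= del.
    by rewrite -lee_fin fineK// fin_num_measure.
  apply: (@le_trans _ _ ((1 + 2 * M) * del)).
    by rewrite ler_pM ?mulr_ge0 ?fine_ge0// lerDr.
  by rewrite /del mulrCA divff ?mulr1// gt_eqF.
have [m [gm bm]] : exists m,
    (forall x, (forall i, `|x i| <= b i) -> `|g x - trig_approx g m x| <= e / 4) /\
    `|expect P (fun w => \1_A w * expect (beta w) g) -
      expect P (fun w => \1_A w * expect (beta w) (trig_approx g m))| <= e / 4.
  have h1 := trig_approx_cvg cg gM b e4; have /cvgrPdist_le/(_ _ e4) h2 := approx_beta.
  by have [m _ mP] := filterI h1 h2; exists m; exact: mP m (leqnn m).
have /cvgrPdist_le/(_ _ e4) := Ztrig _ _ (first_coords_uniq m)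
  (trig_poly_bernstein_approx g m (m.+1 ^ 4) m.+1%:R).
apply: filterS => n h1; have h2 := approx_Z m n gm.
move: h1 h2 bm; rewrite -/(trig_approx g m) /=.
set a1 := expect _ _; set a2 := expect _ _; set a3 := expect _ _; set a4 := expect _ _.
rewrite !ler_distl => /andP[? ?] /andP[? ?] /andP[? ?]; apply/andP; split; lra.
Qed.

End stable_convergence.

Theorem mainTheorem14 (R : realType) (d : measure_display) (Omega : measurableType d)
    (P : probability Omega R) (I : countType) (G : nat -> set (set Omega))
    (X : nat -> I -> Omega -> R) (alpha : I -> Omega -> probability R R) :
  partially_cid P G X ->
  (forall (n : nat) (i : I), (1 <= n)%N ->
     measurable_fun setT (X n i) /\
     P.-integrable setT (fun w => (X n i w ^+ 2)%:E)) ->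
  directing P G X alpha ->
  forall beta : Omega -> probability (RI I R) R,
    random_prob beta ->
    {ae P, forall w, is_centered_gaussian (beta w)
             (fun i j => if i == j then variance_of (alpha i w) else 0)} ->
    stable_conv P (Sn P G X) beta.
Proof.
move=> cid X2 alphaP beta beta_random beta_gauss.
have X2' n i : integrable_rv P (fun w => X n.+1 i w ^+ 2) by exact: (X2 n.+1 i _).2.
have alpha_random i : random_prob (alpha i) by exact: (alphaP i).1.
have [K KP] := choice (fun i => (alphaP i).2).
have K_distr i : forall n, reg_cond_distr P (G n) (X n.+1 i) (K i n) by exact: (KP i).1.
have K_weak i : {ae P, forall w, weak_conv (fun n => K i n w) (alpha i w)} by exact: (KP i).2.
apply: stable_conv_cos => //.
- by move=> n i; have [] := Sn_sqr cid X2' n i.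
- move=> i; exists (expect P (fun w => X 1%N i w ^+ 2)) => n.
  by have [] := Sn_sqr cid X2' n i.
move=> A J t th mA uJ.
apply: (cid_stable_cos cid X2' K_distr K_weak alpha_random) => //.
  apply: measurable_expect_random_prob => //; apply: bounded_rv_cos.
  by apply: measurable_funD => //; exact: measurable_linear_form.
have := alpha_sqr_integrable cid X2' K_distr K_weak alpha_random.
apply: filterS2 beta_gauss => w betaw alpha2.
apply: expect_cos_gauss1; [exact: measurable_linear_form| |exact: betaw].
(* The quadratic form must be nonnegative to be the variance of a normal law. This uses the finite
   second moments of [alpha], since [variance_of] replaces infinite integrals by 0 and could then be
   negative. *)
rewrite (@double_sum_diag _ _ _ _ (fun i => variance_of (alpha i w)))//.
apply: sumr_ge0 => i _; rewrite mulr_ge0 ?sqr_ge0// variance_ofE.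
apply: expect_variance_ge0 => //.
by have [] := expect_norm_sqr (@ltr01 R) (@measurable_id _ _ setT) (alpha2 i).
Qed.
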